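(* Let $(\Omega,\mathcal{F},\mathbb{P})$ be a probability space, let $a,b:\Omega\to[0,1]$ be measurable with $\int_\Omega a_\omega+b_\omega\,d\mathbb{P}(\omega)\ne0$, and let $\{(\Omega,\mathcal{F},\mathbb{P},\sigma,\mathrm{BV}(I),\mathcal{L}^\varepsilon)\}_{\varepsilon\ge0}$ be the family of random dynamical systems of paired tent maps $(T^\varepsilon_\omega)_{\omega\in\Omega}:=(T_{\varepsilon a_\omega,\varepsilon b_\omega})_{\omega\in\Omega}$ on $I=[-1,1]$, where: $\sigma:\Omega\to\Omega$ is an ergodic, $\mathbb{P}$-preserving, invertible transformation; for all $\varepsilon\ge0$ the map $\omega\mapsto T^\varepsilon_\omega$ has finite range; and the skew product $(\omega,x)\mapsto(\sigma\omega,T^\varepsilon_\omega(x))$ is measurable with respect to the product $\sigma$-algebra $\mathcal{F}\otimes\mathcal{B}$ on $\Omega\times I$. Let $(\psi^\varepsilon_\omega)_{\omega\in\Omega}$ denote the functions spanning the second Oseledets spaces of $(\mathcal{L}^\varepsilon_\omega)_{\omega\in\Omega}$, normalised by $\|\psi^\varepsilon_\omega\|_{L^1(\mathrm{Leb})}=1$. Choose the sign of $\psi^\varepsilon_\omega$ such that $\int_{I_L}\psi^\varepsilon_\omega\,d\mathrm{Leb}>0$ for $\mathbb{P}$-a.e. $\omega\in\Omega$. Then as $\varepsilon\to0$, $$\psi^\varepsilon_\omega\xrightarrow{L^1}\psi^0:=\tfrac12\mathbf{1}_{I_L}-\tfrac12\mathbf{1}_{I_R}$$ for $\mathbb{P}$-a.e.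 $\omega\in\Omega$, where $I_L=[-1,0]$ and $I_R=[0,1]$.
   Context: $I=[-1,1]$ with Borel $\sigma$-algebra $\mathcal{B}$ and Lebesgue measure $\mathrm{Leb}$; $L^1=L^1(\mathrm{Leb})$. For $0\le a,b\le1$ the paired tent map $T_{a,b}:I\to I$ is $T_{a,b}(x)=2(1+b)(x+1)-1$ for $x\in[-1,-1/2]$; $-2(1+b)x-1$ for $x\in[-1/2,0)$; $0$ for $x=0$; $-2(1+a)x+1$ for $x\in(0,1/2]$; $2(1+a)(x-1)+1$ for $x\in[1/2,1]$. $T^\varepsilon_\omega=T_{\varepsilon a_\omega,\varepsilon b_\omega}$ is considered for $\varepsilon$ sufficiently small. $\mathcal{L}^\varepsilon_\omega$ is the Perron–Frobenius operator of $T^\varepsilon_\omega$, i.e. $\int_D\mathcal{L}^\varepsilon_\omega f\,d\mathrm{Leb}=\int_{(T^\varepsilon_\omega)^{-1}(D)}f\,d\mathrm{Leb}$ for all Borel $D$, acting on $X=\mathrm{BV}(I)$, the space of functions of bounded variation with norm $\mathrm{var}(f)+\|f\|_{L^1}$; $\mathcal{L}^{\varepsilon\,(n)}_\omega=\mathcal{L}^\varepsilon_{\sigma^{n-1}\omega}\circ\cdots\circ\mathcal{L}^\varepsilon_\omega$. Oseledets spaces. The asymptotic index of compactness of a cocycle $(\mathcal{L}_\omega)$ on $X$ is $\kappa=\lim_{n\to\infty}\frac1n\log\alpha(\mathcal{L}^{(n)}_\omega)$, where $\alpha(A)$ is the infimum of those $t$ such that the image of the unit ball of $X$ under $A$ can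 be covered by finitely many balls of radius $t$ ($\kappa$ is a.e. constant as $\sigma$ is ergodic). An Oseledets splitting consists of isolated Lyapunov exponents $\infty>\lambda_1>\lambda_2>\dots>\lambda_\ell>\kappa\ge-\infty$ ($\ell\ge1$ finite or countably infinite) and subspaces $V_1(\omega),\dots,V_\ell(\omega),W(\omega)$ such that for $\mathbb{P}$-a.e. $\omega$ and all $i$: $\dim V_i(\omega)=m_i<\infty$; $\mathcal{L}_\omega V_i(\omega)=V_i(\sigma\omega)$, $\mathcal{L}_\omega W(\omega)\subseteq W(\sigma\omega)$; $V_1(\omega)\oplus\dots\oplus V_\ell(\omega)\oplus W(\omega)=X$; $\lim_n\frac1n\log\|\mathcal{L}^{(n)}_\omega f\|=\lambda_i$ for $f\in V_i(\omega)\setminus\{0\}$; $\lim_n\frac1n\log\|\mathcal{L}^{(n)}_\omega f\|\le\kappa$ for $f\in W(\omega)\setminus\{0\}$. In the present setting, for all sufficiently small $\varepsilon>0$ the cocycle $(\mathcal{L}^\varepsilon_\omega)$ has such a splitting in which $V^\varepsilon_1(\omega)$ is one-dimensional with $\lambda_1^\varepsilon=0$ and the second Oseledets space $V^\varepsilon_2(\omega)$ is one-dimensional with $\lambda_2^\varepsilon<0$; $\psi^\varepsilon_\omega\in\mathrm{BV}(I)$ denotes a function spanning $V_2^\varepsilon(\omega)$.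
   Formalization: The Oseledets spaces are assumed to depend measurably on ω, and the limit holds for a version of the family: for each ε>0 it equals ψ^ε_ω for P-a.e. ω, since arbitrary ε-dependent null sets would break a.e. convergence over uncountably many ε. *)

(* Defs.v *)
From HB Require Import structures.
From mathcomp Require Import all_boot all_order all_algebra.
From mathcomp Require Import all_classical all_reals all_analysis measurable_realfun.
Import Order.TTheory GRing.Theory Num.Theory.
Import numFieldNormedType.Exports.

Set Implicit Arguments.
Unset Strict Implicit.
Unset Printing Implicit Defensive.

Local Open Scope classical_set_scope.
Local Open Scope ring_scope.

Section ergodic_theory.
Context {R : realType} {d : measure_display} {Omega : measurableType d}.
Variables (P : probability Omega R) (sigma : Omega -> Omega).

Definition measure_preserving : Prop :=
  measurable_fun setT sigma /\
  forall A : set Omega, measurable A -> P (sigma @^-1` A) = P A.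

Definition ergodic : Prop :=
  forall A : set Omega, measurable A -> sigma @^-1` A = A ->
    P A = 0%E \/ P A = 1%E.

Definition invertible : Prop :=
  exists tau : Omega -> Omega,
    [/\ measurable_fun setT tau, cancel sigma tau & cancel tau sigma].

End ergodic_theory.

Section interval.
Context {R : realType}.
Local Notation leb := (@lebesgue_measure R).
Implicit Types (f g : R -> R).

Definition II : set R := `[-1, 1].
Definition IL : set R := `[-1, 0].
Definition IR : set R := `[0, 1].

(* The value outside [-1, 1] is irrelevant; it is constant so that two paired
   tent maps are equal iff they agree on [-1, 1]. *)
Definition tent (a b x : R) : R :=
  if (-1 <= x) && (x <= - 2^-1) then 2 * (1 + b) * (x + 1) - 1
  else if (- 2^-1 <= x) && (x < 0) then - 2 * (1 + b) * x - 1
  else if (0 < x) && (x <= 2^-1) then - 2 * (1 + a) * x + 1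
  else if (2^-1 <= x) && (x <= 1) then 2 * (1 + a) * (x - 1) + 1
  else 0.

Definition psi0 : R -> R :=
  fun x => 2^-1 * \1_IL x - 2^-1 * \1_IR x.

Definition L1norm f : \bar R := (\int[leb]_(x in II) `|f x|%:E)%E.

(* Elements of BV(I) are classes of functions modulo Lebesgue-a.e. equality on
   I: a class is handled through its representatives R -> R, every notion below
   being invariant under eqI, which plays the role of equality in BV(I). *)
Definition eqI f g : Prop := \forall x \ae leb, II x -> f x = g x.

Definition var f : \bar R :=
  ereal_inf [set total_variation (-1) 1 g | g in [set g | eqI f g]].

Definition BVI : set (R -> R) :=
  [set f | measurable_fun II f /\
           exists g, eqI f g /\ bounded_variation (-1) 1 g].

Definition BVnorm f : \bar R := (var f + L1norm f)%E.

Definition is_transfer (T : R -> R) f g : Prop :=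
  leb.-integrable II (EFin \o g) /\
  forall D : set R, measurable D -> D `<=` II ->
    (\int[leb]_(x in D) (g x)%:E =
     \int[leb]_(x in II `&` T @^-1` D) (f x)%:E)%E.

(* The density L f is unique up to a.e. equality; a representative is chosen
   (with a dummy value if there is none). *)
Definition transfer (T : R -> R) f : R -> R :=
  if pselect (exists g, is_transfer T f g) is left h then projT1 (cid h)
  else cst 0.

Definition is_subspace (V : set (R -> R)) : Prop :=
  [/\ V `<=` BVI, V (cst 0),
      forall (c : R) f g, V f -> V g -> V (fun x => c * f x + g x) &
      forall f g, V f -> BVI g -> eqI f g -> V g].

Definition is_basis (m : nat) (V : set (R -> R)) (e : 'I_m -> R -> R) : Prop :=
  [/\ forall j, BVI (e j),
      V = [set f | BVI f /\ exists c : 'I_m -> R,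
                   eqI f (fun x => \sum_(j < m) c j * e j x)] &
      forall c : 'I_m -> R,
        eqI (fun x => \sum_(j < m) c j * e j x) (cst 0) -> forall j, c j = 0].

Definition is_direct_sum (n : nat) (V : nat -> set (R -> R))
    (U : set (R -> R)) : Prop :=
  (forall f, BVI f -> exists (v : nat -> R -> R) (u : R -> R),
     [/\ forall i, (i < n)%N -> V i (v i), U u &
         eqI f (fun x => \sum_(i < n) v i x + u x)]) /\
  (forall (v : nat -> R -> R) (u : R -> R),
     (forall i, (i < n)%N -> V i (v i)) -> U u ->
     eqI (fun x => \sum_(i < n) v i x + u x) (cst 0) ->
     (forall i, (i < n)%N -> eqI (v i) (cst 0)) /\ eqI u (cst 0)).

Definition noncompactness (A : (R -> R) -> (R -> R)) : \bar R :=
  ereal_inf [set t%:E | t in [set t : R |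
    exists (k : nat) (c : 'I_k -> R -> R), (forall j, BVI (c j)) /\
      forall f, BVI f -> (BVnorm f <= 1)%E ->
        exists j, (BVnorm (A f \- c j)%R <= t%:E)%E]].

End interval.

Section oseledets.
Context {R : realType} {d : measure_display} {Omega : measurableType d}.
Variables (P : probability Omega R) (sigma : Omega -> Omega).
Variable L : Omega -> (R -> R) -> (R -> R).
Local Notation leb := (@lebesgue_measure R).

Fixpoint cocycle (n : nat) (w : Omega) (f : R -> R) : R -> R :=
  if n is n'.+1 then L (iter n' sigma w) (cocycle n' w f) else f.

Definition growth (w : Omega) (f : R -> R) (n : nat) : \bar R :=
  ((n%:R^-1)%:E * lne (BVnorm (cocycle n w f)))%E.

Definition is_compactness_index (kappa : \bar R) : Prop :=
  \forall w \ae P,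
    (fun n => (n%:R^-1)%:E * lne (noncompactness (cocycle n w)))%E @ \oo
      --> kappa.

(* The rate of a general vector is a limsup; it is the limit when that exists. *)
Definition slow (w : Omega) (c : \bar R) : set (R -> R) :=
  [set f | BVI f /\ (limn_esup (growth w f) <= c)%E].

(* Indices are shifted by one: expo i, mult i, spaceV i are the (i+1)-st
   exponent, multiplicity and space. num = None means infinitely many. *)
Record splitting := Splitting {
  num : option nat ;
  expo : nat -> R ;
  mult : nat -> nat ;
  compactness_index : \bar R ;
  spaceV : nat -> Omega -> set (R -> R) ;
  spaceW : Omega -> set (R -> R) }.

Definition has_index (S : splitting) (i : nat) : Prop :=
  if num S is Some l then (i < l)%N else True.

(* V is P-a.e. an m-dimensional subspace of BV(I), depending measurably on w:
   it has a basis which is weakly measurable, hence measurable, as a map from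
   Omega to the separable space L^1. Measurability is what makes the splitting
   unique up to P-null sets: the growth conditions only look forward in time,
   and equivariant complements may be altered arbitrarily orbit by orbit. *)
Definition is_measurable_space (m : nat) (V : Omega -> set (R -> R)) : Prop :=
  exists e : Omega -> 'I_m -> R -> R,
    (forall (j : 'I_m) (D : set R), measurable D -> D `<=` II ->
       measurable_fun setT
         (fun w => (\int[leb]_(x in D) (e w j x)%:E)%E)) /\
    \forall w \ae P, is_basis (V w) (e w).

(* For infinitely many exponents the decomposition of BV(I) is understood, as
   in the multiplicative ergodic theorem, through its finite truncations: for
   each n, the first n spaces are complemented by the vectors of growth rate at
   most the (n+1)-st exponent, and W is the intersection of these complements. *)
Definition splits (S : splitting) (w : Omega) : Prop :=
  if num S is Some l then is_direct_sum l (fun i => spaceV S i w) (spaceW S w)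
  else (forall n, is_direct_sum n (fun i => spaceV S i w)
                    (slow w (expo S n)%:E)) /\
       spaceW S w = \bigcap_n slow w (expo S n)%:E.

Definition is_oseledets_splitting (S : splitting) : Prop :=
  [/\ has_index S 0,
      is_compactness_index (compactness_index S),
      (forall i, has_index S i.+1 -> expo S i.+1 < expo S i) /\
      (forall i, has_index S i ->
         (compactness_index S < (expo S i)%:E)%E /\ (0 < mult S i)%N),
      forall i, has_index S i -> is_measurable_space (mult S i) (spaceV S i) &
      \forall w \ae P,
        [/\ is_subspace (spaceW S w),
            forall i, has_index S i ->
              (forall f, spaceV S i w f -> spaceV S i (sigma w) (L w f)) /\
              (forall g, spaceV S i (sigma w) g ->
                 exists2 f, spaceV S i w f & eqI g (L w f)),
            forall f, spaceW S w f -> spaceW S (sigma w) (L w f),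
            splits S w &
            (forall i, has_index S i -> forall f, spaceV S i w f ->
               ~ eqI f (cst 0) -> growth w f @ \oo --> (expo S i)%:E) /\
            (forall f, spaceW S w f -> ~ eqI f (cst 0) ->
               (limn_esup (growth w f) <= compactness_index S)%E)]].

End oseledets.

(* Main.v *)
Require Import Defs.
From mathcomp Require Import all_boot all_order all_algebra.
From mathcomp Require Import all_classical all_reals all_analysis measurable_realfun.
From mathcomp Require Import ring lra.
Import Order.TTheory GRing.Theory Num.Theory.
Import numFieldNormedType.Exports.

Set Implicit Arguments.
Unset Strict Implicit.
Unset Printing Implicit Defensive.

Local Open Scope classical_set_scope.
Local Open Scope ring_scope.

(* Everything is read off the Koopman operators h |-> h o T, which act explicitly
   on primitives of bounded test functions h. Write [gap h] for the difference of
   the integrals of h over the left and right halves, and [dev h] for the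
   primitives of h minus its means on the two halves. A tent branch halves [dev],
   up to the small leak through the holes, so for small eps the cone "[dev h] is
   small compared to [gap h]" is invariant, and it contains h* = 1_L - 1_R. Since
   dev controls the pairing with functions of bounded variation, all iterates of a
   mean-zero function of BV are dominated by the iterates of psi0, and the latter
   are, uniformly in the environment, almost proportional to psi0.

   For almost every w, psi0 splits as c e_w + u, where e_w spans the second
   Oseledets space and u decays faster. Domination forces c <> 0, hence the iterates
   of e_w, that is e_(sigma^n w) up to scaling, become close to psi0 along the times
   n at which e_(sigma^n w) has bounded BV norm. By Poincare recurrence the set of w
   where e_w is far from psi0 is null. This needs the sets {BV norm of e_w <= K} to
   be measurable up to constants, which follows from describing the variation by
   averages over uniform grids. The resulting closeness is uniform in w up to null
   sets, and so the required version of the family psi exists. *)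

(** * Integrals over intervals *)

(** Growth rates are measured in the BV norm, whereas the Koopman side only sees pairings with
    bounded functions. An upper bound on a rate passes to pairings at once, since these are bounded
    by the L1 norm; a lower bound does so only at times when the normalised Oseledets vector has
    bounded BV norm. This is why the comparison runs along return times. The leak at 0 brings in the
    integral of the test function over a window of width at most [eps]. It is governed by [gap] and
    by [dev] near 0, hence two bounds per half: [s] on the whole half and [e] on the window. One
    step turns [(s, e)] into about [((s + e) / 2, s / 2)], up to [O(eps)] times the gap, and this
    linear map has spectral radius about 0.81. The total integral is conserved, so it vanishes on
    everything that decays and must be carried by the first Oseledets space. As [psi0] has integral
    0, it has no component there. The threshold on [eps] and the number of steps are chosen from the
    tolerance alone, before the environment, so the bound for a given [eps] is the same for almost
    every [w]. *)

Section affine_change.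
Context {R : realType}.
Local Notation mu := (@lebesgue_measure R).
Variables (c d : R).
Hypothesis c0 : c != 0.
Let phi (x : R) : R := c * x + d.

Let mphi : measurable_fun [set: measurableTypeR R] (phi : measurableTypeR R -> measurableTypeR R).
Proof. by apply: measurable_funD => //; apply: measurable_funM. Qed.

Let k : {nonneg R} := NngNum (normr_ge0 c^-1).

(** Lebesgue measure is determined by its values on half-open intervals, so the rescaled pushforward
    is only compared there. For [c < 0] the preimage of []x, y]] is closed on the other side, which
    does not change its length. *)
Lemma pushforward_affine (A : set R) : measurable A ->
  pushforward mu (phi : measurableTypeR R -> measurableTypeR R) A = mscale k mu A.
Proof.
move=> mA; rewrite /mscale/=.
suff H : forall B, measurable B -> mu B = mscale (NngNum (normr_ge0 c))
   (pushforward mu (phi : measurableTypeR R -> measurableTypeR R)) B.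
  rewrite (H mphi A mA) /mscale /= muleA -EFinM -normrM mulVf// normr1 mul1e.
  by [].
move=> m B mB; apply: lebesgue_measure_unique => // _ [[x y]] _ <-.
change (mu `]x, y] = `|c|%:E * mu (phi @^-1` `]x, y]))%E.
have [cp|cn] := ltP 0 c.
  have -> : phi @^-1` `]x, y] = `](x - d) / c, (y - d) / c]%classic.
    apply/seteqP; split => z/=; rewrite !in_itv/= ltr_pdivrMr// ler_pdivlMr// /phi;
      by move=> /andP[? ?]; apply/andP; split; lra.
  rewrite !lebesgue_measure_itv/= !lte_fin.
  rewrite ltr_pM2r ?invr_gt0// ltrD2r.
  case: ifPn => _; last by rewrite mule0.
  rewrite -!EFinD -EFinM gtr0_norm//; congr (_%:E); field; exact: lt0r_neq0.
have {}cn : c < 0 by rewrite lt_neqAle c0.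
have -> : phi @^-1` `]x, y] = `[(y - d) / c, (x - d) / c[%classic.
  apply/seteqP; split => z/=; rewrite !in_itv/= ltr_ndivlMr// ler_ndivrMr// /phi;
    by move=> /andP[? ?]; apply/andP; split; lra.
rewrite !lebesgue_measure_itv/= !lte_fin.
rewrite ltr_nM2r ?invr_lt0// ltrD2r.
case: ifPn => _; last by rewrite mule0.
rewrite -!EFinD -EFinM ltr0_norm//; congr (_%:E); field; exact: ltr0_neq0.
Qed.

Lemma ge0_integral_affine (f : R -> \bar R) : measurable_fun setT f ->
  (forall x, 0 <= f x)%E ->
  (\int[mu]_x f (phi x) = `|c^-1|%:E * \int[mu]_x f x)%E.
Proof.
move=> mf f0.
have := @ge0_integral_pushforward _ _ _ _ R _ mphi mu setT f measurableT mf (fun x _ => f0 x).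
rewrite preimage_setT => <-.
rewrite -(ge0_integral_mscale mu measurableT k mf)//.
by apply: eq_measure_integral => A mA _; exact: pushforward_affine.
Qed.

Lemma integrable_affine (f : R -> R) : mu.-integrable setT (EFin \o f) ->
  mu.-integrable setT (EFin \o (f \o phi)).
Proof.
move=> /integrableP[mf fi]; apply/integrableP; split.
  exact: (measurableT_comp mf mphi).
have mf' : measurable_fun [set: R] (fun x => `|(f x)%:E|)%E.
  exact: measurableT_comp.
have := @ge0_integral_affine (fun x => `|(f x)%:E|)%E mf' (fun x => abse_ge0 _).
by move=> /= ->; rewrite lte_mul_pinfty.
Qed.

Lemma Rintegral_affine (f : R -> R) : mu.-integrable setT (EFin \o f) ->
  \int[mu]_x f (phi x) = `|c^-1| * \int[mu]_x f x.
Proof.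
move=> fi; have /integrableP[mf _] := fi.
have fi2 := integrable_affine fi.
rewrite /Rintegral.
suff -> : (\int[mu]_x (f (phi x))%:E = `|c^-1|%:E * \int[mu]_x (f x)%:E)%E.
  by rewrite fineM//; exact: integrable_fin_num.
rewrite integralE [X in (_ * X)%E]integralE.
rewrite muleBr//; last first.
  rewrite fin_num_adde_defr//; apply: integrable_pos_fin_num => //.
rewrite -!ge0_integral_affine//.
- by congr (_ - _)%E; apply: eq_integral => x _; rewrite ?funeposE ?funenegE.
- exact: (measurable_funeneg mf).
- exact: (measurable_funepos mf).
Qed.

End affine_change.

Section interval_integrals.
Context {R : realType}.
Local Notation mu := (@lebesgue_measure R).
Implicit Types (f g h : R -> R) (x y z c d M : R).

Definition intv (x y : R) : set R := `[x, y].
Definition integ (x y : R) (f : R -> R) : Prop :=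
  mu.-integrable (intv x y) (EFin \o f).
Definition J (f : R -> R) (x y : R) : R := \int[mu]_(t in intv x y) f t.

Lemma mu_intv x y : x <= y -> mu (intv x y) = (y - x)%:E.
Proof.
move=> xy; rewrite /intv lebesgue_measure_itv/= lte_fin.
case: ltP => // yx; have -> : x = y by apply/le_anti; rewrite xy.
by rewrite subrr.
Qed.

Lemma integ_sub x y x' y' f : x <= x' -> y' <= y ->
  integ x y f -> integ x' y' f.
Proof.
move=> xx yy; apply: integrableS => //; rewrite /intv; try exact: measurable_itv.
by apply: subset_itvScc; rewrite bnd_simp.
Qed.

Lemma J_chasles x y z f : x <= y -> y <= z -> integ x z f ->
  J f x z = J f x y + J f y z.
Proof.
move=> xy yz fi; rewrite addrC; apply/eqP; rewrite -subr_eq; apply/eqP.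
rewrite /J /intv Rintegral_itvB ?bnd_simp// Rintegral_itv_obnd_cbnd//.
apply: integrableS fi; rewrite ?/intv; try exact: measurable_itv.
by move=> t /=; rewrite !in_itv/= => /andP[yt ->]; rewrite andbT (le_trans xy)// ltW.
Qed.

Lemma J_point x f : J f x x = 0.
Proof. by rewrite /J /intv set_itv1 Rintegral_set1. Qed.

Lemma integ_eq x y f g : (forall t, x <= t <= y -> f t = g t) ->
  integ x y f -> integ x y g.
Proof.
move=> fg; apply: eq_integrable => //; first exact: measurable_itv.
by move=> t; rewrite inE /intv/= in_itv/= => /fg ->.
Qed.

Lemma J_eq x y f g : (forall t, x <= t <= y -> f t = g t) -> J f x y = J g x y.
Proof.
move=> fg; apply: eq_Rintegral => t; rewrite inE /intv/= in_itv/=; exact: fg.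
Qed.

(** Endpoints are left out because [tent] jumps at 0, and [hstar] vanishes there since its two
    halves overlap. *)
Lemma J_eqoo x y f g : integ x y f -> integ x y g ->
  (forall t, x < t < y -> f t = g t) -> J f x y = J g x y.
Proof.
move=> fi gi fg; rewrite /J /intv.
have H k : integ x y k -> \int[mu]_(t in `[x, y]) k t = \int[mu]_(t in `]x, y[) k t.
  move=> ki; rewrite -Rintegral_itv_obnd_cbnd//; last first.
    by apply: integrableS ki; rewrite ?/intv; try exact: measurable_itv;
       apply: subset_itvr; rewrite bnd_simp.
  rewrite -Rintegral_itv_bndo_bndc//.
  by apply: integrableS ki; rewrite ?/intv; try exact: measurable_itv;
       apply: subset_itvScc; rewrite bnd_simp.
rewrite !H//; apply: eq_Rintegral => t; rewrite inE /intv/= in_itv/=; exact: fg.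
Qed.

Lemma integD x y f g : integ x y f -> integ x y g -> integ x y (f \+ g).
Proof. by move=> fi gi; apply: (integrableD _ fi gi); exact: measurable_itv. Qed.

Lemma integB x y f g : integ x y f -> integ x y g -> integ x y (f \- g).
Proof. by move=> fi gi; apply: (integrableB _ fi gi); exact: measurable_itv. Qed.

Lemma integZ x y c f : integ x y f -> integ x y (fun t => c * f t).
Proof. by move=> fi; apply: (integrableZl _ c fi); exact: measurable_itv. Qed.

Lemma JD x y f g : integ x y f -> integ x y g ->
  J (fun t => f t + g t) x y = J f x y + J g x y.
Proof. by move=> fi gi; apply: RintegralD fi gi; exact: measurable_itv. Qed.

Lemma JB x y f g : integ x y f -> integ x y g ->
  J (fun t => f t - g t) x y = J f x y - J g x y.
Proof. by move=> fi gi; apply: RintegralB fi gi; exact: measurable_itv. Qed.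

Lemma JZ x y c f : integ x y f -> J (fun t => c * f t) x y = c * J f x y.
Proof. by move=> fi; apply: RintegralZl fi; exact: measurable_itv. Qed.

Lemma J_cst x y c : x <= y -> J (fun=> c) x y = c * (y - x).
Proof.
move=> xy; rewrite /J Rintegral_cst; last exact: measurable_itv.
by congr (_ * _); have := mu_intv xy => /= ->.
Qed.

Lemma J_le x y f g : integ x y f -> integ x y g ->
  (forall t, x <= t <= y -> f t <= g t) -> J f x y <= J g x y.
Proof.
move=> fi gi fg; apply: le_Rintegral fi gi _; first exact: measurable_itv.
by move=> t; rewrite /intv/= in_itv/=; exact: fg.
Qed.

Lemma integ_norm x y f : integ x y f -> integ x y (fun t => `|f t|).
Proof. by move=> fi; apply: (integrable_norm fi); exact: measurable_itv. Qed.

Lemma J_norm x y f : integ x y f -> `|J f x y| <= J (fun t => `|f t|) x y.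
Proof. by move=> fi; apply: le_normr_Rintegral fi; exact: measurable_itv. Qed.

(** Both conditions are imposed on the whole line, so that test functions can be composed with
    [tent] and reflected without tracking domains. *)
Definition bmeas (M : R) (h : R -> R) : Prop :=
  measurable_fun setT h /\ forall x, `|h x| <= M.

Lemma bmeas_ge0 M h : bmeas M h -> 0 <= M.
Proof. by move=> [_ /(_ 0)]; apply: le_trans. Qed.

Lemma bmeasD M N h k : bmeas M h -> bmeas N k -> bmeas (M + N) (h \+ k).
Proof.
move=> [mh bh] [mk bk]; split; first exact: measurable_funD.
by move=> x /=; rewrite (le_trans (ler_normD _ _))// lerD.
Qed.

Lemma bmeasB M N h k : bmeas M h -> bmeas N k -> bmeas (M + N) (h \- k).
Proof.
move=> [mh bh] [mk bk]; split; first exact: measurable_funB.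
by move=> x /=; rewrite (le_trans (ler_normB _ _))// lerD.
Qed.

Lemma bmeasZ M c h : bmeas M h -> bmeas (`|c| * M) (fun x => c * h x).
Proof.
move=> [mh bh]; split; first exact: measurable_funM.
by move=> x /=; rewrite normrM ler_wpM2l.
Qed.

Lemma bmeas_cst c : bmeas `|c| (fun=> c).
Proof. by split. Qed.

Lemma bmeasW M N h : M <= N -> bmeas M h -> bmeas N h.
Proof. by move=> MN [mh bh]; split => // x; exact: le_trans (bh x) MN. Qed.

Lemma bmeas_bounded M h (D : set R) : bmeas M h -> [bounded h x | x in D].
Proof.
move=> [_ bh]; exists M; split; first exact: num_real.
by move=> N MN x _; exact: le_trans (bh x) (ltW MN).
Qed.

Lemma bmeas_integ M h x y : bmeas M h -> integ x y h.
Proof.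
move=> hM; apply: measurable_bounded_integrable.
- exact: measurable_itv.
- have := @lebesgue_measure_itv R `[x, y] => /= ->.
  by case: ifP => _ //; rewrite ltry.
- by apply: measurable_funTS; case: hM.
- exact: bmeas_bounded hM.
Qed.

Lemma J_bound M h x y : bmeas M h -> x <= y -> `|J h x y| <= M * (y - x).
Proof.
move=> hM xy; have hi := bmeas_integ x y hM.
rewrite (le_trans (J_norm hi))// -J_cst//; apply: J_le.
- exact: integ_norm.
- exact: bmeas_integ (bmeas_cst M).
- by move=> t _; case: hM => _ ->.
Qed.

Lemma integM M h f x y : bmeas M h -> integ x y f -> integ x y (fun t => f t * h t).
Proof.
move=> hM fi.
have := integrableMl _ fi (measurable_funTS (proj1 hM)) (bmeas_bounded _ hM).
by apply => //; exact: measurable_itv.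
Qed.

Lemma J_restrict f x y : J f x y = \int[mu]_t (f \_ (intv x y)) t.
Proof. exact: Rintegral_mkcond. Qed.

Lemma integ_restrict f x y :
  integ x y f <-> mu.-integrable setT (EFin \o (f \_ (intv x y))).
Proof.
rewrite /integ integrable_mkcond; last exact: measurable_itv.
by rewrite restrict_EFin.
Qed.

Lemma restrict_affine_pos c d f x y : 0 < c ->
  (f \_ (intv (c * x + d) (c * y + d))) \o (fun t => c * t + d) =
  (fun t => f (c * t + d)) \_ (intv x y).
Proof.
move=> c0; apply/funext => t /=; rewrite /patch.
suff -> : (c * t + d \in intv (c * x + d) (c * y + d)) = (t \in intv x y) by [].
by apply/idP/idP; rewrite !inE /intv/= !in_itv/= !lerD2r !ler_pM2l.
Qed.

Lemma restrict_affine_neg c d f x y : c < 0 ->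
  (f \_ (intv (c * y + d) (c * x + d))) \o (fun t => c * t + d) =
  (fun t => f (c * t + d)) \_ (intv x y).
Proof.
move=> c0; apply/funext => t /=; rewrite /patch.
suff -> : (c * t + d \in intv (c * y + d) (c * x + d)) = (t \in intv x y) by [].
by apply/idP/idP; rewrite !inE /intv/= !in_itv/= !lerD2r !ler_nM2l// andbC.
Qed.

Lemma J_affine_pos c d f x y : 0 < c ->
  integ (c * x + d) (c * y + d) f ->
  integ x y (fun t => f (c * t + d)) /\
  J (fun t => f (c * t + d)) x y = c^-1 * J f (c * x + d) (c * y + d).
Proof.
move=> c0 /integ_restrict fi; rewrite integ_restrict !J_restrict.
rewrite -restrict_affine_pos//; split.
  by apply: integrable_affine => //; rewrite gt_eqF.
by rewrite (@Rintegral_affine _ c d _ _ fi) ?gt_eqF// gtr0_norm ?invr_gt0.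
Qed.

Lemma J_affine_neg c d f x y : c < 0 ->
  integ (c * y + d) (c * x + d) f ->
  integ x y (fun t => f (c * t + d)) /\
  J (fun t => f (c * t + d)) x y = (- c)^-1 * J f (c * y + d) (c * x + d).
Proof.
move=> c0 /integ_restrict fi; rewrite integ_restrict !J_restrict.
rewrite -restrict_affine_neg//; split.
  by apply: integrable_affine => //; rewrite lt_eqF.
by rewrite (@Rintegral_affine _ c d _ _ fi) ?lt_eqF// ltr0_norm ?invr_lt0// invrN.
Qed.

End interval_integrals.

(** * Invariant cone for the Koopman operators *)

Section half_step.
Context {R : realType}.
Implicit Types (A B : R -> R) (x y s e eps b : R).

(* For a primitive [A] of [h] with [A (-1) = 0], this is the primitive of [h]
   minus its mean over [-1, 0]. *)
Definition dev A x : R := A x - A 0 * (x + 1).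
Definition dev_le A s : Prop := forall x, -1 <= x <= 0 -> `|dev A x| <= s.
(** The image of a half overshoots 0 by at most [eps]; through [AB], values beyond 0 become values
    of the other half's primitive on this window. *)
Definition dev_near A eps e : Prop := forall x, - eps <= x <= 0 -> `|dev A x| <= e.

(* [A] and [B] are the primitives, started at [-1], of [h] and of its reflection
   [h \o -%R]; [A'] is the primitive of [h \o tent a b]. The estimates for [B] are
   the same ones after exchanging the roles of the two halves. *)
Variables (A B A' : R -> R) (eps b s e : R).
Hypothesis b_eps : 0 <= b <= eps.
Hypothesis eps_small : eps <= 1000^-1.
Hypothesis A_m1 : A (-1) = 0.
Hypothesis AB : forall x, 0 <= x <= 1 -> A x = A 0 + B 0 - B (- x).
Hypothesis A'l : forall x, -1 <= x <= - 2^-1 ->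
  A' x = (2 * (1 + b))^-1 * A (2 * (1 + b) * (x + 1) - 1).
Hypothesis A'r : forall x, - 2^-1 <= x <= 0 ->
  A' x = (1 + b)^-1 * A b - (2 * (1 + b))^-1 * A (- 2 * (1 + b) * x - 1).
Hypothesis sA : dev_le A s.
Hypothesis sB : dev_le B s.
Hypothesis eA : dev_near A eps e.
Hypothesis eB : dev_near B eps e.

Let D := A 0 - B 0.

Let b1_gt0 : 0 < 1 + b. Proof. by move: b_eps; lra. Qed.

Let be1 : 0 < (1 + b)^-1 <= 1.
Proof.
move: b_eps => /andP[b0 _]; rewrite invr_gt0 b1_gt0/=.
by rewrite invf_le1// lerDl.
Qed.

(** Both left branches cover [[-1, b]], up to an endpoint, with slope [2 * (1 + b)] in absolute
    value, so [A' 0] is [(1 + b)^-1 * A b]. Rewriting [A b] by [AB] is where the other half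
    enters. *)
Lemma mass_step : A' 0 = A 0 - (1 + b)^-1 * (b * D + dev B (- b)).
Proof.
rewrite A'r; last by lra.
rewrite mulr0 sub0r A_m1 mulr0 subr0 AB; last by move: b_eps eps_small; lra.
rewrite /dev /D; field; exact: lt0r_neq0.
Qed.

Lemma mass_step_le : `|A' 0 - A 0| <= eps * `|D| + e.
Proof.
rewrite mass_step addrAC subrr add0r normrN normrM.
have /andP[be0 be_1] := be1.
rewrite ger0_norm; last exact: ltW.
rewrite (@le_trans _ _ `|b * D + dev B (- b)|)//.
  by rewrite ler_piMl.
rewrite (le_trans (ler_normD _ _))// lerD//.
  rewrite normrM ler_wpM2r//; move: b_eps => /andP[b0 be].
  by rewrite ger0_norm.
by apply: eB; move: b_eps; lra.
Qed.

(** Like [dev A], but with the new mean [A' 0]: then [dev A'] is, up to sign, exactly [Phi] at the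
    image point divided by [2 * (1 + b)]. *)
Let Phi r := A r - A' 0 * (r + 1).

Let s_ge0 : 0 <= s.
Proof. by apply: le_trans (sA (_ : -1 <= 0 <= 0)) => //; lra. Qed.
Let e_ge0 : 0 <= e.
Proof. by apply: le_trans (eA (_ : - eps <= 0 <= 0)) => //; move: b_eps; lra. Qed.

Lemma Phi_le r : -1 <= r <= 0 ->
  `|Phi r| <= s + (eps * `|D| + e) * (r + 1).
Proof.
move=> r0; have -> : Phi r = dev A r - (A' 0 - A 0) * (r + 1).
  by rewrite /Phi /dev; ring.
rewrite (le_trans (ler_normB _ _))// lerD//; first exact: sA.
rewrite normrM [X in _ * X]ger0_norm; last by lra.
rewrite ler_wpM2r//; [by lra|exact: mass_step_le].
Qed.

Lemma Phi_le_all r : -1 <= r <= b ->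
  `|Phi r| <= s + (1 + eps) * (eps * `|D| + e) + eps * `|D|.
Proof.
move=> r0; have mm := mass_step_le.
have D0 := normr_ge0 D.
have ed : 0 <= eps * `|D| by apply: mulr_ge0 => //; move: b_eps; lra.
have [rn|rp] := leP r 0.
  apply: (le_trans (Phi_le _)); first by lra.
  rewrite -addrA lerD2l.
  apply: (@le_trans _ _ ((1 + eps) * (eps * `|D| + e))); last by rewrite lerDl.
  rewrite mulrC ler_wpM2r//; first by rewrite addr_ge0.
  by move: b_eps; lra.
have -> : Phi r = - dev B (- r) - r * D - (A' 0 - A 0) * (r + 1).
  rewrite /Phi AB; last by move: b_eps eps_small; lra.
  by rewrite /dev /D; ring.
rewrite (le_trans (ler_normB _ _))// addrAC lerD//.
  rewrite (le_trans (ler_normB _ _))// normrN lerD//.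
    by apply: sB; move: b_eps eps_small; lra.
  rewrite normrM ger0_norm; last exact: ltW.
  by rewrite ler_wpM2r//; move: b_eps; lra.
rewrite normrM mulrC; apply: ler_pM => //.
by rewrite ger0_norm; move: b_eps; lra.
Qed.

(** [r] is the image of [x] under the branch containing it. The branch next to 0 decreases to -1, so
    points within [eps] of 0 land within [4 * eps] of -1. *)
Lemma dev_step x : -1 <= x <= 0 -> exists r, 
  [/\ -1 <= r <= b, (- eps <= x -> r + 1 <= 4 * eps) & `|dev A' x| <= 2^-1 * `|Phi r|].
Proof.
move=> x01.
have /andP[be0 be_1] := be1.
have hb : (2 * (1 + b))^-1 = 2^-1 * (1 + b)^-1 by rewrite invfM.
have b1n : 1 + b != 0 by exact: lt0r_neq0.
have F r : `|(2 * (1 + b))^-1 * Phi r| <= 2^-1 * `|Phi r|.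
  rewrite normrM ler_wpM2r// ger0_norm; last by rewrite hb; lra.
  by rewrite hb; lra.
have [xl|xr] := leP x (- 2^-1).
  exists (2 * (1 + b) * (x + 1) - 1); split.
  - move: b_eps => /andP[b0 _]; apply/andP; split.
      by rewrite lerBrDr addrC subrr; apply: mulr_ge0; lra.
    have : (1 + b) * (x + 1) <= (1 + b) * 2^-1 by rewrite ler_wpM2l//; lra.
    by lra.
  - by move: eps_small b_eps; lra.
  rewrite (le_trans _ (F _))// /dev A'l; last by lra.
  rewrite le_eqVlt; apply/orP; left; apply/eqP; congr (`|_|).
  by rewrite /Phi; field.
exists (- 2 * (1 + b) * x - 1); split.
- move: b_eps => /andP[b0 _]; apply/andP; split.
    by rewrite lerBrDr addrC subrr mulNr mulNr oppr_ge0; apply: mulr_ge0_le0; lra.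
  have : (1 + b) * (- x) <= (1 + b) * 2^-1 by rewrite ler_wpM2l//; lra.
  by lra.
- move=> xe; have : (1 + b) * (- x) <= 2 * eps by apply: ler_pM; move: b_eps eps_small; lra.
  by lra.
rewrite (le_trans _ (F _))// /dev {1}A'r; last by lra.
rewrite (A'r (_ : - 2^-1 <= 0 <= 0)); last by lra.
rewrite le_eqVlt; apply/orP; left; apply/eqP; rewrite -[RHS]normrN; congr (`|_|).
rewrite /Phi (A'r (_ : - 2^-1 <= 0 <= 0)); last by lra.
by rewrite mulr0 sub0r A_m1; field.
Qed.

Lemma dev_le_step :
  dev_le A' (2^-1 * s + 2^-1 * (1 + eps) * e + 2 * eps * `|D|).
Proof.
move=> x x0; have [r [rb _ H]] := dev_step x0.
rewrite (le_trans H)//.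
have := Phi_le_all rb.
have D0 := normr_ge0 D.
have ed : 0 <= eps * `|D| by apply: mulr_ge0 => //; move: b_eps; lra.
have eed : eps * (eps * `|D|) <= eps * `|D| by rewrite ler_piMl//; move: eps_small; lra.
lra.
Qed.

(** For [x] in the window, [Phi_le] is used at a point [r] near -1, where the change of mean is
    multiplied by [r + 1 <= 4 * eps]. Hence [e] returns only with a factor [eps], whereas in
    [dev_le_step] its weight is about one half. *)
Lemma dev_near_step :
  dev_near A' eps (2^-1 * s + 2 * eps * (eps * `|D| + e)).
Proof.
move=> x x0; have [|r [rb r4 H]] := @dev_step x.
  by move: x0 eps_small; lra.
rewrite (le_trans H)//.
have ed : 0 <= eps * `|D| by apply: mulr_ge0 => //; move: b_eps; lra.
have {}r4 : r + 1 <= 4 * eps by apply: r4; lra.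
have := @Phi_le r; rewrite (_ : (-1 <= r <= 0) = true); last first.
  by apply/idP; move: eps_small rb; lra.
move=> /(_ isT) H2.
have : (eps * `|D| + e) * (r + 1) <= (eps * `|D| + e) * (4 * eps).
  by rewrite ler_wpM2l// addr_ge0.
lra.
Qed.

End half_step.

(** * Action of a tent map on primitives *)

Section tent_map.
Context {R : realType}.
Local Notation mu := (@lebesgue_measure R).
Implicit Types (a b x : R) (h : R -> R).

Lemma tentN a b x : tent a b (- x) = - tent b a x.
Proof.
rewrite /tent.
have -> : (-1 <= - x) && (- x <= - 2^-1) = (2^-1 <= x) && (x <= 1).
  by apply/idP/idP; lra.
have -> : (- 2^-1 <= - x) && (- x < 0) = (0 < x) && (x <= 2^-1).
  by apply/idP/idP; lra.
have -> : (0 < - x) && (- x <= 2^-1) = (- 2^-1 <= x) && (x < 0).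
  by apply/idP/idP; lra.
have -> : (2^-1 <= - x) && (- x <= 1) = (-1 <= x) && (x <= - 2^-1).
  by apply/idP/idP; lra.
do ?case: ifPn => ?; try lra.
(* Only the breakpoints remain, where two branches are both admissible and agree; once [x] is a
   number, the goals are linear in [a] and [b]. *)
all: first [have -> : x = 2^-1 by lra | have -> : x = - 2^-1 by lra].
all: lra.
Qed.

Lemma tent_l a b x : -1 <= x <= - 2^-1 ->
  tent a b x = 2 * (1 + b) * x + (2 * (1 + b) - 1).
Proof. by move=> h; rewrite /tent h; ring. Qed.

Lemma tent_ml a b x : - 2^-1 <= x < 0 -> tent a b x = - 2 * (1 + b) * x + (- 1).
Proof.
move=> h; rewrite /tent h; case: ifPn => // h1.
by have -> : x = - 2^-1 by [lra]; field.
Qed.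

Lemma measurable_tent a b : measurable_fun [set: R] (tent a b).
Proof.
rewrite /tent.
have lec (c : R) : measurable_fun [set: R] (fun x : R => c <= x) by exact: measurable_fun_ler.
have gec (c : R) : measurable_fun [set: R] (fun x : R => x <= c) by exact: measurable_fun_ler.
have ltc (c : R) : measurable_fun [set: R] (fun x : R => c < x) by exact: measurable_fun_ltr.
have gtc (c : R) : measurable_fun [set: R] (fun x : R => x < c) by exact: measurable_fun_ltr.
have lin (c d e : R) : measurable_fun [set: R] (fun x : R => c * (x + d) + e).
  by apply: measurable_funD => //; apply: measurable_funM => //; exact: measurable_funD.
have lin' (c e : R) : measurable_fun [set: R] (fun x : R => c * x + e).
  by apply: measurable_funD => //; apply: measurable_funM.
apply: measurable_fun_ifT; first (by apply: measurable_and); first exact: lin.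
apply: measurable_fun_ifT; first (by apply: measurable_and); first exact: lin'.
apply: measurable_fun_ifT; first (by apply: measurable_and); first exact: lin'.
apply: measurable_fun_ifT; first (by apply: measurable_and); first exact: lin.
exact: measurable_cst.
Qed.

Lemma bmeas_tent M a b h : bmeas M h -> bmeas M (h \o tent a b).
Proof.
move=> [mh bh]; split; first exact: measurableT_comp (measurable_tent a b).
by move=> x; exact: bh.
Qed.

Lemma bmeas_opp M h : bmeas M h -> bmeas M (h \o -%R).
Proof. by move=> [mh bh]; split; [exact: measurableT_comp|move=> x; exact: bh]. Qed.

Lemma tent_opp a b h : (h \o tent a b) \o -%R = (h \o -%R) \o tent b a.
Proof. by apply/funext => x /=; rewrite tentN. Qed.

Definition prim h x := J h (-1) x.

Lemma prim_m1 h : prim h (-1) = 0. Proof. exact: J_point. Qed.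

Lemma prim_oppE M h x : bmeas M h -> prim (h \o -%R) x = J h (- x) 1.
Proof.
move=> hM; rewrite /prim.
rewrite (@J_eq _ _ _ (h \o -%R) (fun t => h (-1 * t + 0))); last first.
  by move=> t _ /=; rewrite mulN1r addr0.
have [] := @J_affine_neg _ (-1) 0 h (-1) x; [lra|exact: bmeas_integ hM|].
by move=> _ ->; rewrite opprK invr1 !mul1r mulN1r mulrNN mulr1 !addr0.
Qed.

Lemma prim_opp M h x : bmeas M h -> 0 <= x <= 1 ->
  prim h x = prim h 0 + prim (h \o -%R) 0 - prim (h \o -%R) (- x).
Proof.
move=> hM x01; rewrite !(prim_oppE _ hM) opprK oppr0.
rewrite {1}/prim (@J_chasles _ (-1) 0 x); [|lra|lra|exact: bmeas_integ hM].
rewrite (@J_chasles _ 0 x 1); [|lra|lra|exact: bmeas_integ hM].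
by rewrite /prim; ring.
Qed.

Section prim_tent.
Variables (M a b : R) (h : R -> R).
Hypotheses (hM : bmeas M h) (b01 : 0 <= b <= 1).

Lemma prim_tent_l x : -1 <= x <= - 2^-1 ->
  prim (h \o tent a b) x = (2 * (1 + b))^-1 * prim h (2 * (1 + b) * (x + 1) - 1).
Proof.
move=> x1; rewrite /prim.
rewrite (@J_eq _ _ _ _ (fun t => h (2 * (1 + b) * t + (2 * (1 + b) - 1)))); last first.
  by move=> t tx /=; rewrite tent_l//; lra.
have [] := @J_affine_pos _ (2 * (1 + b)) (2 * (1 + b) - 1) h (-1) x; [move: b01; lra|exact: bmeas_integ hM|].
move=> _ ->.
have -> : 2 * (1 + b) * x + (2 * (1 + b) - 1) = 2 * (1 + b) * (x + 1) - 1 by ring.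
by have -> : 2 * (1 + b) * -1 + (2 * (1 + b) - 1) = -1 by ring.
Qed.

Lemma J_tent_ml x y : - 2^-1 <= x -> x <= y -> y <= 0 ->
  J (h \o tent a b) x y = (2 * (1 + b))^-1 * J h (- 2 * (1 + b) * y - 1) (- 2 * (1 + b) * x - 1).
Proof.
move=> x1 xy y0.
rewrite (@J_eqoo _ _ _ _ (fun t => h (- 2 * (1 + b) * t + (- 1)))); last 3 first.
- exact: bmeas_integ (bmeas_tent _ _ hM).
- apply: (@bmeas_integ _ M); split; last by move=> t; case: hM.
  apply: (measurableT_comp (proj1 hM)).
  by apply: measurable_funD => //; apply: measurable_funM.
- by move=> t tx /=; rewrite tent_ml//; lra.
have [] := @J_affine_neg _ (- 2 * (1 + b)) (- 1) h x y; [move: b01; lra|exact: bmeas_integ hM|].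
by move=> _ ->; congr (_^-1 * J _ _ _); ring.
Qed.

Lemma prim_tent_r x : - 2^-1 <= x <= 0 ->
  prim (h \o tent a b) x =
  (1 + b)^-1 * prim h b - (2 * (1 + b))^-1 * prim h (- 2 * (1 + b) * x - 1).
Proof.
move=> x1; rewrite {1}/prim (@J_chasles _ (-1) (- 2^-1) x); [|lra|lra|]; last first.
  exact: bmeas_integ (bmeas_tent _ _ hM).
rewrite -/(prim (h \o tent a b) (- 2^-1)) prim_tent_l; last by lra.
rewrite J_tent_ml; [|lra|lra|lra].
move: b01 => b01'; have b1n : 1 + b != 0 by apply: lt0r_neq0; lra.
have -> : 2 * (1 + b) * (- 2^-1 + 1) - 1 = b by field.
have -> : - 2 * (1 + b) * - 2^-1 - 1 = b by field.
have H : (1 + b) * (- x) <= (1 + b) * 2^-1 by rewrite ler_wpM2l//; lra.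
have H2 : 0 <= (1 + b) * (- x) by apply: mulr_ge0; lra.
rewrite /prim (@J_chasles _ (-1) (- 2 * (1 + b) * x - 1) b); [|lra|lra|exact: bmeas_integ hM].
by field.
Qed.

End prim_tent.
End tent_map.

(** * The cone, and domination along orbits *)

Section koopman.
Context {R : realType}.
Local Notation mu := (@lebesgue_measure R).
Implicit Types (a b x eps s e M t : R) (h k : R -> R).

Definition gap h : R := prim h 0 - prim (h \o -%R) 0.

Definition state h eps s e : Prop :=
  [/\ dev_le (prim h) s, dev_le (prim (h \o -%R)) s,
      dev_near (prim h) eps e & dev_near (prim (h \o -%R)) eps e].

(** The one-sided estimates are applied to [h] and to its reflection, with [a] and [b] exchanged.
    The gap drifts by at most the sum of the changes of the two means. *)
Lemma state_tent M h eps s e a b : bmeas M h -> eps <= 1000^-1 ->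
  0 <= a <= eps -> 0 <= b <= eps -> state h eps s e ->
  state (h \o tent a b) eps
    (2^-1 * s + 2^-1 * (1 + eps) * e + 2 * eps * `|gap h|)
    (2^-1 * s + 2 * eps * (eps * `|gap h| + e)) /\
  `|gap (h \o tent a b) - gap h| <= 2 * eps * `|gap h| + 2 * e.
Proof.
move=> hM epss a0 b0 [s1 s2 e1 e2].
have hoM := bmeas_opp hM.
have a01 : 0 <= a <= 1 by lra.
have b01 : 0 <= b <= 1 by lra.
have gapN : `|prim (h \o -%R) 0 - prim h 0| = `|gap h| by rewrite distrC.
have hopp : (h \o -%R) \o -%R = h by apply/funext => x /=; rewrite opprK.
have AB := fun x => @prim_opp _ M h x hM.
have BA x : 0 <= x <= 1 -> prim (h \o -%R) x =
    prim (h \o -%R) 0 + prim h 0 - prim h (- x).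
  by move=> x01; rewrite (prim_opp hoM x01) hopp.
have Tl := fun x => @prim_tent_l _ M a b h hM b01 x.
have Tr := fun x => @prim_tent_r _ M a b h hM b01 x.
have Tl' := fun x => @prim_tent_l _ M b a _ hoM a01 x.
have Tr' := fun x => @prim_tent_r _ M b a _ hoM a01 x.
split.
  split; rewrite ?tent_opp.
  - exact: (dev_le_step b0 epss (prim_m1 _) AB Tl Tr s1 s2 e1 e2).
  - rewrite -gapN.
    exact: (dev_le_step a0 epss (prim_m1 _) BA Tl' Tr' s2 s1 e2 e1).
  - exact: (dev_near_step b0 epss (prim_m1 _) AB Tl Tr s1 e1 e2).
  - rewrite -gapN.
    exact: (dev_near_step a0 epss (prim_m1 _) BA Tl' Tr' s2 e2 e1).
have m1 := mass_step_le b0 epss (prim_m1 _) AB Tr e2.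
have := mass_step_le a0 epss (prim_m1 _) BA Tr' e1.
rewrite gapN => m2.
rewrite /gap tent_opp.
rewrite (_ : _ - _ = (prim (h \o tent a b) 0 - prim h 0) -
  (prim (h \o -%R \o tent b a) 0 - prim (h \o -%R) 0)); last by ring.
rewrite (le_trans (ler_normB _ _))//; move: m1 m2; rewrite /gap; lra.
Qed.

Lemma state_le h eps s e s' e' : s <= s' -> e <= e' ->
  state h eps s e -> state h eps s' e'.
Proof.
by move=> ss ee [s1 s2 e1 e2]; split => x x0;
  [exact: le_trans (s1 x x0) ss|exact: le_trans (s2 x x0) ss
  |exact: le_trans (e1 x x0) ee|exact: le_trans (e2 x x0) ee].
Qed.

(* The weights 1/24 and 1/32, in the ratio 4 : 3, make [state_tent] strictly
   contracting when eps is small, although one step of the map does not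
   contract the bound [s] alone. *)
Definition cone eps h : Prop :=
  [/\ exists M, bmeas M h, 0 < gap h &
     state h eps (24^-1 * gap h) (32^-1 * gap h)].

Lemma cone_tent eps h a b : 0 <= eps <= 1000^-1 ->
  0 <= a <= eps -> 0 <= b <= eps -> cone eps h -> cone eps (h \o tent a b).
Proof.
move=> /andP[eps0 eps1] a0 b0 [[M hM] D0 st].
have [st' dD] := state_tent hM eps1 a0 b0 st.
move: st' dD; rewrite gtr0_norm// => st' dD.
(* [16^-1] is the drift term [2 * e] at the cone value [32^-1 * gap h] of [e]. *)
have {}dD : gap (h \o tent a b) >= (1 - 2 * eps - 16^-1) * gap h.
  by move: dD; rewrite ler_norml => /andP[+ _]; lra.
have eD : eps * gap h <= 1000^-1 * gap h by rewrite ler_pM2r.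
have eeD : eps * (eps * gap h) <= 1000^-1 * gap h.
  rewrite (le_trans _ eD)// ler_piMl//; [|lra].
  by apply: mulr_ge0 => //; exact: ltW.
split; first by exists M; exact: bmeas_tent.
- lra.
- apply: state_le st'; lra.
Qed.

Variable th : nat -> R * R.

Fixpoint orb (n : nat) (x : R) : R :=
  if n is m.+1 then tent (th m).1 (th m).2 (orb m x) else x.

(** The newest map is absorbed into the test function; inductions on [n] therefore keep [h]
    general. *)
Lemma orbS h n : h \o orb n.+1 = (h \o tent (th n).1 (th n).2) \o orb n.
Proof. by []. Qed.

Lemma bmeas_orb M h n : bmeas M h -> bmeas M (h \o orb n).
Proof. by elim: n h => [//|n IH] h hM; rewrite orbS; apply: IH; exact: bmeas_tent. Qed.

Definition small_params eps := forall n, 0 <= (th n).1 <= eps /\ 0 <= (th n).2 <= eps.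

Lemma cone_orb eps h n : 0 <= eps <= 1000^-1 -> small_params eps ->
  cone eps h -> cone eps (h \o orb n).
Proof.
move=> eps1 sp; elim: n h => [//|n IH] h ch; rewrite orbS; apply: IH.
by have [? ?] := sp n; apply: cone_tent.
Qed.

Lemma primD M N h k x : bmeas M h -> bmeas N k ->
  prim (h \+ k) x = prim h x + prim k x.
Proof. by move=> hM kN; apply: JD; [exact: bmeas_integ hM|exact: bmeas_integ kN]. Qed.

Lemma primZ M c h x : bmeas M h -> prim (fun t => c * h t) x = c * prim h x.
Proof. by move=> hM; apply: JZ; exact: bmeas_integ hM. Qed.

Lemma gapD M N h k : bmeas M h -> bmeas N k -> gap (h \+ k) = gap h + gap k.
Proof.
move=> hM kN; rewrite /gap (primD _ hM kN).
rewrite -[(h \+ k) \o -%R]/((h \o -%R) \+ (k \o -%R)).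
by rewrite (primD _ (bmeas_opp hM) (bmeas_opp kN)); ring.
Qed.

Lemma gapZ M c h : bmeas M h -> gap (fun t => c * h t) = c * gap h.
Proof.
move=> hM; rewrite /gap (primZ _ _ hM).
rewrite -[(fun t => c * h t) \o -%R]/(fun t => c * (h \o -%R) t).
by rewrite (primZ _ _ (bmeas_opp hM)); ring.
Qed.

Lemma devD M N h k x : bmeas M h -> bmeas N k ->
  dev (prim (h \+ k)) x = dev (prim h) x + dev (prim k) x.
Proof. by move=> hM kN; rewrite /dev !(primD _ hM kN); ring. Qed.

Lemma devZ M c h x : bmeas M h ->
  dev (prim (fun t => c * h t)) x = c * dev (prim h) x.
Proof. by move=> hM; rewrite /dev !(primZ _ _ hM); ring. Qed.

Lemma prim_bound M h x : bmeas M h -> -1 <= x -> `|prim h x| <= M * (x + 1).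
Proof. by move=> hM x1; have := J_bound hM x1; rewrite opprK. Qed.

Lemma gap_bound M h : bmeas M h -> `|gap h| <= 2 * M.
Proof.
move=> hM; have := @prim_bound M h 0 hM; have := @prim_bound M _ 0 (bmeas_opp hM).
rewrite !add0r !mulr1 => h1 h2.
rewrite (le_trans (ler_normB _ _))//; have := h1; have := h2; lra.
Qed.

Lemma dev_bound M h : bmeas M h -> dev_le (prim h) (2 * M).
Proof.
move=> hM x x0; rewrite (le_trans (ler_normB _ _))//.
have M0 := bmeas_ge0 hM.
have h1 : `|prim h x| <= M * (x + 1) by apply: prim_bound => //; lra.
have := @prim_bound M h 0 hM; rewrite add0r mulr1 => h2.
have h3 : `|prim h 0 * (x + 1)| <= M * (x + 1).
  rewrite normrM [X in _ * X]ger0_norm; [|lra].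
  by apply: ler_wpM2r; [lra|apply: h2; lra].
have h4 : M * (x + 1) <= M * 1 by apply: ler_wpM2l => //; lra.
lra.
Qed.

Lemma dev_near_bound M h eps : bmeas M h -> 0 <= eps <= 1 ->
  dev_near (prim h) eps (2 * M * eps).
Proof.
move=> hM e1 x x0.
have M0 := bmeas_ge0 hM.
(* [dev] vanishes at 0 as well as at -1; integrating from 0 makes both terms of the order of [x]. *)
have -> : dev (prim h) x = - J h x 0 - prim h 0 * x.
  rewrite /dev {2}/prim (@J_chasles _ (-1) x 0); [|lra|lra|exact: bmeas_integ hM].
  by rewrite /prim (@J_chasles _ (-1) x 0); [ring|lra|lra|exact: bmeas_integ hM].
rewrite (le_trans (ler_normB _ _))// normrN.
have h1 : `|J h x 0| <= M * (0 - x) by apply: J_bound => //; lra.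
have := @prim_bound M h 0 hM; rewrite add0r mulr1 => h2.
have h3 : `|prim h 0 * x| <= M * (- x).
  rewrite normrM [X in _ * X]ler0_norm; [|lra].
  by apply: ler_wpM2r; [lra|apply: h2; lra].
have h4 : M * (- x) <= M * eps by apply: ler_wpM2l => //; lra.
lra.
Qed.

Lemma state_bound M h eps : bmeas M h -> 0 <= eps <= 1 ->
  state h eps (2 * M) (2 * M * eps).
Proof.
by move=> hM e1; split; [exact: dev_bound|exact: dev_bound (bmeas_opp hM)
 |exact: dev_near_bound|exact: dev_near_bound (bmeas_opp hM) _].
Qed.

(* Before entering the cone, the crude bound [gap h = O(M)] is all one has, but
   [dev] contracts and the gap drifts by at most [O(eps)] at every step. *)
Lemma transient M eps t c h j n :
  0 <= eps <= 1000^-1 -> small_params eps ->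
  c + 12 * M * eps <= 24^-1 * t -> 64 * M * eps <= t -> 0 < t ->
  bmeas M h ->
  dev_le (prim h) (c * 2 ^+ j + 12 * M * eps) ->
  dev_le (prim (h \o -%R)) (c * 2 ^+ j + 12 * M * eps) ->
  t + 8 * M * eps * j%:R <= gap h -> 
  (j <= n)%N -> cone eps (h \o orb n).
Proof.
move=> eps1 sp h1 h2 t0; elim: j n h => [|j IH] n h hM s1 s2 g jn.
  apply: cone_orb => //.
  move: g; rewrite mulr0 addr0 => g.
  have [_ _ e1 e2] : state h eps (2 * M) (2 * M * eps).
    by apply: state_bound hM _; lra.
  split; [by exists M|lra|].
  split.
  - by move=> x x0; apply: le_trans (s1 x x0) _; rewrite expr0 mulr1; lra.
  - by move=> x x0; apply: le_trans (s2 x x0) _; rewrite expr0 mulr1; lra.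
  - by move=> x x0; apply: le_trans (e1 x x0) _; lra.
  - by move=> x x0; apply: le_trans (e2 x x0) _; lra.
case: n jn => [//|n] jn; rewrite orbS.
have [a0 b0] := sp n; have /andP[eps0 eps11] := eps1.
have M0 := bmeas_ge0 hM.
have gb := gap_bound hM.
have [_ _ e1 e2] : state h eps (2 * M) (2 * M * eps).
  by apply: state_bound hM _; lra.
have st : state h eps (c * 2 ^+ j.+1 + 12 * M * eps) (2 * M * eps) by [].
(* With [|gap h| <= 2 * M] and [e = 2 * M * eps], the error in [dev] becomes [6 + 1 + 4 = 11] times
   [M * eps] plus a term of second order, so the coefficient 12 reproduces itself; the gap moves by
   at most [(4 + 4) * M * eps]. *)
have [[s1' s2' _ _] dD] := state_tent hM eps11 a0 b0 st.
have E1 : eps * `|gap h| <= eps * (2 * M) by rewrite ler_wpM2l.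
have E2 : eps * (M * eps) <= 1000^-1 * (M * eps).
  by rewrite ler_wpM2r// mulr_ge0.
have E3 : 0 <= M * eps by apply: mulr_ge0.
apply: IH => //.
- exact: bmeas_tent.
- by move=> x x0; apply: le_trans (s1' x x0) _; rewrite exprS; lra.
- by move=> x x0; apply: le_trans (s2' x x0) _; rewrite exprS; lra.
- move: g dD; rewrite ler_norml -natr1 => g /andP[dD _]; lra.
Qed.

Definition hstar (x : R) : R := 2 * psi0 x.

Lemma hstarE x : hstar x = \1_IL x - \1_IR x.
Proof. by rewrite /hstar /psi0; field. Qed.

Lemma hstar_opp : hstar \o -%R = fun x => -1 * hstar x.
Proof.
apply/funext => x; rewrite /= !hstarE !indicE.
have -> : (- x \in IL) = (x \in IR).
  by apply/idP/idP; rewrite !inE /IL /IR/= !in_itv/=; lra.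
have -> : (- x \in IR) = (x \in IL).
  by apply/idP/idP; rewrite !inE /IL /IR/= !in_itv/=; lra.
by ring.
Qed.

Lemma bmeas_hstar : bmeas 1 hstar.
Proof.
split.
  have -> : hstar = (\1_IL \- \1_IR) by apply/funext => x; rewrite hstarE.
  by apply: measurable_funB; apply: measurable_indic; exact: measurable_itv.
move=> x; rewrite hstarE !indicE; case: (_ \in _); case: (_ \in _);
  rewrite /= ?subrr ?subr0 ?sub0r ?normr0 ?normrN ?normr1//.
Qed.

Lemma prim_hstar x : -1 <= x <= 0 -> prim hstar x = x + 1.
Proof.
move=> x0; rewrite /prim (@J_eqoo _ _ _ _ (fun=> 1)).
- by rewrite J_cst; [ring|lra].
- exact: bmeas_integ bmeas_hstar.
- exact: bmeas_integ (bmeas_cst 1).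
- move=> t tx; rewrite hstarE !indicE.
  rewrite (_ : t \in IL = true); last by apply/idP; rewrite inE/IL/= in_itv/=; lra.
  rewrite (_ : t \in IR = false) ?subr0//; apply/negP.
  by rewrite inE/IR/= in_itv/=; lra.
Qed.

Lemma gap_hstar : gap hstar = 2.
Proof.
rewrite /gap hstar_opp (primZ _ _ bmeas_hstar) prim_hstar; first by ring.
lra.
Qed.

Lemma dev_hstar x : -1 <= x <= 0 -> dev (prim hstar) x = 0.
Proof. by move=> x0; rewrite /dev !prim_hstar//; [ring|lra]. Qed.

Lemma dev_hstar_opp x : -1 <= x <= 0 -> dev (prim (hstar \o -%R)) x = 0.
Proof. by move=> x0; rewrite hstar_opp (devZ _ _ bmeas_hstar) dev_hstar// mulr0. Qed.

Lemma cone_hstar eps : 0 <= eps <= 1 -> cone eps hstar.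
Proof.
move=> e1; split; rewrite ?gap_hstar//; first by exists 1; exact: bmeas_hstar.
split=> x x0; rewrite ?dev_hstar ?dev_hstar_opp ?normr0; lra.
Qed.

(** Twice the pairing of [psi0] with [hstar \o orb n], that is, twice what survives of [psi0] after
    [n] steps. It is the scale against which all iterates are measured. *)
Definition mass n := gap (hstar \o orb n).

Section bounds.
Variable eps : R.
Hypotheses (eps1 : 0 <= eps <= 1000^-1) (sp : small_params eps).

Lemma mass_gt0 n : 0 < mass n.
Proof.
suff [] : cone eps (hstar \o orb n) by [].
by apply: cone_orb => //; apply: cone_hstar; move: eps1; lra.
Qed.

Lemma comp_lin c h n : (fun t => c * hstar t + h t) \o orb n =
  (fun t => c * (hstar \o orb n) t) \+ (h \o orb n).
Proof. by []. Qed.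

(** As [hstar] has no deviation, the function before iteration has deviation at most 2 but gap at
    least [100 - 2], well inside the cone. The value 50 is convenient, not optimal. *)
Lemma dominate1 h n : bmeas 1 h -> cone eps ((fun t => 50 * hstar t + h t) \o orb n).
Proof.
move=> h1; apply: cone_orb => //.
have sh : bmeas (`|50| * 1) (fun t => 50 * hstar t) by exact: bmeasZ bmeas_hstar.
have /(_ eps)[] := state_bound h1; first by move: eps1; lra.
move=> s1 s2 e1 e2.
have gE : gap (fun t => 50 * hstar t + h t) = 100 + gap h.
  by rewrite (gapD sh h1) (gapZ _ bmeas_hstar) gap_hstar; ring.
have := gap_bound h1; rewrite ler_norml => gb.
have dE x : -1 <= x <= 0 ->
    dev (prim (fun t => 50 * hstar t + h t)) x = dev (prim h) x.
  by move=> x0; rewrite (devD _ sh h1) (devZ _ _ bmeas_hstar) dev_hstar//; ring.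
have dE' x : -1 <= x <= 0 ->
    dev (prim ((fun t => 50 * hstar t + h t) \o -%R)) x = dev (prim (h \o -%R)) x.
  move=> x0.
  have -> : (fun t => 50 * hstar t + h t) \o -%R =
    (fun t => 50 * (hstar \o -%R) t) \+ (h \o -%R) by [].
  rewrite (devD _ (bmeasZ _ (bmeas_opp bmeas_hstar)) (bmeas_opp h1)).
  by rewrite (devZ _ _ (bmeas_opp bmeas_hstar)) dev_hstar_opp//; ring.
split; rewrite ?gE; [by exists (`|50| * 1 + 1); exact: bmeasD|lra|].
split=> x x0; rewrite ?dE ?dE'; try by move: eps1 x0; lra.
- by apply: le_trans (s1 x x0) _; lra.
- by apply: le_trans (s2 x x0) _; lra.
- by apply: le_trans (e1 x x0) _; move: eps1; lra.
- by apply: le_trans (e2 x x0) _; move: eps1; lra.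
Qed.

Lemma bmeasN1 h : bmeas 1 h -> bmeas 1 (fun t => -1 * h t).
Proof. by move=> /(bmeasZ (-1)); rewrite normrN1 mulr1. Qed.

(** Cone members have positive gap; using this for [h] and for its opposite gives both sides. *)
Lemma gap_dominate h n : bmeas 1 h -> `|gap (h \o orb n)| <= 50 * mass n.
Proof.
move=> h1.
have sh := bmeasZ 50 (bmeas_orb n bmeas_hstar).
have [_ + _] := dominate1 n h1.
rewrite comp_lin (gapD sh (bmeas_orb n h1)) (gapZ _ (bmeas_orb n bmeas_hstar)).
have [_ + _] := dominate1 n (bmeasN1 h1).
rewrite comp_lin (gapD sh (bmeas_orb n (bmeasN1 h1))) (gapZ _ (bmeas_orb n bmeas_hstar)).
rewrite -[(fun t => -1 * h t) \o orb n]/(fun t => -1 * (h \o orb n) t).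
rewrite (gapZ _ (bmeas_orb n h1)) -/(mass n) ler_norml; lra.
Qed.

(** [h] is the difference of [50 * hstar + h], whose iterate has gap at most [100 * mass n], and of
    [50 * hstar], with gap [50 * mass n]. The cone bounds both deviations, and [150 / 24 < 7]. *)
Lemma dev_dominate h n : bmeas 1 h ->
  dev_le (prim (h \o orb n)) (7 * mass n) /\
  dev_le (prim (h \o orb n \o -%R)) (7 * mass n).
Proof.
move=> h1.
have hsn := bmeas_orb n bmeas_hstar.
have hn := bmeas_orb n h1.
have sh := bmeasZ 50 hsn.
have [_ _ []] := dominate1 n h1.
have [_ _ []] : cone eps (hstar \o orb n).
  by apply: cone_orb => //; apply: cone_hstar; move: eps1; lra.
rewrite -/(mass n) comp_lin (gapD sh hn) (gapZ _ hsn) -/(mass n) => s1 s2 _ _ t1 t2 _ _.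
have := gap_dominate n h1; rewrite ler_norml => gd.
have m0 := mass_gt0 n.
split=> x x0.
- have := t1 x x0; have := s1 x x0.
  rewrite (devD _ sh hn) (devZ _ _ hsn) !ler_norml; lra.
- have := t2 x x0; have := s2 x x0.
  rewrite -[(_ \+ _) \o -%R]/((fun t => 50 * (hstar \o orb n \o -%R) t) \+ (h \o orb n \o -%R)).
  rewrite (devD _ (bmeasZ _ (bmeas_opp hsn)) (bmeas_opp hn)) (devZ _ _ (bmeas_opp hsn)).
  rewrite !ler_norml; lra.
Qed.

End bounds.
End koopman.

(** * Pairing with functions of bounded variation *)

Section direction.
Context {R : realType}.
Implicit Types (t eps : R) (h : R -> R).

Lemma pair_psi0 M h : bmeas M h -> J (fun x => psi0 x * h x) (-1) 1 = 2^-1 * gap h.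
Proof.
move=> hM.
have ps x : psi0 x = 2^-1 * (hstar x : R) by rewrite /hstar; field.
rewrite (@J_eq _ _ _ _ (fun x => 2^-1 * (hstar x * h x))); last first.
  by move=> x _; rewrite ps; ring.
have ih x y : integ x y (fun z => hstar z * h z).
  by apply: (integM hM); exact: bmeas_integ bmeas_hstar.
rewrite JZ// (@J_chasles _ (-1) 0 1)//.
congr (_ * _); rewrite /gap (prim_oppE _ hM) oppr0; congr (_ + _).
  apply: J_eqoo => //; first exact: bmeas_integ hM.
  move=> x x0; rewrite hstarE !indicE.
  rewrite (_ : x \in IL = true); last by apply/idP; rewrite inE/IL/= in_itv/=; lra.
  rewrite (_ : x \in IR = false) ?subr0 ?mul1r//; apply/negP.
  by rewrite inE/IR/= in_itv/=; lra.
rewrite -[RHS]mulN1r -JZ; last exact: bmeas_integ hM.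
apply: J_eqoo => //; first by apply: integZ; exact: bmeas_integ hM.
move=> x x0; rewrite hstarE !indicE.
rewrite (_ : x \in IR = true); last by apply/idP; rewrite inE/IR/= in_itv/=; lra.
rewrite (_ : x \in IL = false) ?sub0r//; apply/negP.
by rewrite inE/IL/= in_itv/=; lra.
Qed.

(** Removing from [h] its component [2^-1 * gap h] along [hstar] leaves a function of gap 0; adding
    [t * hstar] gives it gap [2 * t]. For small [eps] this gap outlasts the [k] steps after which
    [dev] is small enough for the cone, and positivity of the gap from then on is one side of the
    estimate. *)
Lemma direction t : 0 < t <= 1 -> exists k (eps0 : R),
  0 < eps0 <= 1000^-1 /\ forall eps th, 0 <= eps <= eps0 -> small_params th eps ->
  forall n h, (k <= n)%N -> bmeas 1 h ->
  `|gap (h \o orb th n) - 2^-1 * gap h * mass th n| <= t * mass th n.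
Proof.
move=> t01.
(* The cone asks for a deviation below [24^-1 * t]; half of this is reserved for the halved initial
   deviation, at most 2, and the rest for the error [12 * M * eps]. *)
have [k hk] : exists k, 2 / 2 ^+ k <= 48^-1 * t.
  exists (Num.truncn (96 / t)).
  rewrite ler_pdivrMr ?exprn_gt0//.
  have : 96 / t < (2 ^+ (Num.truncn (96 / t)) : R).
    have t96 : 0 <= 96 / t by apply: divr_ge0; lra.
    apply: (lt_le_trans (truncnS_gt _)).
    by rewrite -natrX ler_nat ltn_expl.
  rewrite ltr_pdivrMr; lra.
have k1 : 1 <= (k.+1%:R : R) by rewrite ler1n.
have [r [r0 r1 rt]] : exists r : R, [/\ 0 < r, r <= 1000^-1 & 2 * r <= 1000^-1 * t].
  by exists (2000^-1 * t); split; lra.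
have [eps0 [e1 e0]] : exists e : R, 0 < e /\ e * k.+1%:R = r.
  exists (r / k.+1%:R); split; last by rewrite mulfVK// gt_eqF//; apply: lt_le_trans k1.
  by apply: divr_gt0 => //; apply: lt_le_trans k1.
have e2 : eps0 <= r by rewrite -e0 ler_peMr//; exact: ltW.
exists k, eps0; split; first by apply/andP; split => //; exact: le_trans r1.
move=> eps th ep sp n h kn h1.
have eps1 : 0 <= eps <= 1000^-1 by lra.
have ek : eps * k%:R <= r.
  rewrite -e0; by move: ep => /andP[? ?]; apply: ler_pM; rewrite ?ler_nat.
have sn := bmeas_orb th n (@bmeas_hstar R).
have hn := bmeas_orb th n h1.
suff key (sg : R) : sg = 1 \/ sg = -1 ->
    0 <= t * mass th n + sg * (gap (h \o orb th n) - 2^-1 * gap h * mass th n).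
  rewrite ler_norml; apply/andP; split.
    by have := key 1 (or_introl erefl); lra.
  by have := key (-1) (or_intror erefl); lra.
move=> sg1.
have nsg : `|sg| = 1 by case: sg1 => ->; rewrite ?normrN1 ?normr1.
have gb := gap_bound h1; rewrite mulr1 in gb.
(* [p] is [t * hstar] plus [sg] times the gap-free part of [h]. It is bounded by 3 since
   [|c| <= t + 1 <= 2]. *)
pose c := t - sg * 2^-1 * gap h.
pose p := (fun x => c * hstar x) \+ (fun x => sg * h x).
have pM : bmeas 3 p.
  apply: bmeasW (bmeasD (bmeasZ c bmeas_hstar) (bmeasZ sg h1)).
  rewrite nsg !mulr1 /c.
  have : `|sg * 2^-1 * gap h| <= 1.
    rewrite !normrM nsg mul1r ger0_norm; [|lra].
    by rewrite mulrC ler_pdivrMr//; lra.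
  have := ler_normB t (sg * 2^-1 * gap h); rewrite (@ger0_norm _ t); lra.
have sgsg : sg * sg = 1 by case: sg1 => ->; ring.
have gp : gap p = 2 * t.
  rewrite (gapD (bmeasZ c bmeas_hstar) (bmeasZ sg h1)) (gapZ _ bmeas_hstar).
  by rewrite (gapZ _ h1) gap_hstar /c; field.
have dp x : -1 <= x <= 0 -> dev (prim p) x = sg * dev (prim h) x.
  move=> x0; rewrite (devD _ (bmeasZ c bmeas_hstar) (bmeasZ sg h1)).
  by rewrite (devZ _ _ bmeas_hstar) (devZ _ _ h1) dev_hstar//; ring.
have dp' x : -1 <= x <= 0 -> dev (prim (p \o -%R)) x = sg * dev (prim (h \o -%R)) x.
  move=> x0; have h1' := bmeas_opp h1; have s' := bmeas_opp (@bmeas_hstar R).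
  have -> : p \o -%R = (fun x => c * (hstar \o -%R) x) \+
    (fun x => sg * (h \o -%R) x) by [].
  rewrite (devD _ (bmeasZ c s') (bmeasZ sg h1')).
  by rewrite (devZ _ _ s') (devZ _ _ h1') dev_hstar_opp//; ring.
have [_ + _] : cone eps (p \o orb th n).
  have pk : 2 / 2 ^+ k * 2 ^+ k = 2 :> R by rewrite mulfVK// expf_neq0.
  apply: (@transient _ th 3 eps t (2 / 2 ^+ k) p k n) => //; try lra.
  - move=> x x0; rewrite dp// normrM nsg mul1r pk.
    by apply: le_trans (dev_bound h1 x0) _; lra.
  - move=> x x0; rewrite dp'// normrM nsg mul1r pk.
    by apply: le_trans (dev_bound (bmeas_opp h1) x0) _; lra.
have -> : p \o orb th n = (fun x => c * (hstar \o orb th n) x) \+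
    (fun x => sg * (h \o orb th n) x) by [].
rewrite (gapD (bmeasZ c sn) (bmeasZ sg hn)) (gapZ _ sn) (gapZ _ hn) -/(mass th n) /c.
lra.
Qed.

End direction.

(** * Monotone functions and summation by parts *)

Section bounded_variation_pairing.
Context {R : realType}.
Local Notation mu := (@lebesgue_measure R).
Implicit Types (f g h k : R -> R) (a b s M : R).

Definition ndec g : Prop := {homo g : x y / x <= y}.

Lemma ndec_measurable g (D : set R) : measurable D -> ndec g -> measurable_fun D g.
Proof. by move=> mD gn; apply: nondecreasing_measurable => // x y; exact: gn. Qed.

Lemma ndec_integ g a b : ndec g -> integ a b g.
Proof.
move=> gn; apply: measurable_bounded_integrable.
- exact: measurable_itv.
- have := @lebesgue_measure_itv R `[a, b] => /= ->.
  by case: ifP => _ //; rewrite ltry.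
- by apply: ndec_measurable => //; exact: measurable_itv.
- exists (`|g a| + `|g b|); split; first exact: num_real.
  move=> N MN x; rewrite /intv/= in_itv/= => /andP[ax xb].
  have := gn _ _ ax; have := gn _ _ xb.
  have := ler_norm (g b); have := ler_norm (- g a).
  have := normr_ge0 (g a); have := normr_ge0 (g b).
  rewrite normrN ler_norml; lra.
Qed.

(* By Abel summation over a grid whose mesh tends to 0. *)
Lemma second_mean g k a b M s : a <= b -> ndec g -> bmeas M k ->
  (forall x, a <= x <= b -> `|J k a x| <= s) -> J k a b = 0 ->
  `|J (fun t => g t * k t) a b| <= s * (g b - g a).
Proof.
move=> ab gn kM Gs G0.
have igk x y : integ x y (fun t => g t * k t) by apply: (integM kM); exact: ndec_integ.
have ik x y : integ x y k by exact: bmeas_integ kM.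
have M0 := bmeas_ge0 kM.
have grid (n : nat) : (0 < n)%N ->
    `|J (fun t => g t * k t) a b| <= (s + M * ((b - a) / n%:R)) * (g b - g a).
  move=> n0; set d := (b - a) / n%:R.
  have n0' : (n%:R : R) != 0 by rewrite pnatr_eq0 -lt0n.
  have d0 : 0 <= d by rewrite divr_ge0// subr_ge0.
  (* The boundary term [g * J k a _] stays in the invariant; at [b] it disappears because
     [J k a b = 0]. *)
  have main (i : nat) : (i <= n)%N ->
    `|J (fun t => g t * k t) a (a + i%:R * d) - g (a + i%:R * d) * J k a (a + i%:R * d)|
      <= (s + M * d) * (g (a + i%:R * d) - g a).
    elim: i => [_|i IH ilt].
      by rewrite mul0r addr0 !J_point mulr0 subrr normr0 subrr mulr0.
    have {IH} := IH (ltnW ilt).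
    have -> : a + i.+1%:R * d = a + i%:R * d + d by rewrite -natr1; ring.
    set x := a + i%:R * d; set y := x + d.
    have xy : x <= y by rewrite lerDl.
    have ax : a <= x by rewrite lerDl mulr_ge0.
    have yb : y <= b.
      have -> : b = a + n%:R * d by rewrite /d mulrC mulfVK//; ring.
      have -> : y = a + i.+1%:R * d by rewrite /y /x -natr1; ring.
      by rewrite lerD2l ler_wpM2r// ler_nat.
    have gxy := gn _ _ xy.
    have -> : J (fun t => g t * k t) a y = J (fun t => g t * k t) a x +
      (g x * J k x y + J (fun t => (g t - g x) * k t) x y).
      rewrite (@J_chasles _ a x y)//; congr (_ + _).
      rewrite -JZ// -JD//; [|exact: integZ|]; first by apply: J_eq => t _; ring.
      apply: (@integ_eq _ _ _ (fun t => g t * k t - g x * k t)) => [t _|]; first by ring.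
      by apply: integB => //; exact: integZ.
    rewrite (@J_chasles _ a x y k)//.
    have err : `|J (fun t => (g t - g x) * k t) x y| <= (g y - g x) * (M * d).
      have ie : integ x y (fun t => (g t - g x) * k t).
        apply: (@integ_eq _ _ _ (fun t => g t * k t - g x * k t)) => [t _|]; first by ring.
        by apply: integB => //; exact: integZ.
      rewrite (le_trans (J_norm ie))//.
      have -> : (g y - g x) * (M * d) = J (fun=> (g y - g x) * M) x y.
        by rewrite J_cst// /y; ring.
      apply: J_le; [exact: integ_norm|exact: bmeas_integ (bmeas_cst _)|].
      move=> t /andP[xt ty]; rewrite normrM; apply: ler_pM => //.
        rewrite ger0_norm ?subr_ge0; last exact: gn.
        by rewrite lerD2r gn.
      by case: kM => _ ->.
    have Gy : `|J k a x + J k x y| <= s.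
      by rewrite -J_chasles//; apply: Gs; rewrite (le_trans ax).
    move: Gy; set P := J k a x; set Q := J k x y => Gy IH.
    set E := J (fun t => _) x y in err *.
    set A := J _ a x in IH *.
    have -> : A + (g x * Q + E) - g y * (P + Q) =
      (A - g x * P) + (E - (g y - g x) * (P + Q)) by ring.
    rewrite (le_trans (ler_normD _ _))//.
    have : `|E - (g y - g x) * (P + Q)| <= (s + M * d) * (g y - g x).
      rewrite (le_trans (ler_normB _ _))// normrM [`|g y - g x|]ger0_norm ?subr_ge0//.
      have : (g y - g x) * `|P + Q| <= (g y - g x) * s by rewrite ler_wpM2l// subr_ge0.
      lra.
    lra.
  have := main n (leqnn n).
  have -> : a + n%:R * d = b by rewrite /d mulrC mulfVK//; ring.
  by rewrite G0 mulr0 subr0.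
apply/ler_addgt0Pr => e e0.
have gab := gn _ _ ab.
set X := M * (b - a) * (g b - g a).
have X0 : 0 <= X by rewrite !mulr_ge0// subr_ge0.
pose n := (Num.truncn (X / e)).+1.
have n1 : X / e < n%:R := truncnS_gt _.
have n0 : 0 < (n%:R : R) by rewrite ltr0n.
apply: (le_trans (grid n isT)).
have : X / n%:R <= e.
  by rewrite ler_pdivrMr// mulrC -ler_pdivrMr//; exact: ltW.
by rewrite /X; lra.
Qed.

(** [second_mean] is applied on each half to [h] minus its mean there; on the right half the
    primitive of this difference is, up to sign, [dev] of the reflected function. *)
Lemma ndec_pairing g h M s : ndec g -> bmeas M h ->
  dev_le (prim h) s -> dev_le (prim (h \o -%R)) s ->
  `|J (fun t => g t * h t) (-1) 1 -
    (J g (-1) 0 * prim h 0 + J g 0 1 * prim (h \o -%R) 0)| <= s * (g 1 - g (-1)).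
Proof.
move=> gn hM s1 s2.
have igh x y : integ x y (fun t => g t * h t) by apply: (integM hM); exact: ndec_integ.
have ig x y : integ x y g by exact: ndec_integ.
have ih x y : integ x y h by exact: bmeas_integ hM.
rewrite (prim_oppE _ hM) oppr0.
set p := prim h 0; set q := J h 0 1.
have half (c x y : R) : x <= y ->
    J (fun t => g t * (h t - c)) x y = J (fun t => g t * h t) x y - J g x y * c.
  move=> xy; rewrite mulrC -JZ// -JB//; last exact: integZ.
  by apply: J_eq => t _; ring.
have bc c : bmeas (M + `|c|) (fun t => h t - c) by apply: bmeasB hM (bmeas_cst c).
have pc c x y : x <= y -> J (fun t => h t - c) x y = J h x y - c * (y - x).
  by move=> xy; rewrite JB// ?J_cst//; exact: bmeas_integ (bmeas_cst c).
have l1 : `|J (fun t => g t * (h t - p)) (-1) 0| <= s * (g 0 - g (-1)).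
  apply: second_mean (bc p) _ _ => //.
    move=> x x0; rewrite pc; last by lra.
    by apply: le_trans (s1 x x0); rewrite /dev opprK.
  by rewrite pc; [rewrite /p /prim; ring|lra].
have l2 : `|J (fun t => g t * (h t - q)) 0 1| <= s * (g 1 - g 0).
  apply: second_mean (bc q) _ _ => //.
    move=> x x0; rewrite pc; last by lra.
    have x0' : -1 <= - x <= 0 by lra.
    apply: le_trans (s2 _ x0').
    rewrite /dev !(prim_oppE _ hM) opprK oppr0 -/q.
    have -> : J h 0 x = q - J h x 1.
      by rewrite /q (@J_chasles _ 0 x 1)//; [ring|lra|lra].
    rewrite addr0.
    have -> : q - J h x 1 - q * x = - (J h x 1 - q * (- x + 1)) by ring.
    by rewrite normrN.
  by rewrite pc ?ler01// /q; ring.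
rewrite (@J_chasles _ (-1) 0 1)//.
rewrite !half// in l1 l2.
move: l1 l2; rewrite !ler_norml => /andP[a1 a2] /andP[b1 b2].
by apply/andP; split; lra.
Qed.

End bounded_variation_pairing.

Section monotone_differences.
Context {R : realType}.
Local Notation mu := (@lebesgue_measure R).
Implicit Types (f g h : R -> R) (x y K : R).

Lemma aeS (P Q : R -> Prop) : (forall x, P x -> Q x) ->
  (\forall x \ae mu, P x) -> \forall x \ae mu, Q x.
Proof. by move=> PQ [N [mN N0 PN]]; exists N; split => // x nQ; apply: PN => /PQ. Qed.

Lemma aeS2 (P Q S : R -> Prop) : (forall x, P x -> Q x -> S x) ->
  (\forall x \ae mu, P x) -> (\forall x \ae mu, Q x) -> \forall x \ae mu, S x.
Proof.
move=> PQS [N [mN N0 PN]] [N' [mN' N0' QN]]; exists (N `|` N'); split.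
- exact: measurableU.
- by rewrite (measureU0 mN mN' N0').
- by move=> x nS; case: (pselect (P x)) => [Px|/PN]; [right; apply: QN => /(PQS _ Px)|left].
Qed.

Lemma eqI_sym f g : eqI f g -> eqI g f.
Proof. by apply: aeS => x h /h ->. Qed.

Lemma eqI_trans f g h : eqI f g -> eqI g h -> eqI f h.
Proof. by move=> fg gh; apply: aeS2 fg gh => x e1 e2 xI; rewrite e1// e2. Qed.

Lemma measurable_fun_intv f x y : -1 <= x -> y <= 1 -> measurable_fun (@II R) f ->
  measurable_fun (intv x y) f.
Proof.
move=> x1 y1; apply: measurable_funS; first exact: measurable_itv.
by apply: subset_itvScc; rewrite bnd_simp.
Qed.

Lemma eqI_sub f g x y : -1 <= x -> y <= 1 -> eqI f g ->
  ae_eq mu (intv x y) (EFin \o f) (EFin \o g).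
Proof.
move=> x1 y1; apply: aeS => t h; rewrite /intv/= in_itv/= => /andP[xt ty].
by congr EFin; apply: h; rewrite /II/= in_itv/= (le_trans x1)// (le_trans ty).
Qed.

Lemma eqI_J f g x y : -1 <= x -> y <= 1 -> measurable_fun (@II R) f ->
  measurable_fun (@II R) g -> eqI f g -> J f x y = J g x y.
Proof.
move=> x1 y1 mf mg fg; rewrite /J /Rintegral; congr fine.
apply: ae_eq_integral.
- exact: measurable_itv.
- by apply/measurable_EFinP; exact: measurable_fun_intv.
- by apply/measurable_EFinP; exact: measurable_fun_intv.
- exact: eqI_sub.
Qed.

Lemma eqI_integ f g : measurable_fun (@II R) f -> eqI f g ->
  integ (-1) 1 g -> integ (-1) 1 f.
Proof.
move=> mf fg /integrableP[mg gi]; apply/integrableP; split.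
  exact/measurable_EFinP.
apply: le_lt_trans gi; rewrite le_eqVlt; apply/orP; left; apply/eqP; apply: ae_eq_integral.
- exact: measurable_itv.
- by apply: measurableT_comp => //; exact/measurable_EFinP.
- exact: measurableT_comp.
- by apply: aeS (eqI_sub (lexx (-1)) (lexx 1) fg) => t h /h ->.
Qed.

(** No grid cell lies to the right of 1, so the value at 1 has to be recovered from the left, by
    left continuity; constancy beyond 1 makes it the right limit as well. *)
Definition left_cont1 g := (forall x, 1 <= x -> g x = g 1) /\
  forall e, 0 < e -> exists2 y, y < 1 & g 1 - e < g y.

Lemma left_cont1_modif g : ndec g -> exists g', 
  [/\ ndec g', left_cont1 g' & forall x, x < 1 -> g' x = g x].
Proof.
move=> gn; pose S := [set g y | y in [set y | y < 1]].
have hsS : has_sup S.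
  split; first by exists (g 0), 0 => //=.
  by exists (g 1) => _ [y /= y1 <-]; apply: gn; exact: ltW.
exists (fun x => if x < 1 then g x else sup S); split.
- move=> x y xy; case: ifPn => x1; case: ifPn => y1 //.
  + exact: gn.
  + by apply: ub_le_sup; [case: hsS|exists x].
  + by move: x1; rewrite (le_lt_trans xy y1).
- split.
  + by move=> x x1; rewrite ltNge x1/= ltxx.
  + move=> e e0; rewrite ltxx; have [_ [y /= y1 <-] ye] := sup_adherent e0 hsS.
    by exists y => //; rewrite y1.
- by move=> x ->.
Qed.

Lemma ae_ne (c : R) (Q : R -> Prop) : (forall x, x != c -> Q x) -> \forall x \ae mu, Q x.
Proof.
move=> H; exists [set c]; split; [exact: measurable_set1|exact: lebesgue_measure_set1|].
by move=> x /= nQ; apply/eqP; apply/negPn/negP => /H.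
Qed.

(** Jordan decomposition of a representative, changed only at the point 1 to obtain [left_cont1]. *)
Lemma BVI_split f : BVI f -> exists g1 g2,
  [/\ ndec g1, ndec g2, left_cont1 g1, left_cont1 g2 & eqI f (g1 \- g2)].
Proof.
move=> [_ [g [fg bvg]]].
(* Clamping to [[-1, 1]] makes the Jordan parts monotone on the whole line, as [ndec] demands. *)
pose cl x : R := Num.max (-1) (Num.min x 1).
have clI x : cl x \in `[-1, 1].
  by rewrite in_itv/= /cl le_max lexx/= ge_max ge_min lexx orbT andbT; lra.
have cln x y : x <= y -> cl x <= cl y.
  by move=> xy; rewrite /cl le_max2// le_min2.
have clid x : -1 <= x <= 1 -> cl x = x.
  by move=> /andP[x1 x2]; rewrite /cl min_l// max_r.
have nd k : bounded_variation (-1) 1 k -> ndec (fun x => fine (neg_tv (-1) k (cl x))).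
  by move=> bvk x y xy; apply: (fine_neg_tv_nondecreasing bvk) => //; exact: cln.
have [g1 [n1 l1 e1]] := left_cont1_modif (nd _ (bounded_variationN bvg)).
have [g2 [n2 l2 e2]] := left_cont1_modif (nd _ bvg).
exists g1, g2; split => //; apply: (eqI_trans fg).
apply: (@ae_ne 1) => x x1; rewrite /II/= => xI.
rewrite (bounded_variation_pos_neg_tvE bvg xI) /= e1 ?e2 ?clid//;
  by move: xI; rewrite in_itv/= lt_neqAle x1/= => /andP[].
Qed.

Lemma BVI_integ f : BVI f -> integ (-1) 1 f.
Proof.
move=> fB; have [g1 [g2 [n1 n2 _ _ fg]]] := BVI_split fB.
apply: eqI_integ fg _; first by case: fB.
by apply: integB; exact: ndec_integ.
Qed.

(** [C] is the total increase of the two monotone parts. The sup bound of [h] does not enter the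
    estimate, so a small deviation alone makes the error small. *)
Lemma BVI_pairing f : BVI f -> exists C, 0 <= C /\ forall h M s, bmeas M h ->
  dev_le (prim h) s -> dev_le (prim (h \o -%R)) s ->
  `|J (fun t => f t * h t) (-1) 1 -
    (J f (-1) 0 * prim h 0 + J f 0 1 * prim (h \o -%R) 0)| <= C * s.
Proof.
move=> fB; have [g1 [g2 [n1 n2 _ _ fg]]] := BVI_split fB.
have mI : measurable (@II R) by exact: measurable_itv.
have mf : measurable_fun (@II R) f by case: fB.
have mg1 := ndec_measurable mI n1; have mg2 := ndec_measurable mI n2.
have mg : measurable_fun (@II R) (g1 \- g2) by exact: measurable_funB.
exists ((g1 1 - g1 (-1)) + (g2 1 - g2 (-1))); split.
  by rewrite addr_ge0// subr_ge0; [apply: n1|apply: n2]; lra.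
move=> h M s hM s1 s2.
have mh : measurable_fun (@II R) h by apply: measurable_funTS; case: hM.
have i1 x y := ndec_integ x y n1; have i2 x y := ndec_integ x y n2.
have -> : J (fun t => f t * h t) (-1) 1 =
  J (fun t => g1 t * h t) (-1) 1 - J (fun t => g2 t * h t) (-1) 1.
  rewrite -JB; [|exact: integM hM _|exact: integM hM _].
  apply: eqI_J; rewrite ?lexx//.
  - exact: measurable_funM.
  - by apply: measurable_funB; exact: measurable_funM.
  - by apply: aeS fg => t H tI; rewrite H//= mulrBl.
have E x y : -1 <= x -> y <= 1 -> J f x y = J g1 x y - J g2 x y.
  by move=> x1 y1; rewrite (eqI_J x1 y1 mf mg fg) -JB.
rewrite !E ?lexx//.
have := ndec_pairing n1 hM s1 s2; have := ndec_pairing n2 hM s1 s2.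
rewrite !ler_norml => /andP[a1 a2] /andP[b1 b2]; apply/andP; split; lra.
Qed.

End monotone_differences.

(** * Variation through averages over uniform grids *)

Section grid.
Context {R : realType}.
Local Notation mu := (@lebesgue_measure R).
Implicit Types (f g : R -> R) (x y K e : R) (N i : nat).

(** Index [N] denotes the grid with [N.+1] cells, so no grid is empty. *)
Definition wd N : R := 2 / N.+1%:R.
Definition pt N i : R := -1 + i%:R * wd N.
Definition mean N f i : R := J f (pt N i) (pt N i.+1) / wd N.
Definition wvar N f : R := \sum_(0 <= i < N) `|mean N f i.+1 - mean N f i|.
Definition wl1 N f : R := \sum_(0 <= i < N.+1) `|J f (pt N i) (pt N i.+1)|.

Lemma wd_gt0 N : 0 < wd N. Proof. exact: divr_gt0. Qed.

Lemma pt0 N : pt N 0 = -1. Proof. by rewrite /pt mul0r addr0. Qed.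

Lemma ptS N i : pt N i.+1 = pt N i + wd N.
Proof. by rewrite /pt -natr1; ring. Qed.

Lemma ptN N : pt N N.+1 = 1.
Proof. by rewrite /pt /wd mulrC mulfVK ?pnatr_eq0//; ring. Qed.

Lemma le_pt N i j : (i <= j)%N -> pt N i <= pt N j.
Proof. by move=> ij; rewrite lerD2l ler_wpM2r ?ler_nat//; exact/ltW/wd_gt0. Qed.

Lemma pt_ge N i : -1 <= pt N i.
Proof. by rewrite -(pt0 N); exact: le_pt. Qed.

Lemma pt_le N i : (i <= N.+1)%N -> pt N i <= 1.
Proof. by move=> iN; rewrite -(ptN N); exact: le_pt. Qed.

Lemma integ_cell N f i : integ (-1) 1 f -> (i <= N)%N ->
  integ (pt N i) (pt N i.+1) f.
Proof. by move=> fi iN; apply: integ_sub fi; [exact: pt_ge|exact: pt_le]. Qed.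

Lemma J_grid N f : integ (-1) 1 f ->
  \sum_(0 <= i < N.+1) J f (pt N i) (pt N i.+1) = J f (-1) 1.
Proof.
move=> fi; suff H j : (j <= N.+1)%N ->
    \sum_(0 <= i < j) J f (pt N i) (pt N i.+1) = J f (-1) (pt N j).
  by rewrite H// ptN.
elim: j => [_|j IH jN]; first by rewrite big_geq// pt0 J_point.
rewrite big_nat_recr//= IH; last exact: ltnW.
rewrite [RHS](@J_chasles _ _ (pt N j))//; first exact: pt_ge.
  exact: le_pt.
by apply: integ_sub fi => //; exact: pt_le.
Qed.

Lemma wl1_le N f : integ (-1) 1 f -> wl1 N f <= J (fun t => `|f t|) (-1) 1.
Proof.
move=> fi; rewrite -(J_grid N); last exact: integ_norm.
rewrite /wl1 !big_nat; apply: ler_sum => i /= iN.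
by apply: J_norm; exact: integ_cell.
Qed.

Lemma mean_ndec g N i : ndec g -> g (pt N i) <= mean N g i <= g (pt N i.+1).
Proof.
move=> gn; have w0 := wd_gt0 N.
have ig := ndec_integ (pt N i) (pt N i.+1) gn.
have ic c := bmeas_integ (pt N i) (pt N i.+1) (@bmeas_cst R c).
have E c : c * wd N = J (fun=> c) (pt N i) (pt N i.+1).
  by rewrite J_cst ?ptS; [ring|rewrite lerDl ltW].
rewrite /mean ler_pdivlMr// ler_pdivrMr// !E.
by apply/andP; split; apply: J_le => // t /andP[? ?]; exact: gn.
Qed.

Section split.
Variables (f g1 g2 : R -> R).
Hypotheses (mf : measurable_fun (@II R) f) (n1 : ndec g1) (n2 : ndec g2)
  (fg : eqI f (g1 \- g2)).
Let V x := g1 x + g2 x.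

Let mg : measurable_fun (@II R) (g1 \- g2).
Proof.
by apply: measurable_funB; apply: ndec_measurable => //; exact: measurable_itv.
Qed.

Let ig x y : integ x y (g1 \- g2).
Proof. by apply: integB; exact: ndec_integ. Qed.

Lemma mean_split N i : (i <= N)%N -> mean N f i = mean N g1 i - mean N g2 i.
Proof.
move=> iN; rewrite /mean (eqI_J (pt_ge N i) (@pt_le N i.+1 iN) mf mg fg) JB.
- by rewrite mulrBl.
- exact: ndec_integ.
- exact: ndec_integ.
Qed.

(** Consecutive means differ by at most the increase of [V] over two adjacent cells, and each cell
    is counted at most twice. *)
Lemma wvar_le N : wvar N f <= 2 * (V 1 - V (-1)).
Proof.
have -> : 2 * (V 1 - V (-1)) =
    (V (pt N N.+1) - V (pt N 1)) + (V (pt N 1) - V (pt N 0)) + (V (pt N N.+1) - V (pt N 0)).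
  by rewrite pt0 ptN; ring.
apply: (@le_trans _ _ ((V (pt N N.+1) - V (pt N 1)) + (V (pt N N) - V (pt N 0)))).
  rewrite -(@telescope_sumr _ 0 N (fun i => V (pt N i)))//.
  rewrite -[V (pt N N.+1) - V (pt N 1)](@telescope_sumr _ 0 N (fun i => V (pt N i.+1)))//.
  rewrite -big_split/= /wvar !big_nat; apply: ler_sum => i /= iN.
  rewrite !mean_split//; last exact: ltnW.
  have := mean_ndec N i n1; have := mean_ndec N i.+1 n1.
  have := mean_ndec N i n2; have := mean_ndec N i.+1 n2.
  by rewrite /V ler_norml; lra.
have := n1 (le_pt N (leqnSn N)); have := n2 (le_pt N (leqnSn N)).
have := n1 (le_pt N (leqnSn 0)); have := n2 (le_pt N (leqnSn 0)).
by rewrite /V; lra.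
Qed.

(** On a cell, [f] differs from its mean by at most the increase of [V] there; summing these errors
    gives a converse of [wl1_le] with an error of order [wd N]. *)
Lemma J_norm_le N :
  J (fun t => `|f t|) (-1) 1 <= wl1 N f + wd N * (V 1 - V (-1)).
Proof.
have fi : integ (-1) 1 f by exact: eqI_integ mf fg (ig _ _).
rewrite -(J_grid N); last exact: integ_norm.
have -> : V 1 - V (-1) = \sum_(0 <= i < N.+1) (V (pt N i.+1) - V (pt N i)).
  by rewrite (@telescope_sumr _ 0 N.+1 (fun i => V (pt N i)))// ptN pt0.
rewrite mulr_sumr -big_split/= !big_nat; apply: ler_sum => i /= iN.
set x := pt N i; set y := pt N i.+1.
have w0 := wd_gt0 N.
have yE : y = x + wd N by exact: ptS.
have xy : x <= y by exact: le_pt.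
have fE : J (fun t => `|f t|) x y = J (fun t => `|(g1 \- g2) t|) x y.
  apply: eqI_J; [exact: pt_ge|exact: pt_le|exact: measurableT_comp|exact: measurableT_comp|].
  by apply: aeS fg => t H tI; rewrite H.
rewrite fE (eqI_J (pt_ge N i) (@pt_le N i.+1 iN) mf mg fg) -/x -/y.
set m := J (g1 \- g2) x y.
have mE : m = (mean N g1 i - mean N g2 i) * wd N.
  rewrite /m (JB (ndec_integ _ _ n1) (ndec_integ _ _ n2)) /mean -/x -/y.
  by rewrite mulrBl !mulfVK// gt_eqF.
have -> : `|m| + wd N * (V y - V x) =
    J (fun=> `|mean N g1 i - mean N g2 i| + (V y - V x)) x y.
  by rewrite J_cst// mE normrM (gtr0_norm w0) yE; ring.
apply: J_le => //; [exact: integ_norm|exact: bmeas_integ (bmeas_cst _)|].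
move=> t /andP[xt ty]; rewrite -[X in `|X|](subrK (mean N g1 i - mean N g2 i)) addrC.
rewrite (le_trans (ler_normD _ _))// lerD2l.
have := mean_ndec N i n1; have := mean_ndec N i n2; rewrite -/x -/y.
have := n1 xt; have := n1 ty; have := n2 xt; have := n2 ty.
by rewrite /V /= ler_norml; lra.
Qed.

End split.

Lemma wd_small (C : R) e : 0 <= C -> 0 < e -> \forall N \near \oo, wd N * C <= e.
Proof.
move=> C0 e0; near=> N.
rewrite /wd mulrAC ler_pdivrMr// -ler_pdivrMl// mulrC.
apply: (@le_trans _ _ N%:R); last by rewrite ler_nat.
near: N; exact: nbhs_infty_ger.
Unshelve. all: by end_near. Qed.

Lemma BVI_weak f : BVI f -> exists K, forall N, wvar N f <= K /\ wl1 N f <= K.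
Proof.
move=> fB; have [g1 [g2 [n1 n2 _ _ fg]]] := BVI_split fB.
have mf : measurable_fun (@II R) f by case: fB.
pose V x := g1 x + g2 x.
exists (`|2 * (V 1 - V (-1))| + `|J (fun t => `|f t|) (-1) 1|) => N; split.
  apply: le_trans (wvar_le mf n1 n2 fg N) _.
  by rewrite (le_trans (ler_norm _))// lerDl.
apply: le_trans (wl1_le N (BVI_integ fB)) _.
by rewrite (le_trans (ler_norm _))// lerDr.
Qed.

Lemma J_norm_le_wl1 f K : BVI f -> (forall N, wl1 N f <= K) ->
  J (fun t => `|f t|) (-1) 1 <= K.
Proof.
move=> fB fK; have [g1 [g2 [n1 n2 _ _ fg]]] := BVI_split fB.
have mf : measurable_fun (@II R) f by case: fB.
apply/ler_addgt0Pr => e e0; pose C := (g1 1 + g2 1) - (g1 (-1) + g2 (-1)).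
have C0 : 0 <= C.
  have l1 : -1 <= 1 :> R by lra.
  by have := n1 _ _ l1; have := n2 _ _ l1; rewrite /C; lra.
have [N _ /(_ N (leqnn N)) /= HN] := wd_small C0 e0.
by apply: le_trans (J_norm_le mf n1 n2 fg N) _; rewrite lerD.
Qed.

Lemma L1normE f : integ (-1) 1 f -> L1norm f = (J (fun t => `|f t|) (-1) 1)%:E.
Proof.
move=> fi; rewrite /L1norm /J /Rintegral fineK//.
by apply: integrable_fin_num (integ_norm fi); exact: measurable_itv.
Qed.

Definition rlim g x : R := inf [set g y | y in [set y | x < y]].

Lemma rlim_has_inf g x : ndec g -> has_inf [set g y | y in [set y | x < y]].
Proof.
move=> gn; split; first by exists (g (x + 1)), (x + 1) => //=; rewrite ltrDl.
by exists (g x) => _ [y /= xy <-]; apply: gn; exact: ltW.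
Qed.

Lemma rlim_le g x y : ndec g -> x < y -> rlim g x <= g y.
Proof.
by move=> gn xy; apply: ge_inf; [case: (rlim_has_inf x gn)|exists y].
Qed.

Lemma le_rlim g x : ndec g -> g x <= rlim g x.
Proof.
move=> gn; apply: lb_le_inf; first by case: (rlim_has_inf x gn).
by move=> _ [y /= xy <-]; apply: gn; exact: ltW.
Qed.

Lemma rlim_adherent g x e : ndec g -> 0 < e -> exists2 y, x < y & g y < rlim g x + e.
Proof.
move=> gn e0; have [_ [y /= xy <-] H] := inf_adherent e0 (rlim_has_inf x gn).
by exists y.
Qed.

Lemma rlim_ndec g : ndec g -> ndec (rlim g).
Proof.
move=> gn x y xy; apply: lb_le_inf; first by case: (rlim_has_inf y gn).
by move=> _ [z /= yz <-]; apply: rlim_le => //; exact: le_lt_trans yz.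
Qed.

(** The right limit is at most [g] shifted by any [d > 0], and the integral of the shift minus [g]
    reduces to two boundary terms of width [d]. So the nonnegative difference has integral 0. *)
Lemma rlim_ae g : ndec g -> eqI (rlim g) g.
Proof.
move=> gn; have rn := rlim_ndec gn.
have ir x y := ndec_integ x y rn; have ig x y := ndec_integ x y gn.
have D0 : J (fun t => rlim g t - g t) (-1) 1 <= 0.
  apply/ler_addgt0Pr => e e0; rewrite add0r.
  have g21 : 0 <= g 3 - g (-1) by rewrite subr_ge0; apply: gn; lra.
  have [N _ /(_ N (leqnn N)) /= HN] := wd_small g21 e0.
  have w0 := wd_gt0 N; have w2 : wd N <= 2.
    by rewrite /wd ler_pdivrMr// ler_peMr// ler1n.
  move: HN; set d := wd N in w0 w2 * => HN.
  have gd : ndec (fun t => g (1 * t + d)) by move=> x y xy; apply: gn; lra.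
  have := @J_affine_pos _ 1 d g (-1) 1 ltr01 (ig _ _).
  rewrite invr1 !mul1r => -[_ E].
  have le1 : J (fun t => rlim g t - g t) (-1) 1 <= J (fun t => g (1 * t + d) - g t) (-1) 1.
    apply: J_le; [exact: integB|by apply: integB => //; exact: ndec_integ|].
    by move=> t _; rewrite lerD2r; apply: rlim_le => //; rewrite mul1r ltrDl.
  rewrite (le_trans le1)// JB//; last exact: ndec_integ.
  rewrite E.
  have E1 : J g (-1) (1 + d) = J g (-1) 1 + J g 1 (1 + d).
    by apply: J_chasles => //; lra.
  have E2 : J g (-1) (1 + d) = J g (-1) (-1 + d) + J g (-1 + d) (1 + d).
    by apply: J_chasles => //; lra.
  have u1 : J g 1 (1 + d) <= g (1 + d) * d.
    have -> : g (1 + d) * d = J (fun=> g (1 + d)) 1 (1 + d) by rewrite J_cst; [ring|lra].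
    apply: J_le => //; first exact: bmeas_integ (bmeas_cst _).
    by move=> t /andP[_ ?]; exact: gn.
  have u2 : g (-1) * d <= J g (-1) (-1 + d).
    have -> : g (-1) * d = J (fun=> g (-1)) (-1) (-1 + d) by rewrite J_cst; [ring|lra].
    apply: J_le => //; first exact: bmeas_integ (bmeas_cst _).
    by move=> t /andP[? _]; exact: gn.
  have u3 : g (1 + d) * d <= g 3 * d by apply: ler_wpM2r; [exact: ltW|apply: gn; lra].
  lra.
have i0 : integ (-1) 1 (fun t => rlim g t - g t) by exact: integB.
have D00 : (\int[mu]_(x in II) `|((rlim g x - g x)%:E)| = 0)%E.
  have -> : (\int[mu]_(x in II) `|(rlim g x - g x)%:E| =
      \int[mu]_(x in II) (rlim g x - g x)%:E)%E.
    by apply: eq_integral => x _; rewrite gee0_abs// lee_fin subr_ge0 le_rlim.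
  have fi : (\int[mu]_(x in II) (rlim g x - g x)%:E)%E \is a fin_num.
    by apply: integrable_fin_num i0; exact: measurable_itv.
  rewrite -(fineK fi); congr EFin; apply/le_anti; rewrite D0/=.
  by apply: Rintegral_ge0 => x _; rewrite subr_ge0 le_rlim.
have mI : measurable (@II R) by exact: measurable_itv.
have /integrableP[mm _] := i0.
have /(_ D00) := (ae_eq_integral_abs mu mI mm).1.
by apply: aeS => t H /H /= [] /eqP; rewrite subr_eq0 => /eqP.
Qed.

End grid.

Section lower_semicontinuity.
Context {R : realType}.
Local Notation mu := (@lebesgue_measure R).
Implicit Types (f g : R -> R) (x y K e : R) (N i : nat).

(* The first cell of the grid strictly to the right of [x], or the last cell. *)
Definition idx N x : nat := minn (Num.truncn ((x + 1) / wd N)).+1 N.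

Lemma idx_le N x : (idx N x <= N)%N. Proof. exact: geq_minr. Qed.

Lemma le_idx N x y : x <= y -> (idx N x <= idx N y)%N.
Proof.
move=> xy; rewrite leq_min idx_le andbT (leq_trans (geq_minl _ _))// ltnS.
apply: le_truncn; rewrite ler_wpM2r ?lerD2r// invr_ge0; exact/ltW/wd_gt0.
Qed.

Lemma pt_idx N x : -1 <= x <= 1 ->
  (x < pt N (idx N x) \/ pt N (idx N x) = 1 - wd N :> R) /\
  pt N (idx N x).+1 <= x + 2 * wd N.
Proof.
move=> x1; have w0 := @wd_gt0 R N.
have x0 : 0 <= (x + 1) / wd N by apply: divr_ge0; [lra|exact: ltW].
have /andP[t1 t2] := truncn_itv x0.
rewrite ler_pdivlMr// in t1; rewrite ltr_pdivrMr// in t2.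
set m := Num.truncn _ in t1 t2.
split.
  have [mN|Nm] := leqP m.+1 N.
    by left; rewrite /idx -/m (minn_idPl mN) /pt; lra.
  right; rewrite /idx -/m (minn_idPr (ltnW Nm)).
  by apply: (addIr (wd N)); rewrite -ptS ptN subrK.
rewrite (@le_trans _ _ (pt N m.+2))//.
  by apply: le_pt; rewrite ltnS geq_minl.
by rewrite /pt -!natr1; lra.
Qed.

(** The cell of index [idx N x] shrinks to [x] from strictly above, which gives the right limit; at
    [x = 1] it is the last cell, and [left_cont1] takes over. *)
Lemma mean_cvg g x : ndec g -> left_cont1 g -> -1 <= x <= 1 ->
  mean N g (idx N x) @[N --> \oo] --> rlim g x.
Proof.
move=> gn [gc1 gc2] x1; apply/cvgrPdist_le => e e0.
have [y xy gy] := rlim_adherent x gn e0.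
have yx0 : 0 < (y - x) by rewrite subr_gt0.
have up : \forall N \near \oo, wd N * 2 <= y - x by apply: wd_small.
have low : \forall N \near \oo, rlim g x - e <= mean N g (idx N x).
  have [x_lt1|x_ge1] := ltP x 1.
    have x10 : 0 < 2^-1 * (1 - x) by lra.
    near=> N.
    have H : wd N * 1 <= 2^-1 * (1 - x) by near: N; exact: wd_small.
    have [[xp|pE] _] := pt_idx N x1.
      have := rlim_le gn xp; have /andP[+ _] := mean_ndec N (idx N x) gn; lra.
    have xp : x < pt N (idx N x) by rewrite pE; lra.
    have := rlim_le gn xp; have /andP[+ _] := mean_ndec N (idx N x) gn; lra.
  have xE : x = 1 by apply/le_anti; rewrite x_ge1 andbT; case/andP: x1.
  have [z z1 gz] := gc2 _ e0.
  have z10 : 0 < 1 - z by lra.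
  have g21 : g 2 = g 1 by apply: gc1; rewrite ler1n.
  have r1 : rlim g x <= g 1 by rewrite -g21; apply: rlim_le => //; rewrite xE ltr1n.
  near=> N.
  have H : wd N * 1 <= 1 - z by near: N; exact: wd_small.
  have zp : z <= pt N (idx N x).
    by have [[xp|pE] _] := pt_idx N x1; lra.
  have := gn _ _ zp; have /andP[+ _] := mean_ndec N (idx N x) gn; lra.
near=> N.
rewrite distrC ler_norml; apply/andP; split.
  by rewrite lerBrDr addrC; near: N.
have H : wd N * 2 <= y - x by near: N.
have [_ pu] := pt_idx N x1.
have py : pt N (idx N x).+1 <= y by lra.
have := gn _ _ py; have /andP[_] := mean_ndec N (idx N x) gn; lra.
Unshelve. all: by end_near. Qed.

Definition step_fun N f x : R := mean N f (idx N x).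

(** The step function depends on [x] through the monotone [idx N]; it is dominated by the partial
    sums of [wvar] evaluated along [idx N], whose variation telescopes. *)
Lemma variation_step_fun N f s : itv_partition (-1) 1 s ->
  variation (-1) 1 (step_fun N f) s <= wvar N f.
Proof.
move=> sp; pose W (i : nat) := \sum_(0 <= j < i) `|mean N f j.+1 - mean N f j|.
have Wle i j : (i <= j)%N -> `|mean N f j - mean N f i| <= W j - W i.
  elim: j => [|j IH].
    by rewrite leqn0 => /eqP ->; rewrite !subrr normr0.
  rewrite leq_eqVlt => /predU1P[->|]; first by rewrite !subrr normr0.
  rewrite ltnS => /IH {}IH.
  have -> : W j.+1 = W j + `|mean N f j.+1 - mean N f j| by rewrite /W big_nat_recr.
  rewrite -(subrKA (mean N f j)).
  by rewrite (le_trans (ler_normD _ _))//; lra.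
have Wnd : {in `[-1, 1] &, nondecreasing_fun (fun x => W (idx N x))}.
  move=> x y _ _ xy; rewrite -subr_ge0 (le_trans _ (Wle _ _ (le_idx N xy)))//.
apply: (@le_trans _ _ (variation (-1) 1 (fun x => W (idx N x)) s)).
  rewrite /variation !big_nat; apply: ler_sum => i /= isz.
  apply: le_trans (ler_norm _); apply: Wle; apply: le_idx.
  exact: (@nondecreasing_fun_itv_partition _ _ (-1) 1 id s).
rewrite (nondecreasing_variation Wnd sp).
have W0 i : 0 <= W i by apply: sumr_ge0 => *; exact: normr_ge0.
have WN : W (idx N 1) <= W N.
  by rewrite -subr_ge0 (le_trans _ (Wle _ _ (idx_le N 1))).
have := W0 (idx N (-1)); rewrite /wvar -/(W N); lra.
Qed.

Lemma cvg_sum_nat (u : nat -> nat -> R) (l : nat -> R) (n : nat) :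
  (forall i, (i < n)%N -> u i N @[N --> \oo] --> l i) ->
  \sum_(0 <= i < n) u i N @[N --> \oo] --> \sum_(0 <= i < n) l i.
Proof.
elim: n => [_|n IH H].
  rewrite big_geq//; under eq_fun do rewrite big_geq//; exact: cvg_cst.
rewrite big_nat_recr//=; under eq_fun do rewrite big_nat_recr//=.
by apply: cvgD; [apply: IH => i ilt; apply: H; exact: ltnW|exact: H].
Qed.

(** Along a fixed partition the variation is continuous under pointwise convergence. The step
    functions converge at every point of [[-1, 1]] to the representative made of right limits, so
    this one representative attains the bound. *)
Lemma var_le_wvar f K : BVI f -> (forall N, wvar N f <= K) -> (var f <= K%:E)%E.
Proof.
move=> fB fK; have [g1 [g2 [n1 n2 l1 l2 fg]]] := BVI_split fB.
have mf : measurable_fun (@II R) f by case: fB.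
pose F x := rlim g1 x - rlim g2 x.
have fF : eqI f F.
  apply: (aeS2 _ fg); last first.
    by apply: (aeS2 _ (rlim_ae n1) (rlim_ae n2)) => x H1 H2; exact: (conj H1 H2).
  by move=> x H [H1 H2] xI; rewrite H//= /F H1// H2.
apply: (@le_trans _ _ (total_variation (-1) 1 F)).
  by apply: ereal_inf_lbound; exists F.
apply: ge_ereal_sup => _ [_ [s sp <-] <-]; rewrite lee_fin.
have scvg x : -1 <= x <= 1 -> step_fun N f x @[N --> \oo] --> F x.
  move=> x1; rewrite /step_fun.
  have E N : mean N f (idx N x) = mean N g1 (idx N x) - mean N g2 (idx N x).
    by rewrite (mean_split mf n1 n2 fg)// idx_le.
  under eq_fun do rewrite E.
  by apply: cvgB; exact: mean_cvg.
have vcvg : variation (-1) 1 (step_fun N f) s @[N --> \oo] --> variation (-1) 1 F s.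
  apply: cvg_sum_nat => i isz.
  have pI j : (j < (size s).+1)%N -> -1 <= nth 1 (-1 :: s) j <= 1.
    by move=> js; rewrite (itv_partition_nth_ge js sp) (itv_partition_nth_le js sp).
  apply: cvg_norm; apply: cvgB; apply: scvg; apply: pI; first by [].
  exact: ltnW.
rewrite -(cvg_lim _ vcvg)//; apply: limr_le; first by apply/cvg_ex; eexists; exact: vcvg.
by apply: nearW => N; apply: le_trans (fK N); exact: variation_step_fun.
Qed.

Lemma BVnorm_le f K : BVI f -> (forall N, wvar N f <= K) ->
  (forall N, wl1 N f <= K) -> (BVnorm f <= (K + K)%:E)%E.
Proof.
move=> fB v l; rewrite /BVnorm EFinD; apply: leeD; first exact: var_le_wvar.
by rewrite L1normE ?lee_fin; [exact: J_norm_le_wl1|exact: BVI_integ].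
Qed.

Lemma var_ge0 f : (0 <= var f)%E.
Proof.
apply: le_ereal_inf_tmp => _ [g _ <-]; apply: total_variation_ge0; lra.
Qed.

Lemma L1norm_le_BVnorm f : (L1norm f <= BVnorm f)%E.
Proof. by rewrite /BVnorm leeDr// var_ge0. Qed.

End lower_semicontinuity.

(** * Duality of transfer and Koopman operators *)

Section transfer_operator.
Context {R : realType}.
Local Notation mu := (@lebesgue_measure R).
Implicit Types (f g h k : R -> R) (a b c d x y u v M : R).

Lemma J_patch k h u v : -1 <= u -> v <= 1 ->
  J (fun t => (k \_ (intv u v)) t * h t) (-1) 1 = J (fun t => k t * h t) u v.
Proof.
move=> u1 v1; rewrite /J.
have -> : intv u v = intv (-1) 1 `&` intv u v.
  apply/seteqP; split => t; rewrite /intv/= !in_itv/=; last by case.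
  by move=> /andP[ut tv]; split; apply/andP; split => //; lra.
rewrite Rintegral_mkcondr; apply: eq_Rintegral => t _.
rewrite /patch; have -> : (t \in intv (-1) 1 `&` intv u v) = (t \in intv u v).
  apply/idP/idP; rewrite !inE /intv/= !in_itv/=; first by case.
  by move=> /andP[ut tv]; split; apply/andP; split => //; lra.
by case: ifPn => //; rewrite mul0r.
Qed.

Lemma integ_patch k u v : -1 <= u -> v <= 1 -> integ u v k ->
  integ (-1) 1 (k \_ (intv u v)).
Proof.
move=> u1 v1 ki; rewrite /integ -restrict_EFin.
apply/integrable_restrict; [exact: measurable_itv|exact: measurable_itv|].
rewrite (_ : intv (-1) 1 `&` intv u v = intv u v)//.
apply/seteqP; split => t; rewrite /intv/= !in_itv/=; first by case.
by move=> /andP[ut tv]; split; apply/andP; split => //; lra.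
Qed.

(** The witness is the Perron-Frobenius contribution of one branch: [f] at the preimage, divided by
    the slope and cut off to the image interval. *)
Lemma branch_pos f c d x y : 0 < c -> -1 <= x -> y <= 1 ->
  -1 <= c * x + d -> c * y + d <= 1 -> integ (-1) 1 f ->
  exists g, integ (-1) 1 g /\ forall M h, bmeas M h ->
    J (fun t => g t * h t) (-1) 1 = J (fun t => f t * h (c * t + d)) x y.
Proof.
move=> c0 x1 y1 u1 v1 fi; have c0' : c != 0 by rewrite gt_eqF.
set u := c * x + d in u1 *; set v := c * y + d in v1 *.
pose k t := f (c^-1 * t - c^-1 * d).
have E t : c^-1 * (c * t + d) - c^-1 * d = t by field.
have ki : integ u v k.
  apply: (proj1 (@J_affine_pos _ c^-1 (- (c^-1 * d)) f u v _ _)).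
    by rewrite invr_gt0.
  by rewrite !E; exact: integ_sub fi.
exists (fun t => c^-1 * (k \_ (intv u v)) t); split.
  by apply: integZ; exact: integ_patch.
move=> M h hM.
rewrite (@J_eq _ _ _ _ (fun t => c^-1 * ((k \_ (intv u v)) t * h t))); last first.
  by move=> t _; rewrite mulrA.
rewrite JZ; last by apply: (integM hM); exact: integ_patch.
rewrite J_patch// -(proj2 (@J_affine_pos _ c d (fun t => k t * h t) x y c0 _)).
  by apply: J_eq => t _; rewrite /k E.
exact: (integM hM).
Qed.

Lemma branch_neg f c d x y : c < 0 -> -1 <= x -> y <= 1 ->
  -1 <= c * y + d -> c * x + d <= 1 -> integ (-1) 1 f ->
  exists g, integ (-1) 1 g /\ forall M h, bmeas M h ->
    J (fun t => g t * h t) (-1) 1 = J (fun t => f t * h (c * t + d)) x y.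
Proof.
move=> c0 x1 y1 u1 v1 fi; have c0' : c != 0 by rewrite lt_eqF.
set u := c * y + d in u1 *; set v := c * x + d in v1 *.
pose k t := f (c^-1 * t - c^-1 * d).
have E t : c^-1 * (c * t + d) - c^-1 * d = t by field.
have ki : integ u v k.
  apply: (proj1 (@J_affine_neg _ c^-1 (- (c^-1 * d)) f u v _ _)).
    by rewrite invr_lt0.
  by rewrite !E; exact: integ_sub fi.
exists (fun t => (- c)^-1 * (k \_ (intv u v)) t); split.
  by apply: integZ; exact: integ_patch.
move=> M h hM.
rewrite (@J_eq _ _ _ _ (fun t => (- c)^-1 * ((k \_ (intv u v)) t * h t))); last first.
  by move=> t _; rewrite mulrA.
rewrite JZ; last by apply: (integM hM); exact: integ_patch.
rewrite J_patch// -(proj2 (@J_affine_neg _ c d (fun t => k t * h t) x y c0 _)).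
  by apply: J_eq => t _; rewrite /k E.
exact: (integM hM).
Qed.

Lemma tent_mr a b x : 0 < x <= 2^-1 -> tent a b x = - 2 * (1 + a) * x + 1.
Proof.
move=> x0; rewrite -[x]opprK tentN opprK.
have := x0; rewrite le_eqVlt => /andP[xp /orP[/eqP ->|xl]].
  rewrite tent_l; [by field|lra].
rewrite tent_ml; [by ring|lra].
Qed.

Lemma tent_r a b x : 2^-1 <= x <= 1 ->
  tent a b x = 2 * (1 + a) * x + (1 - 2 * (1 + a)).
Proof. by move=> x0; rewrite -[x]opprK tentN opprK tent_l; [ring|lra]. Qed.

(** [transfer] takes a dummy value when no density exists, so a density is first constructed as a
    sum over the four branches. *)
Lemma transfer_exists a b f : 0 <= a <= 1 -> 0 <= b <= 1 -> integ (-1) 1 f ->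
  exists g, integ (-1) 1 g /\ forall M h, bmeas M h ->
    J (fun t => g t * h t) (-1) 1 = J (fun t => f t * h (tent a b t)) (-1) 1.
Proof.
move=> a01 b01 fi.
have [g1 [i1 e1]] : exists g, integ (-1) 1 g /\ forall M h, bmeas M h ->
    J (fun t => g t * h t) (-1) 1 =
    J (fun t => f t * h (2 * (1 + b) * t + (2 * (1 + b) - 1))) (-1) (- 2^-1).
  by apply: branch_pos fi; lra.
have [g2 [i2 e2]] : exists g, integ (-1) 1 g /\ forall M h, bmeas M h ->
    J (fun t => g t * h t) (-1) 1 =
    J (fun t => f t * h (- 2 * (1 + b) * t + (- 1))) (- 2^-1) 0.
  by apply: branch_neg fi; lra.
have [g3 [i3 e3]] : exists g, integ (-1) 1 g /\ forall M h, bmeas M h ->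
    J (fun t => g t * h t) (-1) 1 =
    J (fun t => f t * h (- 2 * (1 + a) * t + 1)) 0 (2^-1).
  by apply: branch_neg fi; lra.
have [g4 [i4 e4]] : exists g, integ (-1) 1 g /\ forall M h, bmeas M h ->
    J (fun t => g t * h t) (-1) 1 =
    J (fun t => f t * h (2 * (1 + a) * t + (1 - 2 * (1 + a)))) (2^-1) 1.
  by apply: branch_pos fi; lra.
exists (fun t => (g1 t + g2 t) + (g3 t + g4 t)); split.
  by apply: integD; exact: integD.
move=> M h hM.
have j1 := integM hM i1; have j2 := integM hM i2.
have j3 := integM hM i3; have j4 := integM hM i4.
rewrite (@J_eq _ _ _ _ (fun t => (g1 t * h t + g2 t * h t) + (g3 t * h t + g4 t * h t))); last first.
  by move=> t _; ring.
rewrite JD; [|exact: integD|exact: integD].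
rewrite (JD j1 j2) (JD j3 j4) (e1 _ _ hM) (e2 _ _ hM) (e3 _ _ hM) (e4 _ _ hM).
have hT := bmeas_tent a b hM.
have iT x y : -1 <= x -> y <= 1 -> integ x y (fun t => f t * h (tent a b t)).
  by move=> x1 y1; apply: (integM hT); exact: integ_sub fi.
have ia c d x y : -1 <= x -> y <= 1 -> integ x y (fun t => f t * h (c * t + d)).
  move=> x1 y1; apply: (@integM _ M (fun t => h (c * t + d))); last exact: integ_sub fi.
  split; last by move=> t; case: hM.
  apply: (measurableT_comp (proj1 hM)).
  by apply: measurable_funD => //; apply: measurable_funM.
rewrite [RHS](@J_chasles _ _ 0)//; [|exact: iT].
rewrite [X in _ = X + _](@J_chasles _ _ (- 2^-1)); [|lra|lra|by apply: iT; lra].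
rewrite [X in _ = _ + X](@J_chasles _ _ (2^-1)); [|lra|lra|by apply: iT; lra].
congr ((_ + _) + (_ + _)).
- by apply: J_eq => t t0; rewrite tent_l//; lra.
- apply: J_eqoo; [by apply: ia; lra|by apply: iT; lra|].
  by move=> t t0; rewrite tent_ml//; lra.
- apply: J_eqoo; [by apply: ia; lra|by apply: iT; lra|].
  by move=> t t0; rewrite tent_mr//; lra.
- by apply: J_eq => t t0; rewrite tent_r//; lra.
Qed.

Lemma bmeas_indic (D : set R) : measurable D -> bmeas 1 (\1_D : R -> R).
Proof.
move=> mD; split; first exact: measurable_indic.
by move=> x; rewrite indicE; case: (_ \in _); rewrite /= ?normr1 ?normr0.
Qed.

Lemma integral_subset f (D : set R) : measurable D -> integ (-1) 1 f ->
  (\int[mu]_(x in II `&` D) (f x)%:E = (J (fun t => f t * \1_D t) (-1) 1)%:E)%E.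
Proof.
move=> mD fi.
have bD := bmeas_indic mD.
rewrite integral_mkcondr /J /Rintegral fineK; last first.
  by apply: integrable_fin_num (integM bD fi); exact: measurable_itv.
apply: eq_integral => t _; rewrite /patch indicE.
by case: ifPn => _ /=; rewrite ?mulr1 ?mulr0.
Qed.

Lemma is_transfer_unique (T : R -> R) f g g' :
  is_transfer T f g -> is_transfer T f g' -> eqI g g'.
Proof.
move=> [gi gE] [gi' gE'].
have H : ae_eq mu II (EFin \o g) (EFin \o g').
  apply: integral_ae_eq; [exact: measurable_itv|exact: gi|by case/integrableP: gi'|].
  by move=> E EI mE; rewrite /= gE// gE'.
by apply: aeS H => x H /H [].
Qed.

(** Indicators as test functions show that the explicit density satisfies [is_transfer]; uniqueness
    up to null sets then carries the duality over to the chosen one. *)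
Lemma transfer_dual a b f : 0 <= a <= 1 -> 0 <= b <= 1 -> integ (-1) 1 f ->
  integ (-1) 1 (transfer (tent a b) f) /\ forall M h, bmeas M h ->
    J (fun t => transfer (tent a b) f t * h t) (-1) 1 =
    J (fun t => f t * h (tent a b t)) (-1) 1.
Proof.
move=> a01 b01 fi; have [g [gi gE]] := transfer_exists a01 b01 fi.
have mI : measurable (@II R) by exact: measurable_itv.
have gT : is_transfer (tent a b) f g.
  split=> // D mD DI.
  have mTD : measurable (tent a b @^-1` D).
    by rewrite -[X in measurable X]setTI; exact: measurable_tent.
  rewrite (integral_subset mTD fi).
  have {1}-> : D = II `&` D by apply/seteqP; split => [x Dx|x []//]; split => //; exact: DI.
  rewrite (integral_subset mD gi) (gE _ _ (bmeas_indic mD)).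
  by congr EFin; apply: J_eq => t _; rewrite !indicE.
have tT : is_transfer (tent a b) f (transfer (tent a b) f).
  rewrite /transfer; case: pselect => [H|[]]; last by exists g.
  by case: cid.
have ti : integ (-1) 1 (transfer (tent a b) f) by case: tT.
have tg := is_transfer_unique tT gT.
split => // M h hM; rewrite -(gE _ _ hM).
have mh : measurable_fun (@II R) h by apply: measurable_funTS; case: hM.
have mt k : integ (-1) 1 k -> measurable_fun (@II R) k.
  by move=> /integrableP[/measurable_EFinP].
apply: eqI_J => //.
- by apply: measurable_funM => //; exact: mt.
- by apply: measurable_funM => //; exact: mt.
- by apply: aeS tg => t H tI; rewrite H.
Qed.

End transfer_operator.

(** * Growth rates *)

Section exponential_rates.
Context {R : realType}.
Implicit Types (u : nat -> \bar R) (r l : R).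

Lemma limn_esup_lt u r : (limn_esup u < r%:E)%E -> \forall n \near \oo, (u n < r%:E)%E.
Proof.
rewrite /limn_esup/limf_esup => /ereal_inf_lt[_ [A [N _ NA] <-] H].
exists N => // n /= Nn; apply: le_lt_trans H.
by apply: ereal_sup_ubound; exists n => //; exact: NA.
Qed.

Lemma cvg_near_gt u l r : u @ \oo --> l%:E -> r < l -> \forall n \near \oo, (r%:E < u n)%E.
Proof. by move=> ul rl; exact: ul _ (@nbhs_open_ereal_gt _ l (fun=> r) rl). Qed.

Lemma rate_le (x : \bar R) n r : (0 < n)%N -> ((n%:R^-1)%:E * lne x < r%:E)%E ->
  (x <= (expR (n%:R * r))%:E)%E.
Proof.
move=> n0; have n0' : 0 < (n%:R : R) by rewrite ltr0n.
case: x => [x| |]//.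
- have [x0 _|x0] := leP x 0; first by rewrite lee_fin (le_trans x0)// expR_ge0.
  rewrite lne_EFin// -EFinM lte_fin mulrC ltr_pdivrMr// => H.
  by rewrite lee_fin -[x]lnK ?posrE// ler_expR mulrC ltW.
- by rewrite /= mulry gtr0_sg ?invr_gt0// mul1e.
- by rewrite leNye.
Qed.

Lemma rate_ge (x : \bar R) n r : (0 < n)%N -> (r%:E < (n%:R^-1)%:E * lne x)%E ->
  ((expR (n%:R * r))%:E <= x)%E.
Proof.
move=> n0; have n0' : 0 < (n%:R : R) by rewrite ltr0n.
case: x => [x| |]//.
- have [x0|x0] := leP x 0.
    by rewrite le0_lneNy ?lee_fin// mulrNy gtr0_sg ?invr_gt0// mul1e.
  rewrite lne_EFin// -EFinM lte_fin mulrC ltr_pdivlMr// => H.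
  by rewrite lee_fin -[x in leRHS]lnK ?posrE// ler_expR mulrC ltW.
- by rewrite leey.
- by rewrite le0_lneNy ?leNye// mulrNy gtr0_sg ?invr_gt0// mul1e.
Qed.

Lemma expR_decay (c : R) e : c < 0 -> 0 < e -> \forall n \near \oo, expR (n%:R * c) <= e.
Proof.
move=> c0 e0; have H0 : 0 < (- c) * e by rewrite mulr_gt0// oppr_gt0.
near=> n.
have n0 : 0 < (n%:R : R) by rewrite ltr0n; near: n; exists 1%N.
have nc : 0 < n%:R * (- c) by rewrite mulr_gt0// oppr_gt0.
have : n%:R * (- c) <= expR (n%:R * (- c)).
  by rewrite (le_trans _ (expR_ge1Dx _))// lerDr.
have -> : n%:R * c = - (n%:R * (- c)) by ring.
rewrite expRN => H; rewrite -(invrK e) lef_pV2 ?posrE ?expR_gt0 ?invr_gt0//.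
apply: le_trans H; rewrite -ler_pdivrMr ?oppr_gt0//.
near: n; exact: nbhs_infty_ger.
Unshelve. all: by end_near. Qed.

End exponential_rates.

Section rates.
Context {R : realType}.
Variable th : nat -> R * R.
Implicit Types (f g h x : R -> R) (lam : R).

(** Exponential decay in the weak sense, read on the Koopman side. The strict gap [rho < lam] leaves
    room for a rate in between, which later separates remainders from vectors of exact rate
    [lam]. *)
Definition decays lam f : Prop := exists rho C, [/\ rho < lam, 0 <= C &
  \forall n \near \oo, forall h, bmeas 1 h ->
    `|J (fun t => f t * h (orb th n t)) (-1) 1| <= C * expR (n%:R * rho)].

Lemma decays_eqI lam f g : measurable_fun (@II R) f -> measurable_fun (@II R) g ->
  eqI f g -> decays lam f -> decays lam g.
Proof.
move=> mf mg fg [rho [C [r0 C0 H]]]; exists rho, C; split => //.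
apply: filterS H => n H h h1.
have mh : measurable_fun (@II R) (fun t => h (orb th n t)).
  by apply: measurable_funTS; case: (bmeas_orb th n h1).
rewrite (@eqI_J _ _ (fun t => f t * h (orb th n t)))//; first exact: H.
- exact: measurable_funM.
- exact: measurable_funM.
- by apply: aeS fg => t E tI; rewrite E.
Qed.

Lemma decays0 lam : decays lam (cst 0).
Proof.
exists (lam - 1), 0; split => //; first by rewrite ltrBlDr ltrDl.
apply: nearW => n h h1; rewrite (@J_eq _ _ _ _ (fun=> 0)).
  by rewrite J_cst ?mul0r ?normr0//; lra.
by move=> t _; rewrite mul0r.
Qed.

Lemma decaysD lam f g : integ (-1) 1 f -> integ (-1) 1 g ->
  decays lam f -> decays lam g -> decays lam (fun t => f t + g t).
Proof.
move=> fi gi [r1 [C1 [l1 C10 H1]]] [r2 [C2 [l2 C20 H2]]].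
exists (Num.max r1 r2), (C1 + C2); split; [by rewrite gt_max l1|exact: addr_ge0|].
near=> n.
have E1 : forall h, bmeas 1 h ->
    `|J (fun t => f t * h (orb th n t)) (-1) 1| <= C1 * expR (n%:R * r1).
  by near: n.
have E2 : forall h, bmeas 1 h ->
    `|J (fun t => g t * h (orb th n t)) (-1) 1| <= C2 * expR (n%:R * r2).
  by near: n.
move=> h h1; have hn := bmeas_orb th n h1.
rewrite (@J_eq _ _ _ _ (fun t => f t * h (orb th n t) + g t * h (orb th n t))); last first.
  by move=> t _; rewrite mulrDl.
rewrite (JD (integM hn fi) (integM hn gi)) (le_trans (ler_normD _ _))// mulrDl lerD//.
  apply: (@le_trans _ _ (C1 * expR (n%:R * r1))); first exact: E1.
  by rewrite ler_wpM2l// ler_expR ler_wpM2l// le_max lexx.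
apply: (@le_trans _ _ (C2 * expR (n%:R * r2))); first exact: E2.
by rewrite ler_wpM2l// ler_expR ler_wpM2l// le_max lexx orbT.
Unshelve. all: by end_near. Qed.

Lemma decays_sum lam (m : nat) (v : nat -> R -> R) :
  (forall i, (i < m)%N -> integ (-1) 1 (v i) /\ decays lam (v i)) ->
  integ (-1) 1 (fun t => \sum_(i < m) v i t) /\ decays lam (fun t => \sum_(i < m) v i t).
Proof.
elim: m => [_|m IH H].
  have -> : (fun t => \sum_(i < 0) v i t) = cst 0 by apply/funext => t; rewrite big_ord0.
  by split; [exact: bmeas_integ (bmeas_cst 0)|exact: decays0].
have [i1 d1] := IH (fun i im => H i (ltnW im)); have [i2 d2] := H m (ltnSn m).
have -> : (fun t => \sum_(i < m.+1) v i t) = (fun t => \sum_(i < m) v i t + v m t).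
  by apply/funext => t; rewrite big_ord_recr.
by split; [exact: integD|exact: decaysD].
Qed.

(** The constant test function 1 is fixed by composition, so the integral of [f] is bounded by a
    quantity tending to 0. *)
Lemma decays_mass0 lam f : integ (-1) 1 f -> lam <= 0 -> decays lam f -> J f (-1) 1 = 0.
Proof.
move=> fi l0 [rho [C [r0 C0 H]]].
have b1 : bmeas 1 (fun=> 1 : R) by rewrite -[X in bmeas X](@normr1 R); exact: bmeas_cst.
apply/eqP; rewrite -normr_eq0 eq_le normr_ge0 andbT.
apply/ler_addgt0Pr => e e0; rewrite add0r.
have eC : 0 < e / (C + 1) by rewrite divr_gt0//; lra.
have D := expR_decay (lt_le_trans r0 l0) eC.
have [N _ /(_ N (leqnn N))[/= H1 H2]] := filterI H D.
have := H1 _ b1; rewrite (@J_eq _ _ _ _ f); last by move=> t _; rewrite mulr1.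
move=> {}H1; apply: (le_trans H1).
rewrite ler_pdivlMr in H2; last by lra.
apply: le_trans H2; rewrite mulrC ler_wpM2l ?expR_ge0//; lra.
Qed.

End rates.

Section cocycle_pairing.
Context {R : realType} {d : measure_display} {Omega : measurableType d}.
Variables (sigma : Omega -> Omega) (a b : Omega -> R) (eps : R).
Variable L : Omega -> (R -> R) -> (R -> R).
Hypothesis eps01 : 0 <= eps <= 1.
Hypothesis a01 : forall w, 0 <= a w <= 1.
Hypothesis b01 : forall w, 0 <= b w <= 1.
Hypothesis L_def : forall w, L w = transfer (tent (eps * a w) (eps * b w)).
Implicit Types (f h : R -> R) (w : Omega).

Definition params w : nat -> R * R :=
  fun n => (eps * a (iter n sigma w), eps * b (iter n sigma w)).

Lemma params_small w : small_params (params w) eps.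
Proof.
move=> n /=; have := a01 (iter n sigma w); have := b01 (iter n sigma w).
move=> /andP[b0 b1] /andP[a0 a1]; move: eps01 => /andP[e0 _].
by rewrite !mulr_ge0//= !ler_piMr.
Qed.

Lemma cocycle_dual w f n : integ (-1) 1 f ->
  integ (-1) 1 (cocycle sigma L n w f) /\ forall M h, bmeas M h ->
    J (fun t => cocycle sigma L n w f t * h t) (-1) 1 =
    J (fun t => f t * h (orb (params w) n t)) (-1) 1.
Proof.
move=> fi; elim: n => [|n [ci IH]]; first by split.
have /(_ n)[ /= p1 p2] := params_small w.
rewrite /= L_def.
have p1' : 0 <= eps * a (iter n sigma w) <= 1 by move: p1 eps01; lra.
have p2' : 0 <= eps * b (iter n sigma w) <= 1 by move: p2 eps01; lra.
have [ti tE] := transfer_dual p1' p2' ci.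
split => // M h hM; rewrite (tE _ _ hM).
exact: (IH _ (h \o tent _ _) (bmeas_tent _ _ hM)).
Qed.

Lemma pairing_le_BVnorm f h : integ (-1) 1 f -> bmeas 1 h ->
  ((`|J (fun t => f t * h t) (-1) 1|)%:E <= BVnorm f)%E.
Proof.
move=> fi h1; apply: le_trans (L1norm_le_BVnorm f).
rewrite (L1normE fi) lee_fin (le_trans (J_norm (integM h1 fi)))//.
apply: J_le; [exact: integ_norm (integM h1 fi)|exact: integ_norm|].
move=> t _; rewrite normrM ler_piMr//; by case: h1.
Qed.

(** Pairings with functions bounded by 1 are at most the L1 norm, hence the BV norm. The bound [c]
    may be [-oo], as the compactness index can be. *)
Lemma growth_decays w f (c : \bar R) lam : integ (-1) 1 f ->
  (limn_esup (growth sigma L w f) <= c)%E -> (c < lam%:E)%E ->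
  decays (params w) lam f.
Proof.
move=> fi fc cl.
have [rho [r1 r2]] : exists rho, rho < lam /\ (c < rho%:E)%E.
  case: c cl {fc} => [c| |]//.
    rewrite lte_fin => cl; exists (2^-1 * (c + lam)); rewrite lte_fin; split; lra.
  by move=> _; exists (lam - 1); rewrite ltNyr; split => //; lra.
exists rho, 1; split => //.
have := limn_esup_lt (le_lt_trans fc r2).
move=> H; near=> n.
have n0 : (0 < n)%N by near: n; exists 1%N.
have gr : (growth sigma L w f n < rho%:E)%E by near: n.
move=> h h1.
rewrite mul1r -lee_fin.
have [ci cE] := cocycle_dual w n fi.
rewrite -(cE _ _ h1); apply: le_trans (pairing_le_BVnorm ci h1) _.
exact: rate_le.
Unshelve. all: by end_near. Qed.

Lemma growth_cvg_decays w f l lam : integ (-1) 1 f ->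
  growth sigma L w f @ \oo --> l%:E -> l < lam -> decays (params w) lam f.
Proof.
move=> fi gl ll; apply: (@growth_decays w f l%:E) => //.
have gc : cvgn (growth sigma L w f) by apply/cvg_ex; eexists; exact: gl.
by rewrite is_cvg_limn_esupE// (cvg_lim _ gl).
Qed.

End cocycle_pairing.

(** * Closeness to [psi0] at one return time *)

Section closeness.
Context {R : realType}.
Variables (th : nat -> R * R) (eps t lam K c : R) (k : nat).
Variables (e u : R -> R) (E : nat -> R -> R) (gam : nat -> R) (NN : set nat).
Hypothesis eps1 : 0 <= eps <= 1000^-1.
Hypothesis sp : small_params th eps.
Hypothesis t01 : 0 < t <= 1.
Hypothesis dir : forall n h, (k <= n)%N -> bmeas 1 h ->
  `|gap (h \o orb th n) - 2^-1 * gap h * mass th n| <= t * mass th n.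
Hypothesis eB : BVI e.
Hypothesis eL : J e (-1) 0 = 2^-1.
Hypothesis e0 : J e (-1) 1 = 0.
Hypothesis ui : integ (-1) 1 u.
Hypothesis ud : decays th lam u.
Hypothesis decomp : eqI (@psi0 R) (fun x => c * e x + u x).
Hypothesis NN_inf : forall m, exists2 n, (m <= n)%N & NN n.
Hypothesis K0 : 0 < K.
Hypothesis gamE : forall n, NN n -> forall h, bmeas 1 h ->
  J (fun x => e x * h (orb th n x)) (-1) 1 = gam n * J (fun x => E n x * h x) (-1) 1.
Hypothesis E1 : forall n, NN n -> J (fun x => E n x * hstar x) (-1) 1 = 1.
Hypothesis gam_ge : forall r, r < lam ->
  \forall n \near \oo, NN n -> expR (n%:R * r) <= `|gam n| * K.

Let h1s : bmeas 1 (@hstar R) := @bmeas_hstar R.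

(** [gam n] is the pairing of [e] with [hstar \o orb n]. As [e] has integral 0, [BVI_pairing] leaves
    half the gap, which is [mass th n], plus a deviation bounded by domination. *)
Lemma gam_le : exists C, 0 < C /\ forall n, NN n -> `|gam n| <= C * mass th n.
Proof.
have [C [C0 HC]] := BVI_pairing eB.
exists (1 + 7 * C); split; first by lra.
move=> n Nn; have m0 := mass_gt0 eps1 sp n.
have -> : gam n = J (fun x => e x * hstar (orb th n x)) (-1) 1.
  by rewrite gamE// E1// mulr1.
have [d1 d2] := dev_dominate eps1 sp n h1s.
have := HC _ _ _ (bmeas_orb th n h1s) d1 d2.
have eR : J e 0 1 = - 2^-1.
  have := e0; rewrite (@J_chasles _ _ 0)//; last exact: BVI_integ.
  by rewrite eL; lra.
rewrite eL eR mulNr -mulrBr -/(gap (hstar \o orb th n)) -/(mass th n).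
rewrite !ler_norml => /andP[h1 h2]; apply/andP; split; lra.
Qed.

(** With [rho < r < lam], the ratio of [exp (n * rho)] to the lower bound [exp (n * r) / K] for
    [|gam n|] tends to 0; that lower bound is available only at times in [NN]. *)
Lemma u_small tta : 0 < tta -> exists2 n, NN n /\ (k <= n)%N &
  forall h, bmeas 1 h -> `|J (fun x => u x * h (orb th n x)) (-1) 1| <= tta * `|gam n|.
Proof.
move=> tta0; have [rho [C [rl C0 H]]] := ud.
pose r := 2^-1 * (rho + lam).
have r1 : rho < r by rewrite /r; lra.
have r2 : r < lam by rewrite /r; lra.
have D0 : 0 < C * K + 1 by have := mulr_ge0 C0 (ltW K0); lra.
have r3 : rho - r < 0 by rewrite subr_lt0.
have H2 := expR_decay r3 (divr_gt0 tta0 D0).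
have [N _ HN] := filterI (filterI H H2) (gam_ge r2).
have [n nN Nn] := NN_inf (maxn N k).
rewrite geq_max in nN; case/andP: nN => nN nk.
have [[Hu He] Hg] := HN n nN.
exists n => // h h1; apply: le_trans (Hu _ h1) _.
have {}Hg := Hg Nn.
have -> : n%:R * rho = n%:R * (rho - r) + n%:R * r by ring.
rewrite expRD.
rewrite ler_pdivlMr// in He.
set x := expR _ in He *; set y := expR _ in Hg *.
have x0 : 0 <= x by exact: expR_ge0.
have : C * x * y <= C * x * (`|gam n| * K) by rewrite ler_wpM2l// mulr_ge0.
have : x * (C * K + 1) * `|gam n| <= tta * `|gam n| by rewrite ler_wpM2r.
have : 0 <= x * `|gam n| by rewrite mulr_ge0.
lra.
Qed.

Let psi0_pair n h : bmeas 1 h -> J (fun x => psi0 x * h (orb th n x)) (-1) 1 =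
  c * J (fun x => e x * h (orb th n x)) (-1) 1 + J (fun x => u x * h (orb th n x)) (-1) 1.
Proof.
move=> h1; have hn := bmeas_orb th n h1.
have ei := BVI_integ eB.
have mh : measurable_fun (@II R) (fun x => h (orb th n x)).
  by apply: measurable_funTS; case: hn.
have mi f : integ (-1) 1 f -> measurable_fun (@II R) f.
  by move=> /integrableP[/measurable_EFinP].
have mp : measurable_fun (@II R) (@psi0 R).
  have -> : (@psi0 R) = (fun x => 2^-1 * hstar x).
    by apply/funext => x; rewrite /hstar; field.
  by apply: mi; apply: integZ; exact: bmeas_integ h1s.
rewrite (@eqI_J _ _ (fun x => (c * e x + u x) * h (orb th n x)))//.
- rewrite -(JZ _ (integM hn ei)) -(JD (integZ c (integM hn ei)) (integM hn ui)).
  by apply: J_eq => x _ /=; ring.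
- exact: measurable_funM.
- apply: measurable_funM => //; apply: mi.
  by apply: integD => //; exact: integZ.
- by apply: aeS decomp => x H xI; rewrite H.
Qed.

(** At a late time in [NN] the iterate of [psi0] is nearly both [c * gam n * E n] and a multiple of
    [psi0]. Testing with [hstar], which pairs to 1 with [E n] and with [psi0], identifies the
    scalars. *)
Lemma closeness : exists2 n, NN n & forall h, bmeas 1 h ->
  `|J (fun x => E n x * h x) (-1) 1 - J (fun x => psi0 x * h x) (-1) 1| <= 2 * t.
Proof.
have [C [C0 HC]] := gam_le; have /andP[t0 t1] := t01.
have main n (Nn : NN n) : 2^-1 * mass th n = c * gam n +
    J (fun x => u x * hstar (orb th n x)) (-1) 1.
  have -> : gam n = J (fun x => e x * hstar (orb th n x)) (-1) 1.
    by rewrite gamE// E1// mulr1.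
  by rewrite -(psi0_pair n h1s) (pair_psi0 (bmeas_orb th n h1s)).
(* If [c = 0], the remainder [u] alone would pair to [2^-1 * mass], whereas it is at most a quarter
   of the mass by [u_small] and [gam_le]. *)
have [c0|c0] := eqVneq c 0.
  have th0 : 0 < 4^-1 / C by apply: divr_gt0 => //; lra.
  have [n [Nn nk] Hu] := u_small th0.
  have := main _ Nn; rewrite c0 mul0r add0r => M1.
  have m0 := mass_gt0 eps1 sp n.
  have := Hu _ h1s; rewrite -M1 ger0_norm; last by lra.
  have : 4^-1 / C * `|gam n| <= 4^-1 / C * (C * mass th n).
    by rewrite ler_wpM2l ?(ltW th0)// HC.
  have -> : 4^-1 / C * (C * mass th n) = 4^-1 * mass th n.
    by rewrite mulrA mulfVK// gt_eqF.
  lra.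
have ac0 : 0 < `|c| by rewrite normr_gt0.
(* The remainder enters three times (tests with [h] and [hstar], and comparison of the mass with
   [c * gam n]), each at cost at most [S]; together they use up the second [t] of [2 * t]. *)
have th0 : 0 < 3^-1 * (`|c| * t) by apply: mulr_gt0; [lra|apply: mulr_gt0; lra].
have [n [Nn nk] Hu] := u_small th0.
exists n => // h h1.
have {}main := main _ Nn.
have ds := dir nk h1.
have := psi0_pair n h1; rewrite (gamE Nn h1) (pair_psi0 (bmeas_orb th n h1)) (pair_psi0 h1).
have us := Hu _ h1s; have uh := Hu _ h1.
have gb := gap_bound h1.
have m0 := mass_gt0 eps1 sp n.
move: main ds us uh; set U := J _ _ _; set Uh := J _ _ _; set X := J _ _ _.
set M := mass th n in m0 *; set G := gap (h \o _); set P := gap h in gb *.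
move=> main ds us uh Eq.
have cg : `|c * gam n| = `|c| * `|gam n| by exact: normrM.
have g0 : 0 < `|c * gam n|.
  rewrite normr_gt0; apply/eqP => cg0.
  have : `|gam n| = 0.
    by apply/eqP; move/eqP: cg0; rewrite mulf_eq0 (negbTE c0)/= => /eqP ->; rewrite normr0.
  move=> g00; move: us; rewrite g00 mulr0 => us.
  have U0 : U = 0 by apply/eqP; rewrite -normr_le0.
  by move: main; rewrite cg0 U0; lra.
have key : c * gam n * (X - 2^-1 * P) =
    2^-1 * (G - 2^-1 * P * M) + (U * (2^-1 * P) - Uh).
  rewrite mulrBr; have -> : c * gam n * X = 2^-1 * G - Uh by rewrite Eq; ring.
  have -> : c * gam n = 2^-1 * M - U by rewrite main; ring.
  by field.
rewrite -(ler_pM2l g0) -normrM key.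
set S := 3^-1 * (`|c| * t) * `|gam n| in us uh.
have SE : S = 3^-1 * t * `|c * gam n| by rewrite /S cg; ring.
have UP : `|U * (2^-1 * P)| <= S.
  rewrite normrM -[leRHS]mulr1; apply: ler_pM => //.
  rewrite normrM ger0_norm; lra.
have Mle : 2^-1 * M <= `|c * gam n| + S.
  have := ler_normD (c * gam n) U; rewrite -main ger0_norm; lra.
have tM : t * (2^-1 * M) <= t * (`|c * gam n| + S) by rewrite ler_pM2l//; lra.
have tS : t * S <= S by rewrite ler_piMl//; exact: le_trans UP.
have h1' := ler_normD (2^-1 * (G - 2^-1 * P * M)) (U * (2^-1 * P) - Uh).
have h2' := ler_normB (U * (2^-1 * P)) Uh.
have h3' : `|2^-1 * (G - 2^-1 * P * M)| <= 2^-1 * (t * M).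
  by rewrite normrM ger0_norm; [rewrite ler_wpM2l//; lra|lra].
lra.
Qed.

End closeness.

Section dual_norm.
Context {R : realType}.
Implicit Types (f : R -> R).

Lemma dual_norm f : integ (-1) 1 f -> exists h, bmeas 1 h /\
  J (fun x => f x * h x) (-1) 1 = J (fun x => `|f x|) (-1) 1.
Proof.
move=> fi; have mf : measurable_fun (@II R) f by case/integrableP: fi => /measurable_EFinP.
pose g := f \_ (@II R).
have mg : measurable_fun [set: R] g.
  by apply/(measurable_restrictT _ _).1 => //; exact: measurable_itv.
exists (fun x => if 0 <= g x then 1 else -1); split.
  split; last by move=> x; case: ifP; rewrite ?normrN1 ?normr1.
  by apply: measurable_fun_ifT => //; exact: measurable_fun_ler.
apply: J_eq => x x1; have -> : g x = f x.
  by rewrite /g /patch mem_set// /II/= in_itv.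
by case: ifPn => [f0|]; [rewrite mulr1 ger0_norm|rewrite -ltNge => f0; rewrite mulrN1 ltr0_norm].
Qed.

End dual_norm.

(** * Oseledets spaces and recurrence *)

Section recurrence.
Context {R : realType} {d : measure_display} {Omega : measurableType d}.
Variables (P : probability Omega R) (sigma : Omega -> Omega).
Hypothesis sigma_mp : measure_preserving P sigma.

Lemma iter_preserving n : measurable_fun setT (iter n sigma) /\
  forall A, measurable A -> P (iter n sigma @^-1` A) = P A.
Proof.
have [ms Ps] := sigma_mp; elim: n => [|n [mn IH]].
  by split => //; exact: measurable_id.
split; first exact: (measurableT_comp ms mn).
move=> A mA; rewrite -[iter n.+1 sigma @^-1` A]/(iter n sigma @^-1` (sigma @^-1` A)).
rewrite IH ?Ps//; rewrite -[X in measurable X]setTI; exact: ms.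
Qed.

Lemma ae_orbit (Q : Omega -> Prop) : (\forall w \ae P, Q w) ->
  \forall w \ae P, forall n, Q (iter n sigma w).
Proof.
move=> [N [mN N0 NQ]]; apply/ae_foralln => n.
have [mn Pn] := iter_preserving n.
exists (iter n sigma @^-1` N); split.
- by rewrite -[X in measurable X]setTI; exact: mn.
- exact: etrans (Pn _ mN) N0.
- by move=> w /= nQ; exact: NQ.
Qed.

Lemma poincare_recurrence B : measurable B ->
  (\forall w \ae P, ~ forall m, exists2 n, (m <= n)%N & B (iter n sigma w)) ->
  P B = 0%E.
Proof.
move=> mB [N [mN N0 HN]].
pose F m := \bigcup_(n in [set n | (m <= n)%N]) (iter n sigma @^-1` B).
have mp n : measurable (iter n sigma @^-1` B).
  by rewrite -[X in measurable X]setTI; have [mn _] := iter_preserving n; exact: mn.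
have mF m : measurable (F m) by apply: bigcup_measurable => n _; exact: mp.
have mI : measurable (\bigcap_m F m) by exact: bigcapT_measurable.
have I0 : P (\bigcap_m F m) = 0%E.
  apply/eqP; rewrite -measure_le0 -N0; apply: le_measure; rewrite ?inE//.
  move=> w Fw; apply: HN; apply => m.
  by have [n /= mn Bn] := Fw m I; exists n.
have dF : nonincreasing_seq F.
  apply/nonincreasing_seqP => n; apply/subsetPset => w [k /= nk Bk].
  by exists k => //=; exact: ltnW.
have F0 : (P (F 0%N) < +oo)%E by rewrite (le_lt_trans (probability_le1 P (mF 0%N)))// ltry.
have cF : P (F m) @[m --> \oo] --> 0%E.
  by rewrite -I0; exact: (nonincreasing_cvg_mu F0 mF mI dF).
apply/eqP; rewrite -measure_le0 -(cvg_lim _ cF)//.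
apply: lime_ge; first by apply/cvg_ex; eexists; exact: cF.
apply: nearW => m /=; have [_ Pm] := iter_preserving m.
rewrite -(Pm _ mB); apply: le_measure; rewrite ?inE//.
by move=> w Bw; exists m => //=.
Qed.

End recurrence.

Section bounded_variation_space.
Context {R : realType}.
Local Notation mu := (@lebesgue_measure R).
Implicit Types (f g : R -> R) (c x y : R).

Lemma BVI_of_split f g1 g2 : measurable_fun (@II R) f -> ndec g1 -> ndec g2 ->
  eqI f (g1 \- g2) -> BVI f.
Proof.
move=> mf n1 n2 fg; split => //; exists (g1 \- g2); split => //.
apply: bounded_variationD; first by lra.
  by apply: nondecreasing_bounded_variation => x y _ _; exact: n1.
apply: bounded_variationN.
by apply: nondecreasing_bounded_variation => x y _ _; exact: n2.
Qed.

Lemma ndecD f g : ndec f -> ndec g -> ndec (f \+ g).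
Proof. by move=> fn gn x y xy; apply: lerD; [exact: fn|exact: gn]. Qed.

Lemma ndecZ c f : 0 <= c -> ndec f -> ndec (fun x => c * f x).
Proof. by move=> c0 fn x y xy; rewrite ler_wpM2l// fn. Qed.

Lemma BVI_lin c f g : BVI f -> BVI g -> BVI (fun x => c * f x + g x).
Proof.
move=> fB gB; have [f1 [f2 [n1 n2 _ _ fE]]] := BVI_split fB.
have [g1 [g2 [k1 k2 _ _ gE]]] := BVI_split gB.
have mf : measurable_fun (@II R) (fun x => c * f x + g x).
  by case: fB => ? _; case: gB => ? _; apply: measurable_funD => //; exact: measurable_funM.
have [c0|c0] := leP 0 c.
  apply: (BVI_of_split mf (ndecD (ndecZ c0 n1) k1) (ndecD (ndecZ c0 n2) k2)).
  by apply: (aeS2 _ fE gE) => x H1 H2 xI; rewrite H1// H2//=; ring.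
have c0' : 0 <= - c by lra.
apply: (BVI_of_split mf (ndecD (ndecZ c0' n2) k1) (ndecD (ndecZ c0' n1) k2)).
by apply: (aeS2 _ fE gE) => x H1 H2 xI; rewrite H1// H2//=; ring.
Qed.

Lemma BVI_cst c : BVI (fun _ : R => c).
Proof.
have n1 : ndec (fun _ : R => c) by move=> x y _.
have n2 : ndec (fun _ : R => 0 : R) by move=> x y _.
apply: (BVI_of_split _ n1 n2); first exact: measurable_cst.
by apply: (@ae_ne _ 0) => x _ _ /=; rewrite subr0.
Qed.

Lemma BVI_psi0 : BVI (@psi0 R).
Proof.
have n1 : ndec (fun _ : R => 0 : R) by move=> x y _.
have n2 : ndec (fun x : R => if x < 0 then - 2^-1 else if x <= 0 then 0 else 2^-1).
  by move=> x y xy; do 4?case: ifPn; lra.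
apply: (BVI_of_split _ n1 n2).
  have -> : (@psi0 R) = (fun x => 2^-1 * hstar x).
    by apply/funext => x; rewrite /hstar; field.
  by apply: measurable_funTS; case: (bmeasZ 2^-1 (@bmeas_hstar R)).
apply: (@ae_ne _ 0) => x x0; rewrite /II/= in_itv/= => /andP[x1 x2].
rewrite /psi0 !indicE.
have -> : (x \in IL) = (x <= 0).
  by apply/idP/idP; rewrite inE /IL/= in_itv/= x1.
have -> : (x \in IR) = (0 <= x).
  by apply/idP/idP; rewrite inE /IR/= in_itv/= x2 andbT.
by case: (ltgtP x 0) x0 => //= _ _; lra.
Qed.

Lemma pair_hstar f : integ (-1) 1 f ->
  J (fun x => f x * hstar x) (-1) 1 = J f (-1) 0 - J f 0 1.
Proof.
move=> fi; have fh := integM (@bmeas_hstar R) fi.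
have fL : integ (-1) 0 f by apply: integ_sub fi; lra.
have fR : integ 0 1 f by apply: integ_sub fi; lra.
have hL : integ (-1) 0 (fun x => f x * hstar x) by apply: integ_sub fh; lra.
have hR : integ 0 1 (fun x => f x * hstar x) by apply: integ_sub fh; lra.
rewrite (@J_chasles _ (-1) 0 1)//; congr (_ + _).
  apply: J_eqoo => // x x0; rewrite hstarE !indicE.
  rewrite (_ : x \in IL = true); last by apply/idP; rewrite inE/IL/= in_itv/=; lra.
  rewrite (_ : x \in IR = false) ?subr0 ?mulr1//; apply/negP.
  by rewrite inE/IR/= in_itv/=; lra.
rewrite -[RHS]mulN1r -JZ//.
apply: J_eqoo => //; first exact: integZ.
move=> x x0; rewrite hstarE !indicE.
rewrite (_ : x \in IR = true); last by apply/idP; rewrite inE/IR/= in_itv/=; lra.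
rewrite (_ : x \in IL = false) ?sub0r ?mulrN1 ?mulN1r//; apply/negP.
by rewrite inE/IL/= in_itv/=; lra.
Qed.

Lemma weak_scale c f g N :
  (forall x y, -1 <= x -> y <= 1 -> J f x y = c * J g x y) ->
  wvar N f = `|c| * wvar N g /\ wl1 N f = `|c| * wl1 N g.
Proof.
move=> H; split.
  rewrite /wvar mulr_sumr !big_nat; apply: eq_bigr => i /= iN.
  rewrite /mean !H ?pt_ge ?pt_le//; last exact: ltnW.
  by rewrite -normrM; congr (`|_|); ring.
rewrite /wl1 mulr_sumr !big_nat; apply: eq_bigr => i /= iN.
by rewrite !H ?pt_ge ?pt_le// normrM.
Qed.

End bounded_variation_space.

(** * Decomposition of [psi0] along the Oseledets spaces *)

Section decomposition.
Context {R : realType} {d : measure_display} {Omega : measurableType d}.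
Variables (sigma : Omega -> Omega) (a b : Omega -> R) (eps : R).
Variable L : Omega -> (R -> R) -> (R -> R).
Hypothesis eps01 : 0 <= eps <= 1.
Hypothesis a01 : forall w, 0 <= a w <= 1.
Hypothesis b01 : forall w, 0 <= b w <= 1.
Hypothesis L_def : forall w, L w = transfer (tent (eps * a w) (eps * b w)).
Variables (S : @splitting R d Omega) (w : Omega).
Let th := params sigma a b eps w.
Let lam := expo S 1.
Hypothesis idx1 : has_index S 1.
Hypothesis expo1 : expo S 1 < 0.
Hypothesis expo_lt : forall i, has_index S i.+1 -> expo S i.+1 < expo S i.
Hypothesis index_lt : forall i, has_index S i -> (compactness_index S < (expo S i)%:E)%E.
Hypothesis V_BVI : forall i f, has_index S i -> spaceV S i w f -> BVI f.
Hypothesis W_sub : is_subspace (spaceW S w).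
Hypothesis splits_w : splits sigma L S w.
Hypothesis V_growth : forall i, has_index S i -> forall f, spaceV S i w f ->
  ~ eqI f (cst 0) -> growth sigma L w f @ \oo --> (expo S i)%:E.
Hypothesis W_growth : forall f, spaceW S w f -> ~ eqI f (cst 0) ->
  (limn_esup (growth sigma L w f) <= compactness_index S)%E.
Variables (e0 E : R -> R).
Hypothesis V0E : forall f, spaceV S 0 w f -> exists c, eqI f (fun x => c * e0 x).
Hypothesis V0e : BVI e0.
Hypothesis V1E : forall f, spaceV S 1 w f -> exists c, eqI f (fun x => c * E x).

Let BVI_meas (f : R -> R) : BVI f -> measurable_fun (@II R) f. Proof. by case. Qed.

Lemma eqI0_decays lam' f : BVI f -> eqI f (cst 0) -> decays th lam' f.
Proof.
move=> fB f0; apply: (@decays_eqI _ th lam' (cst 0)).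
- exact: measurable_cst.
- exact: BVI_meas.
- exact: eqI_sym.
- exact: decays0.
Qed.

Lemma has_index_le i j : (i <= j)%N -> has_index S j -> has_index S i.
Proof. by rewrite /has_index; case: (Defs.num S) => // l; exact: leq_ltn_trans. Qed.

Lemma expo_gt1 i : has_index S i.+2 -> expo S i.+2 < lam.
Proof.
elim: i => [|i IH] hi; first exact: expo_lt.
apply: (lt_trans (expo_lt hi)); apply: IH; exact: has_index_le hi.
Qed.

Lemma V_decays i lam' f : has_index S i -> spaceV S i w f -> expo S i < lam' ->
  decays th lam' f.
Proof.
move=> hi Vf il; have fB := V_BVI hi Vf.
have [f0|f0] := pselect (eqI f (cst 0)); first exact: eqI0_decays.
exact: (growth_cvg_decays eps01 a01 b01 L_def (BVI_integ fB) (V_growth hi Vf f0)).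
Qed.

Lemma decomposition3 f : BVI f -> exists v0 v1 u,
  [/\ spaceV S 0 w v0, spaceV S 1 w v1, integ (-1) 1 u, decays th lam u &
      eqI f (fun x => v0 x + v1 x + u x)].
Proof.
move=> fB; move: splits_w; rewrite /splits; case En : (Defs.num S) => [l|].
  have l1 : (1 < l)%N by move: idx1; rewrite /has_index En.
  move=> [/(_ _ fB)[v [u [Vv Wu fE]]] _].
  have [WB _ _ _] := W_sub.
  have uB := WB _ Wu.
  have hl i : (i < l)%N -> has_index S i by rewrite /has_index En.
  case: l l1 En Vv fE hl => [//|[//|l]] _ En Vv fE hl.
  have [si sd] := @decays_sum _ th lam l (fun i => v i.+2)
    (fun i il => conj (BVI_integ (V_BVI (hl i.+2 il) (Vv i.+2 il)))
                      (V_decays (hl i.+2 il) (Vv i.+2 il) (expo_gt1 (hl i.+2 il)))).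
  have ud : decays th lam u.
    have [u0|u0] := pselect (eqI u (cst 0)); first exact: eqI0_decays.
    exact: (growth_decays eps01 a01 b01 L_def (BVI_integ uB) (W_growth Wu u0) (index_lt idx1)).
  exists (v 0%N), (v 1%N), (fun x => \sum_(i < l) v i.+2 x + u x); split.
  - exact: Vv.
  - exact: Vv.
  - by apply: integD => //; exact: BVI_integ.
  - by apply: decaysD => //; exact: BVI_integ.
  - by apply: aeS fE => x H /H ->; rewrite !big_ord_recl/= !addrA.
(* With infinitely many exponents, the truncation after two spaces suffices: its complement has rate
   at most the third exponent, already below [lam]. *)
move=> [H _]; have [/(_ _ fB)[v [u [Vv [uB ul] fE]]] _] := H 2%N.
have h i : has_index S i by rewrite /has_index En.
exists (v 0%N), (v 1%N), u; split.
- exact: Vv.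
- exact: Vv.
- exact: BVI_integ.
- apply: (growth_decays eps01 a01 b01 L_def (BVI_integ uB) ul).
  by rewrite lte_fin; apply: expo_lt; exact: h.
- by apply: aeS fE => x K /K ->; rewrite !big_ord_recl/= big_ord0 addr0.
Qed.

Let mass0 i f : has_index S i -> spaceV S i w f -> expo S i < 0 -> J f (-1) 1 = 0.
Proof.
move=> hi Vf i0; have fi := BVI_integ (V_BVI hi Vf).
exact: (decays_mass0 fi (lexx 0) (V_decays hi Vf i0)).
Qed.

Let idx0 : has_index S 0. Proof. exact: has_index_le idx1. Qed.

Lemma mass_V0 f : BVI f -> exists v0 c, [/\ spaceV S 0 w v0,
  eqI v0 (fun x => c * e0 x), J f (-1) 1 = c * J e0 (-1) 1 &
  exists v1 u, [/\ spaceV S 1 w v1, integ (-1) 1 u, decays th lam u &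
      eqI f (fun x => v0 x + v1 x + u x)]].
Proof.
move=> fB; have [v0 [v1 [u [V0 V1 ui ud fE]]]] := decomposition3 fB.
have [c vc] := V0E V0; exists v0, c; split => //; last by exists v1, u.
have i0 := BVI_integ (V_BVI idx0 V0); have i1 := BVI_integ (V_BVI idx1 V1).
have mi g : integ (-1) 1 g -> measurable_fun (@II R) g.
  by move=> /integrableP[/measurable_EFinP].
have ie := BVI_integ V0e.
rewrite (eqI_J _ _ _ _ fE)//; [|exact: BVI_meas|]; last first.
  by apply: mi; apply: integD => //; exact: integD.
rewrite (JD (integD i0 i1) ui) (JD i0 i1) (mass0 idx1 V1 expo1).
rewrite (decays_mass0 ui (ltW expo1) ud) !addr0.
rewrite (eqI_J _ _ _ _ vc)//; [exact: JZ|exact: mi|].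
by apply: mi; exact: integZ.
Qed.

(** Only the first space carries integral. The constant 1 forces [e0] to have nonzero integral, and
    [psi0] has integral 0, so its coefficient along [e0] vanishes. *)
Lemma decomposition_psi0 : exists c u, [/\ integ (-1) 1 u, decays th lam u &
  eqI (@psi0 R) (fun x => c * E x + u x)].
Proof.
have [v [c1 [_ _ m1 _]]] := mass_V0 (BVI_cst (1 : R)).
have [v0 [c0 [V0 v0E m0 [v1 [u [V1 ui ud fE]]]]]] := mass_V0 (@BVI_psi0 R).
have e0n : J e0 (-1) 1 != 0.
  apply/eqP => e00; move: m1; rewrite e00 mulr0 J_cst; [lra|lra].
have psi0m : J (@psi0 R) (-1) 1 = 0.
  have b1 : bmeas 1 (fun _ : R => 1 : R) by rewrite -[X in bmeas X](@normr1 R); exact: bmeas_cst.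
  have := pair_psi0 b1; rewrite (@J_eq _ _ _ _ (@psi0 R)); last by move=> x _; rewrite mulr1.
  by move=> ->; rewrite /gap (_ : _ \o _ = (fun=> 1))// subrr mulr0.
have c00 : c0 = 0.
  by apply/eqP; move: m0; rewrite psi0m => /esym/eqP; rewrite mulf_eq0 (negbTE e0n) orbF.
have [c v1E] := V1E V1.
exists c, u; split => //.
apply: (aeS2 _ fE); last by apply: (aeS2 _ v0E v1E) => x H1 H2; exact: (conj H1 H2).
by move=> x H [H0 H1] xI; rewrite H// H0// H1// c00 mul0r add0r.
Qed.

End decomposition.

(** * Closeness for almost every [w], at fixed [eps] *)

Section fixed_parameter.
Context {R : realType} {d : measure_display} {Omega : measurableType d}.
Variables (P : probability Omega R) (sigma : Omega -> Omega).
Hypothesis sigma_mp : measure_preserving P sigma.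
Variables (a b : Omega -> R) (eps t : R) (k : nat).
Hypothesis eps1 : 0 <= eps <= 1000^-1.
Hypothesis a01 : forall w, 0 <= a w <= 1.
Hypothesis b01 : forall w, 0 <= b w <= 1.
Hypothesis t01 : 0 < t <= 1.
Hypothesis dir : forall w n h, (k <= n)%N -> bmeas 1 h ->
  `|gap (h \o orb (params sigma a b eps w) n)
    - 2^-1 * gap h * mass (params sigma a b eps w) n|
  <= t * mass (params sigma a b eps w) n.
Variable L : Omega -> (R -> R) -> (R -> R).
Hypothesis L_def : forall w, L w = transfer (tent (eps * a w) (eps * b w)).
Variable S : @splitting R d Omega.
Hypothesis S_os : is_oseledets_splitting P sigma L S.
Hypothesis idx1 : has_index S 1.
Hypothesis mult0 : mult S 0 = 1%N.
Hypothesis mult1 : mult S 1 = 1%N.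
Hypothesis expo1 : expo S 1 < 0.
Variable psi : Omega -> R -> R.
Hypothesis psi_span : \forall w \ae P, is_basis (spaceV S 1 w) (fun _ : 'I_1 => psi w).
Hypothesis psi_norm : \forall w \ae P, L1norm (psi w) = 1%E.
Hypothesis psi_sign : \forall w \ae P,
  (0 < \int[@lebesgue_measure R]_(x in IL) (psi w x)%:E)%E.

Let eps01 : 0 <= eps <= 1. Proof. by move: eps1; lra. Qed.

Lemma basis1 (V : set (R -> R)) (e : 'I_1 -> R -> R) : is_basis V e ->
  BVI (e ord0) /\ forall f, V f <-> BVI f /\ exists c, eqI f (fun x => c * e ord0 x).
Proof.
move=> [eB VE _]; split; first exact: eB.
move=> f; rewrite VE/=; split => -[fB [c cE]]; split => //.
  by exists (c ord0); apply: aeS cE => x H /H ->; rewrite big_ord_recl big_ord0 addr0.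
by exists (fun=> c); apply: aeS cE => x H /H ->; rewrite big_ord_recl big_ord0 addr0.
Qed.

Definition point_data (e : Omega -> R -> R) (w : Omega) : Prop :=
  [/\ BVI (e w), forall f, spaceV S 1 w f <-> BVI f /\ exists c, eqI f (fun x => c * e w x),
      J (e w) (-1) 0 != 0,
      (forall f, spaceV S 1 w f -> spaceV S 1 (sigma w) (L w f)) &
      (forall f, spaceV S 1 w f -> ~ eqI f (cst 0) ->
        growth sigma L w f @ \oo --> (expo S 1)%:E)].

(** The left integral is made [2^-1], as for [psi0]. This fixes the sign too and is insensitive to
    the scaling of the basis vector [e w]. *)
Definition normalized (e : Omega -> R -> R) w : R -> R :=
  fun x => (2 * J (e w) (-1) 0)^-1 * e w x.

Section orbit.
Variables (e : Omega -> R -> R) (w : Omega).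
Hypothesis data : forall n, point_data e (iter n sigma w).
Let E := normalized e.
Let th := params sigma a b eps w.

Lemma normalized_BVI n : BVI (E (iter n sigma w)).
Proof.
have [eB _ _ _ _] := data n.
have := BVI_lin ((2 * J (e (iter n sigma w)) (-1) 0)^-1) eB (BVI_cst 0).
by congr BVI; apply/funext => x; rewrite addr0.
Qed.

Lemma normalized_left n : J (E (iter n sigma w)) (-1) 0 = 2^-1.
Proof.
have [eB _ m0 _ _] := data n; have ei := BVI_integ eB.
rewrite /E /normalized JZ; last by apply: integ_sub ei; lra.
by rewrite invfM -mulrA mulVf// mulr1.
Qed.

Lemma normalized_V n : spaceV S 1 (iter n sigma w) (E (iter n sigma w)).
Proof.
have [_ VE _ _ _] := data n; apply/VE; split; first exact: normalized_BVI.
by exists (2 * J (e (iter n sigma w)) (-1) 0)^-1; exact: aeW.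
Qed.

Lemma normalized_span n f : spaceV S 1 (iter n sigma w) f ->
  exists c, eqI f (fun x => c * E (iter n sigma w) x).
Proof.
have [_ VE m0 _ _] := data n; move=> /VE[_ [c cE]].
exists (c * (2 * J (e (iter n sigma w)) (-1) 0)); apply: aeS cE => x H /H ->.
by rewrite /E /normalized; field.
Qed.

Lemma normalized_neq0 n : ~ eqI (E (iter n sigma w)) (cst 0).
Proof.
have [mE _] := normalized_BVI n.
move=> /(eqI_J (lexx (-1)) ler01 mE (measurable_cst _)).
rewrite normalized_left J_cst; lra.
Qed.

Lemma cocycle_V n : spaceV S 1 (iter n sigma w) (cocycle sigma L n w (E w)).
Proof.
elim: n => [|n IH]; first exact: (normalized_V 0).
by have [_ _ _ eqv _] := data n; exact: eqv.
Qed.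

Lemma cocycle_growth : growth sigma L w (E w) @ \oo --> (expo S 1)%:E.
Proof.
have [_ _ _ _ gr] := data 0%N.
apply: gr; [exact: (normalized_V 0)|exact: (@normalized_neq0 0)].
Qed.

Lemma normalized_decays lam : expo S 1 < lam -> decays th lam (E w).
Proof.
move=> el; apply: (growth_cvg_decays eps01 a01 b01 L_def (BVI_integ (normalized_BVI 0)) _ el).
exact: cocycle_growth.
Qed.

End orbit.

Lemma orbit_shift e w n : (forall n, point_data e (iter n sigma w)) ->
  forall m, point_data e (iter m sigma (iter n sigma w)).
Proof. by move=> H m; rewrite -iterD. Qed.

Lemma normalized_mass0 e w : (forall n, point_data e (iter n sigma w)) ->
  J (normalized e w) (-1) 1 = 0.
Proof.
move=> H; apply: (decays_mass0 (BVI_integ (normalized_BVI H 0)) (lexx 0)).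
exact: normalized_decays H _ expo1.
Qed.

Definition tame (K : R) (f : R -> R) := forall N, wvar N f <= K /\ wl1 N f <= K.

(** One-dimensionality turns the iterates of the normalised vector into multiples [gam n] of the
    normalised vectors along the orbit, as [closeness] requires; visits to [B] are the times of
    bounded BV norm. *)
Lemma recurrent_close e w (K : R) (B : set Omega) : 0 < K ->
  (forall n, point_data e (iter n sigma w)) ->
  (exists c u, [/\ integ (-1) 1 u, decays (params sigma a b eps w) (expo S 1) u &
     eqI (@psi0 R) (fun x => c * normalized e w x + u x)]) ->
  (forall m, exists2 n, (m <= n)%N & B (iter n sigma w)) ->
  (forall n, B (iter n sigma w) -> tame K (normalized e (iter n sigma w))) ->
  exists2 n, B (iter n sigma w) & forall h, bmeas 1 h ->
    `|J (fun x => normalized e (iter n sigma w) x * h x) (-1) 1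
      - J (fun x => psi0 x * h x) (-1) 1| <= 2 * t.
Proof.
move=> K0 data [c [u [ui ud uE]]] Binf Btame.
pose E n := normalized e (iter n sigma w).
have Ei n : integ (-1) 1 (E n) by exact: BVI_integ (normalized_BVI data n).
have spanC n : exists g, eqI (cocycle sigma L n w (E 0%N)) (fun x => g * E n x).
  by apply: (normalized_span data); exact: (cocycle_V data).
pose gam n := sval (cid (spanC n)).
have gamP n : eqI (cocycle sigma L n w (E 0%N)) (fun x => gam n * E n x).
  exact: (svalP (cid (spanC n))).
have CB n : BVI (cocycle sigma L n w (E 0%N)).
  have [_ VE _ _ _] := data n.
  by have /VE[] := cocycle_V data n.
have mC n : measurable_fun (@II R) (cocycle sigma L n w (E 0%N)) by case: (CB n).
have mE n : measurable_fun (@II R) (E n) by case: (normalized_BVI data n).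
have mgE n : measurable_fun (@II R) (fun x => gam n * E n x).
  by apply: measurable_funM.
have sp := params_small sigma eps01 a01 b01 w.
have R1 n : J (E n) (-1) 1 = 0.
  exact: normalized_mass0 (orbit_shift n data).
(* [K + K] bounds the BV norm of a tame vector: one [K] for the variation, one for the L1 norm. *)
apply: (@closeness _ (params sigma a b eps w) eps t (expo S 1) (K + K) c k
  (E 0%N) u E gam [set n | B (iter n sigma w)]) => //.
- by move=> n h; exact: dir.
- exact: (normalized_BVI data 0).
- exact: (normalized_left data 0).
- lra.
- move=> n Bn h h1.
  have [_ cE] := cocycle_dual sigma eps01 a01 b01 L_def w n (Ei 0%N).
  rewrite -(cE _ _ h1) -JZ; last exact: integM h1 (Ei n).
  have mh : measurable_fun (@II R) h by apply: measurable_funTS; case: h1.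
  apply: eqI_J => //; [exact: measurable_funM| |].
    by apply: measurable_funM => //; exact: measurable_funM.
  by apply: aeS (gamP n) => x H /H ->; rewrite mulrA.
- move=> n Bn; rewrite pair_hstar//.
  have := R1 n; rewrite (@J_chasles _ _ 0)// (normalized_left data n); lra.
- move=> r rl; have gr := cvg_near_gt (cocycle_growth data) rl.
  near=> m => Bm.
  have m0 : (0 < m)%N by near: m; exists 1%N.
  rewrite -lee_fin.
  apply: (@le_trans _ _ (BVnorm (cocycle sigma L m w (E 0%N)))).
    by apply: rate_ge => //; near: m.
  have sc x y : -1 <= x -> y <= 1 ->
      J (cocycle sigma L m w (E 0%N)) x y = gam m * J (E m) x y.
    move=> x1 y1; rewrite (eqI_J x1 y1 (mC m) (mgE m) (gamP m)) JZ//.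
    exact: integ_sub (Ei m).
  rewrite mulrDr; apply: BVnorm_le => // N; have [e1 e2] := weak_scale N sc;
    have [t1 t2] := Btame m Bm N; rewrite ?e1 ?e2; exact: ler_wpM2l.
Unshelve. all: by end_near. Qed.


Section measurable_basis.
Variable e : Omega -> R -> R.
Hypothesis e_meas : forall D : set R, measurable D -> D `<=` II ->
  measurable_fun setT (fun w => (\int[@lebesgue_measure R]_(x in D) (e w x)%:E)%E).

Lemma J_measurable x y : -1 <= x -> y <= 1 ->
  measurable_fun setT (fun w => J (e w) x y).
Proof.
move=> x1 y1; rewrite /J /Rintegral.
apply: (measurableT_comp (fine_measurable measurableT)).
apply: e_meas; first exact: measurable_itv.
by apply: subset_itvScc; rewrite bnd_simp.
Qed.

Lemma mean_measurable N i : (i <= N)%N -> measurable_fun setT (fun w => mean N (e w) i).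
Proof.
move=> iN; apply: measurable_funM; last exact: measurable_cst.
by apply: J_measurable; [exact: pt_ge|exact: pt_le].
Qed.

Lemma wvar_measurable N : measurable_fun setT (fun w => wvar N (e w)).
Proof.
rewrite /wvar; under eq_fun do rewrite big_mkord.
apply: measurable_sum => i; apply: measurableT_comp => //.
by apply: measurable_funB; apply: mean_measurable => //; exact: ltnW.
Qed.

Lemma wl1_measurable N : measurable_fun setT (fun w => wl1 N (e w)).
Proof.
rewrite /wl1; under eq_fun do rewrite big_mkord.
apply: measurable_sum => i; apply: measurableT_comp => //.
by apply: J_measurable; [exact: pt_ge|exact: pt_le].
Qed.

Definition twice_mass w : R := 2 * `|J (e w) (-1) 0|.

Lemma twice_mass_measurable : measurable_fun setT twice_mass.
Proof.
apply: measurable_funM => //; apply: measurableT_comp => //.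
by apply: J_measurable; lra.
Qed.

Definition cell_dist N w : R := \sum_(0 <= i < N.+1)
  `|J (e w) (pt N i) (pt N i.+1) - 2 * J (e w) (-1) 0 * J (@psi0 R) (pt N i) (pt N i.+1)|.

Lemma cell_dist_measurable N : measurable_fun setT (cell_dist N).
Proof.
rewrite /cell_dist; under eq_fun do rewrite big_mkord.
apply: measurable_sum => i; apply: measurableT_comp => //.
apply: measurable_funB; first by apply: J_measurable; [exact: pt_ge|exact: pt_le].
apply: measurable_funM => //; apply: measurable_funM => //.
by apply: J_measurable; lra.
Qed.

(* Written homogeneously in [e w] rather than in terms of [normalized e w], so
   that no quotient of measurable functions is needed. *)
Definition bad (K N : nat) : set Omega :=
  (\bigcap_M ([set w | wvar M (e w) <= K.+1%:R * twice_mass w] `&`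
              [set w | wl1 M (e w) <= K.+1%:R * twice_mass w])) `&`
  ~` [set w | cell_dist N w <= 2 * t * twice_mass w].

Lemma bad_measurable K N : measurable (bad K N).
Proof.
have le_meas (f g : Omega -> R) : measurable_fun setT f -> measurable_fun setT g ->
    measurable [set w | f w <= g w].
  by move=> mf mg; rewrite -[X in measurable X]setTI; exact: measurable_fun_le.
have tm (c : R) : measurable_fun setT (fun w => c * twice_mass w).
  by apply: measurable_funM => //; exact: twice_mass_measurable.
apply: measurableI; last by apply: measurableC; apply: le_meas => //; exact: cell_dist_measurable.
apply: bigcapT_measurable => M; apply: measurableI; apply: le_meas => //.
- exact: wvar_measurable.
- exact: wl1_measurable.
Qed.

Section point.
Variable w : Omega.
Hypothesis data : forall n, point_data e (iter n sigma w).
Let E := normalized e w.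

Let eB : BVI (e w). Proof. by have [] := data 0%N. Qed.
Let m0 : J (e w) (-1) 0 != 0. Proof. by have [] := data 0%N. Qed.

Let tm0 : 0 < twice_mass w.
Proof. by rewrite mulr_gt0// normr_gt0. Qed.

Let tmE : `|(2 * J (e w) (-1) 0)^-1| = (twice_mass w)^-1.
Proof. by rewrite normfV normrM ger0_norm. Qed.

Let scale x y : -1 <= x -> y <= 1 ->
  J E x y = (2 * J (e w) (-1) 0)^-1 * J (e w) x y.
Proof. by move=> x1 y1; rewrite JZ//; exact: integ_sub (BVI_integ eB). Qed.

Lemma tame_normalized (K : R) : tame K E <->
  forall N, wvar N (e w) <= K * twice_mass w /\ wl1 N (e w) <= K * twice_mass w.
Proof.
split=> H N; have [h1 h2] := H N; have [e1 e2] := weak_scale N scale.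
  by move: h1 h2; rewrite e1 e2 tmE !ler_pdivrMl// ![_ * K]mulrC.
by rewrite e1 e2 tmE !ler_pdivrMl// ![_ * K]mulrC.
Qed.

Lemma wl1_dist N : wl1 N (fun x => E x - psi0 x) = (twice_mass w)^-1 * cell_dist N w.
Proof.
rewrite -tmE /wl1 /cell_dist mulr_sumr !big_nat; apply: eq_bigr => i /= iN.
have x1 : -1 <= pt N i :> R := pt_ge N i.
have y1 : pt N i.+1 <= 1 :> R by exact: pt_le.
rewrite JB; last 2 first.
- exact: integ_sub (BVI_integ (normalized_BVI data 0)).
- exact: integ_sub (BVI_integ (@BVI_psi0 R)).
by rewrite -normrM (scale x1 y1); congr (`|_|); field.
Qed.

Lemma tame_dist (K N : nat) : tame K.+1%:R E -> ~ bad K N w ->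
  wl1 N (fun x => E x - psi0 x) <= 2 * t.
Proof.
move=> /tame_normalized H nb; rewrite wl1_dist ler_pdivrMl// mulrC.
apply: contrapT => /= dN; apply: nb; split => // M _.
by have [h1 h2] := H M; split.
Qed.

Lemma bad_tame (K N : nat) : bad K N w -> tame K.+1%:R E /\
  2 * t < wl1 N (fun x => E x - psi0 x).
Proof.
move=> [H dN]; split.
  by apply/tame_normalized => M; have [] := H M I.
by rewrite wl1_dist ltr_pdivlMl// mulrC ltNge; apply/negP.
Qed.

End point.

Hypothesis e_data : \forall w \ae P, forall n, point_data e (iter n sigma w).
Hypothesis e_decomp : \forall w \ae P, exists c u, [/\ integ (-1) 1 u,
  decays (params sigma a b eps w) (expo S 1) u &
  eqI (@psi0 R) (fun x => c * normalized e w x + u x)].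

Lemma dist_BVI (w : Omega) : (forall n, point_data e (iter n sigma w)) ->
  BVI (fun x => normalized e w x - psi0 x).
Proof.
move=> data; have := BVI_lin (-1) (@BVI_psi0 R) (normalized_BVI data 0).
by congr BVI; apply/funext => x /=; ring.
Qed.

(** An orbit returning infinitely often to [bad K N] has, by [recurrent_close], a visit where the L1
    distance to [psi0] is at most [2 * t]; as [wl1] is below the L1 norm, that point is not bad. *)
Lemma bad_null K N : P (bad K N) = 0%E.
Proof.
apply: (poincare_recurrence sigma_mp (bad_measurable K N)).
apply: filterS2 e_data e_decomp => w data dec rec.
have K0 : 0 < K.+1%:R :> R by [].
have [n Bn H] := recurrent_close K0 data dec rec
  (fun n Bn => (bad_tame (orbit_shift n data) Bn).1).
have [_] := bad_tame (orbit_shift n data) Bn; apply/negP; rewrite -leNgt.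
have fB := dist_BVI (orbit_shift n data).
have fi := BVI_integ fB.
apply: le_trans (wl1_le N fi) _.
have [h [h1 <-]] := dual_norm fi.
have Ei := BVI_integ (normalized_BVI data n).
have pi := BVI_integ (@BVI_psi0 R).
apply: le_trans (H _ h1); apply: le_trans (ler_norm _).
rewrite -(JB (integM h1 Ei) (integM h1 pi)) le_eqVlt; apply/orP; left; apply/eqP.
by apply: J_eq => x _; rewrite mulrBl.
Qed.

(** Countably many bad sets are discarded. Every remaining vector is tame for some integer bound, so
    all its grid distances to [psi0] are small, hence also the L1 distance. *)
Lemma normalized_close : \forall w \ae P,
  J (fun x => `|normalized e w x - psi0 x|) (-1) 1 <= 2 * t.
Proof.
have nb : \forall w \ae P, forall K N, ~ bad K N w.
  apply/ae_foralln => K; apply/ae_foralln => N.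
  exists (bad K N); split; [exact: bad_measurable|exact: bad_null|].
  by move=> w /contrapT.
apply: filterS2 e_data nb => w data nb.
have [K0 HK] := BVI_weak (normalized_BVI data 0).
have [K KK] : exists K : nat, K0 <= K.+1%:R.
  by exists (Num.truncn K0); exact/ltW/truncnS_gt.
apply: (J_norm_le_wl1 (dist_BVI data)) => N.
apply: (tame_dist data _ (nb K N)) => M.
by have [h1 h2] := HK M; split; [exact: le_trans h1 KK|exact: le_trans h2 KK].
Qed.

End measurable_basis.

(** Recurrence is run with the measurable basis of the splitting. Then [psi w = c * E] with [c > 0],
    and both [E - psi0] and the correction [(c - 1) * E] have L1 norm at most [2 * t]. *)
Lemma uniform_close : \forall w \ae P, (L1norm (psi w \- psi0)%R <= (4 * t)%:E)%E.
Proof.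
have [_ _ [expo_lt index_lt] V_meas S_ae] := S_os.
have [e [e_meas e_basis]] : exists e : Omega -> 'I_1 -> R -> R,
    (forall (j : 'I_1) (D : set R), measurable D -> D `<=` II ->
      measurable_fun setT
        (fun w => (\int[@lebesgue_measure R]_(x in D) (e w j x)%:E)%E)) /\
    \forall w \ae P, is_basis (spaceV S 1 w) (e w).
  by have := V_meas _ idx1; rewrite mult1.
pose e1 w := e w ord0.
have V_BVI : \forall w \ae P, forall i f, has_index S i -> spaceV S i w f -> BVI f.
  apply/ae_foralln => i.
  have [hi|nhi] := pselect (has_index S i); last first.
    by apply: aeW => w f /nhi.
  have [ei [_ eiB]] := V_meas i hi.
  by apply: filterS eiB => w [_ -> _] f _ [].
have V0 : \forall w \ae P, exists e0, BVI e0 /\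
    forall f, spaceV S 0 w f -> exists c, eqI f (fun x => c * e0 x).
  have := V_meas 0%N (has_index_le (leq0n 1) idx1); rewrite mult0 => -[e0 [_ e0B]].
  apply: filterS e0B => w /basis1[B V]; exists (e0 w ord0); split => // f.
  by move=> /V[].
have p_mass : \forall w \ae P, is_basis (spaceV S 1 w) (fun _ : 'I_1 => psi w) /\
    0 < J (psi w) (-1) 0.
  apply: filterS2 psi_span psi_sign => w pb ps; split => //.
  have [pB _] := basis1 pb.
  have pi : integ (-1) 0 (psi w) by apply: integ_sub (BVI_integ pB); lra.
  rewrite -lte_fin /J /Rintegral fineK//.
  by apply: integrable_fin_num pi; exact: measurable_itv.
have pd : \forall w \ae P, point_data e1 w.
  apply: filterS3 e_basis p_mass S_ae => w eb [pb pm] [_ eqv _ _ [gr _]].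
  have [eB eV] := basis1 eb; have [pB pV] := basis1 pb.
  split => //.
  (* [psi w] is a multiple of [e1 w], so its positive left integral excludes a vanishing one for
     [e1 w]. *)
  - have /eV[_ [c pc]] : spaceV S 1 w (psi w).
      by apply/pV; split => //; exists 1; apply: aeW => x _; rewrite mul1r.
    apply/eqP => m0; move: pm.
    have mp : measurable_fun (@II R) (psi w) by case: pB.
    have me : measurable_fun (@II R) (fun x => c * e1 w x).
      by apply: measurable_funM => //; case: eB.
    rewrite (eqI_J _ _ mp me pc)// JZ ?m0 ?mulr0 ?ltxx//.
    by apply: integ_sub (BVI_integ eB); lra.
  - by have [] := eqv 1%N idx1.
  - exact: gr.
have e_data : \forall w \ae P, forall n, point_data e1 (iter n sigma w).
  exact: ae_orbit.
have e_decomp : \forall w \ae P, exists c u, [/\ integ (-1) 1 u,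
    decays (params sigma a b eps w) (expo S 1) u &
    eqI (@psi0 R) (fun x => c * normalized e1 w x + u x)].
  have VV : \forall w \ae P, (forall i f, has_index S i -> spaceV S i w f -> BVI f) /\
      exists e0, BVI e0 /\
        forall f, spaceV S 0 w f -> exists c, eqI f (fun x => c * e0 x).
    by apply: filterS2 V_BVI V0.
  apply: filterS3 VV e_data S_ae => w [VB [e0 [e0B e0V]]] data [Ws _ _ sw [gr Wg]].
  apply: (@decomposition_psi0 _ _ _ sigma a b eps L eps01 a01 b01 L_def S w idx1
    expo1 expo_lt (fun i hi => (index_lt i hi).1) VB Ws sw gr Wg e0 _ e0V e0B).
    by move=> f; exact: (normalized_span data (n := 0)).
have em1 := e_meas ord0.
have close := normalized_close em1 e_data e_decomp.
have p_n : \forall w \ae P, (is_basis (spaceV S 1 w) (fun _ : 'I_1 => psi w) /\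
    0 < J (psi w) (-1) 0) /\ L1norm (psi w) = 1%E.
  by apply: filterS2 p_mass psi_norm.
apply: filterS3 p_n e_data close => w [[pb pm] pn] data cl.
have [pB pV] := basis1 pb.
have EB := normalized_BVI data 0; have Ei := BVI_integ EB; have pi := BVI_integ pB.
set E := normalized e1 w in cl EB Ei.
have [c pc] : exists c, eqI (psi w) (fun x => c * E x).
  apply: (normalized_span data (n := 0)).
  by apply/pV; split => //; exists 1; apply: aeW => x _; rewrite mul1r.
have mp : measurable_fun (@II R) (psi w) by case: pB.
have mE : measurable_fun (@II R) E by case: EB.
have mcE : measurable_fun (@II R) (fun x => c * E x) by exact: measurable_funM.
have c0 : 0 < c.
  move: pm; rewrite (eqI_J _ _ mp mcE pc)// JZ; last by apply: integ_sub Ei; lra.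
  by rewrite (normalized_left data 0) pmulr_lgt0//; lra.
pose nE := J (fun x => `|E x|) (-1) 1.
have cn : c * nE = 1.
  have : J (fun x => `|psi w x|) (-1) 1 = 1.
    by apply/EFin_inj; rewrite -L1normE.
  rewrite (@eqI_J _ _ (fun x => c * `|E x|))//; [|exact: measurableT_comp| |].
  - by rewrite JZ//; exact: integ_norm.
  - by apply: measurable_funM => //; exact: measurableT_comp.
  - by apply: aeS pc => x H /H ->; rewrite normrM gtr0_norm.
have p0i := BVI_integ (@BVI_psi0 R).
have mi f : integ (-1) 1 f -> measurable_fun (@II R) f.
  by move=> /integrableP[/measurable_EFinP].
have di : integ (-1) 1 (fun x => E x - psi0 x) by exact: integB.
have n0 : J (fun x : R => `|psi0 x|) (-1) 1 = 1.
  rewrite (@J_chasles _ _ 0)//; last exact: integ_norm.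
  have i1 x y := bmeas_integ x y (@bmeas_cst R 2^-1).
  have ps x : psi0 x = 2^-1 * (hstar x : R) by rewrite /hstar; field.
  have half x y : -1 <= x -> x <= y -> y <= 1 -> (forall z, x < z < y -> `|hstar z : R| = 1) ->
      J (fun z => `|psi0 z|) x y = 2^-1 * (y - x).
    move=> x1 xy y1 H; rewrite -J_cst//; apply: J_eqoo => //.
      by apply: integ_norm; apply: integ_sub p0i.
    by move=> z zxy; rewrite ps normrM H// mulr1 ger0_norm.
  rewrite !half//; first by field.
  - move=> z z0; rewrite hstarE !indicE.
    rewrite (_ : z \in IR = true); last by apply/idP; rewrite inE/IR/= in_itv/=; lra.
    rewrite (_ : z \in IL = false) ?sub0r ?normrN ?normr1//; apply/negP.
    by rewrite inE/IL/= in_itv/=; lra.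
  - move=> z z0; rewrite hstarE !indicE.
    rewrite (_ : z \in IL = true); last by apply/idP; rewrite inE/IL/= in_itv/=; lra.
    rewrite (_ : z \in IR = false) ?subr0 ?normr1//; apply/negP.
    by rewrite inE/IR/= in_itv/=; lra.
have nE1 : `|nE - 1| <= 2 * t.
  rewrite -[X in nE - X]n0 /nE -JB; [|exact: integ_norm|exact: integ_norm].
  have i2 : integ (-1) 1 (fun x => `|E x| - `|psi0 x|).
    by apply: integB; exact: integ_norm.
  apply: le_trans (J_norm i2) _. apply: (le_trans _ cl).
  apply: J_le; [exact: integ_norm|exact: integ_norm|].
  by move=> x _; exact: ler_dist_dist.
have dB : integ (-1) 1 (psi w \- psi0) by exact: integB.
rewrite L1normE// lee_fin.
rewrite (@eqI_J _ _ (fun x => `|(c - 1) * E x + (E x - psi0 x)|))//; last 3 first.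
- by apply: measurableT_comp => //; exact: mi.
- by apply: measurableT_comp => //; apply: mi; apply: integD => //; exact: integZ.
- by apply: aeS pc => x H /H /= ->; congr (`|_|); ring.
have iz : integ (-1) 1 (fun x => `|c - 1| * `|E x|) by apply: integZ; exact: integ_norm.
apply: (@le_trans _ _ (J (fun x => `|c - 1| * `|E x| + `|E x - psi0 x|) (-1) 1)).
  apply: J_le.
  - by apply: integ_norm; apply: integD => //; exact: integZ.
  - by apply: integD => //; exact: integ_norm.
  - by move=> x _; rewrite (le_trans (ler_normD _ _))// normrM.
rewrite (JD iz (integ_norm di)) JZ; last exact: integ_norm.
rewrite -/nE.
have nE0 : 0 <= nE by rewrite -(pmulr_rge0 _ c0) cn.
(* From [c * nE = 1]: the error of the scalar equals the error of the norm of [E] against that of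
   [psi0], which is 1. *)
have -> : `|c - 1| * nE = `|nE - 1|.
  rewrite -{1}(ger0_norm nE0) -normrM mulrBl cn mul1r; exact: distrC.
lra.
Qed.

End fixed_parameter.

Unset Implicit Arguments.

(* For each eps, the hypotheses determine psi eps w only up to a P-null set of w
   that may depend on eps. Convergence for P-a.e. w along the uncountable family
   eps -> 0 is therefore meant for a version psi' of the family. *)
Theorem theorem8p2 (R : realType) (d : measure_display)
  (Omega : measurableType d) (P : probability Omega R)
  (sigma : Omega -> Omega) (a b : Omega -> R)
  (ma : measurable_fun setT a) (mb : measurable_fun setT b)
  (a01 : forall w, 0 <= a w <= 1) (b01 : forall w, 0 <= b w <= 1)
  (ab_neq0 : (\int[P]_w (a w + b w)%:E)%E <> 0%E)
  (sigma_mp : measure_preserving P sigma)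
  (sigma_erg : ergodic P sigma)
  (sigma_inv : invertible sigma)
  (T : R -> Omega -> R -> R)
  (T_def : forall eps w, T eps w = tent (eps * a w) (eps * b w))
  (T_finite : forall eps : R, 0 <= eps -> finite_set (range (T eps)))
  (T_meas : forall eps : R, 0 <= eps ->
     measurable_fun (setT `*` II)
       (fun z : Omega * R => (sigma z.1, T eps z.1 z.2)))
  (L : R -> Omega -> (R -> R) -> (R -> R))
  (L_def : forall eps w, L eps w = transfer (T eps w))
  (S : R -> @splitting R d Omega)
  (S_oseledets : \forall eps \near 0^'+,
     [/\ is_oseledets_splitting P sigma (L eps) (S eps),
         has_index (S eps) 1,
         mult (S eps) 0 = 1%N /\ expo (S eps) 0 = 0 &
         mult (S eps) 1 = 1%N /\ expo (S eps) 1 < 0])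
  (psi : R -> Omega -> R -> R)
  (psi_span : \forall eps \near 0^'+, \forall w \ae P,
     is_basis (spaceV (S eps) 1 w) (fun _ : 'I_1 => psi eps w))
  (psi_norm : \forall eps \near 0^'+, \forall w \ae P,
     L1norm (psi eps w) = 1%E)
  (psi_sign : \forall eps \near 0^'+, \forall w \ae P,
     (0 < \int[@lebesgue_measure R]_(x in IL) (psi eps w x)%:E)%E) :
  exists psi' : R -> Omega -> R -> R,
    (forall eps : R, 0 < eps -> \forall w \ae P, psi' eps w = psi eps w) /\
    (\forall w \ae P,
       L1norm (psi' eps w \- psi0) @[eps --> 0^'+] --> 0%E).
Proof.
have close (t : R) : 0 < t <= 1 -> \forall eps \near 0^'+, \forall w \ae P,
    (L1norm (psi eps w \- psi0)%R <= (4 * t)%:E)%E.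
  move=> t01; have [k [eps0 [/andP[e0 e1] dir]]] := direction t01.
  near=> eps.
  have epos : 0 < eps by near: eps; exact: nbhs_right_gt.
  have ele : eps <= eps0 by near: eps; exact: nbhs_right_le.
  have eps1 : 0 <= eps <= 1000^-1 by rewrite ltW//= (le_trans ele).
  have eps01 : 0 <= eps <= 1 by lra.
  have epsE : 0 <= eps <= eps0 by rewrite ltW.
  have LE w : L eps w = transfer (tent (eps * a w) (eps * b w)) by rewrite L_def T_def.
  have [Sos i1 [m0 _] [m1 x1]] : [/\ is_oseledets_splitting P sigma (L eps) (S eps),
      has_index (S eps) 1, mult (S eps) 0 = 1%N /\ expo (S eps) 0 = 0 &
      mult (S eps) 1 = 1%N /\ expo (S eps) 1 < 0] by near: eps.
  apply: (@uniform_close _ _ _ P sigma sigma_mp a b eps t k eps1 a01 b01 t01 _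
    (L eps) LE (S eps) Sos i1 m0 m1 x1 (psi eps)).
  - move=> w n h; apply: (dir eps) => //.
    exact: params_small.
  - by near: eps.
  - by near: eps.
  - by near: eps.
pose good (eps : R) (n : nat) (w : Omega) : Prop :=
  (L1norm (psi eps w \- psi0)%R <= (n.+1%:R^-1)%:E)%E.
(* For each [eps], validity is a countable family of implications, each true almost everywhere, so
   it excludes only a null set. There [psi'] is set to [psi0], and convergence then holds at every
   [w]. *)
pose valid (eps : R) (w : Omega) : Prop :=
  forall n, (\forall w' \ae P, good eps n w') -> good eps n w.
pose psi' (eps : R) (w : Omega) : R -> R :=
  if pselect (valid eps w) then psi eps w else psi0.
exists psi'; split.
  move=> eps _.
  have : \forall w \ae P, valid eps w.
    apply/ae_foralln => n.
    have [H|H] := pselect (\forall w' \ae P, good eps n w').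
      by apply: filterS H => w + _.
    by apply: aeW => w /H.
  by apply: filterS => w vw; rewrite /psi'; case: pselect.
apply: aeW => w.
have psi00 : L1norm (psi0 \- psi0 : R -> R) = 0%E.
  rewrite /L1norm (eq_integral (cst 0%E)) ?integral0// => x _ /=.
  by rewrite subrr normr0.
have L0 f : (0 <= L1norm (f : R -> R))%E.
  by apply: integral_ge0 => x _; rewrite lee_fin.
have bound (n : nat) : \forall eps \near 0^'+,
    (L1norm (psi' eps w \- psi0)%R <= (n.+1%:R^-1)%:E)%E.
  have n0 : 0 < (n.+1%:R : R) by [].
  have n1 : 1 <= (n.+1%:R : R) by rewrite ler1n.
  have n4 : 0 < 4 * n.+1%:R :> R by lra.
  (* The tolerance offsets the factor 4 of [close], so that the bound is exactly the threshold in
     [good]. *)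
  have t01 : 0 < (4 * n.+1%:R : R)^-1 <= 1.
    by apply/andP; split; [rewrite invr_gt0|rewrite invf_le1//; lra].
  apply: filterS (close _ t01) => eps ae_eps.
  rewrite /psi'; case: pselect => [v|nv]; last by rewrite psi00 lee_fin invr_ge0.
  apply: v; apply: filterS ae_eps => w'.
  by rewrite /good invfM mulrA mulfV ?mul1r// pnatr_eq0.
have fin (eps : R) (r : R) : (L1norm (psi' eps w \- psi0)%R <= r%:E)%E ->
    L1norm (psi' eps w \- psi0)%R \is a fin_num.
  by move=> H; rewrite ge0_fin_numE// (le_lt_trans H)// ltry.
apply/fine_cvgP; split.
  by apply: filterS (bound 0%N) => eps; exact: fin.
apply/cvgrPdist_le => e e0.
have [n ne] : exists n : nat, n.+1%:R^-1 <= e.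
  exists (Num.truncn e^-1); rewrite -[leRHS]invrK lef_pV2 ?posrE ?invr_gt0//.
  exact/ltW/truncnS_gt.
apply: filterS (bound n) => eps H /=.
rewrite sub0r normrN ger0_norm ?fine_ge0//.
by rewrite -lee_fin fineK ?(fin _ _ H)// (le_trans H)// lee_fin.
Unshelve. all: by end_near. Qed.
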